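(* Let $M$ be a matroid. Then $M$ is representable over $\mathrm{GF}(4)\otimes\mathbb{H}_2$ if and only if $M$ is representable over $\mathbb{K}_2$.
   Context: For a commutative ring $R$ and $S\subseteq R^*$, the partial field $\mathbb{P}(R,S)$ has underlying set $\langle S\cup\{-1\}\rangle\cup\{0\}$ (the multiplicative subgroup generated, together with $0$), multiplication as in $R$, and $p+q$ defined exactly when the ring sum lies in this set. A matrix over such a partial field $\mathbb{P}$ is a $\mathbb{P}$-matrix if all its square subdeterminants are defined (for $\mathbb{P}(R,S)$: lie in the underlying set); a matroid is $\mathbb{P}$-representable if it is the matroid $M[A]$ of a full-row-rank $\mathbb{P}$-matrix $A$ whose bases are the column sets indexing nonsingular maximal square submatrices. Fields are partial fields. $\mathbb{H}_2=\mathbb{P}(\mathbb{C},\{i,1-i\})$ with $i^2=-1$. $\mathbb{K}_2=\mathbb{P}(\mathbb{Q}(\alpha),\{\alpha,\alpha-1,\alpha^2-1\})$ with $\alpha$ an indeterminate. For partial fields $\mathbb{P}_1,\mathbb{P}_2$, the direct product $\mathbb{P}_1\otimes\mathbb{P}_2$ has elements $(p_1,p_2)$ with $p_1\ne0$ iff $p_2\ne0$, componentwise multiplication, and $(p_1,p_2)+(q_1,q_2)\doteq(p_1+q_1,p_2+q_2)$ iff both component sums are defined and $p_1+q_1=0$ iff $p_2+q_2=0$. *)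

(* Defs.v *)
From HB Require Import structures.
From mathcomp Require Import all_boot all_order all_algebra.
From mathcomp Require Import fraction complex reals.

Set Implicit Arguments.
Unset Strict Implicit.
Unset Printing Implicit Defensive.

Import Order.TTheory GRing.Theory Num.Theory.
Local Open Scope ring_scope.

Record matroid (E : finType) := Matroid {
  bases : {set {set E}};
  bases_neq0 : bases != set0;
  bases_exchange : forall B1 B2 : {set E}, B1 \in bases -> B2 \in bases ->
    forall x, x \in B1 :\: B2 ->
      exists2 y, y \in B2 :\: B1 & y |: (B1 :\ x) \in bases
}.

(* Every partial field considered here sits inside a commutative ring: it is  *)
(* given by that ring and its set of elements, with the ring multiplication,  *)
(* and a ring sum is a defined sum exactly when it is again an element.       *)
(* Likewise a determinant is defined when its value in the ring is an element.*)
Record partialField := PartialField {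
  pf_ring :> comUnitRingType;
  pf_elt : pf_ring -> Prop;
  pf_elt0 : pf_elt 0;
  pf_elt1 : pf_elt 1;
  pf_eltN : forall x, pf_elt x -> pf_elt (- x);
  pf_eltM : forall x y, pf_elt x -> pf_elt y -> pf_elt (x * y);
  pf_unit : forall x, pf_elt x -> x != 0 -> x \is a GRing.unit;
  pf_eltV : forall x, pf_elt x -> x != 0 -> pf_elt x^-1
}.

Definition pf_sum_defined (P : partialField) (p q : P) : Prop := pf_elt (p + q).

Section Constructions.

Inductive gen_subgroup (R : comUnitRingType) (S : {pred R}) : R -> Prop :=
| gen_in x : x \in S -> gen_subgroup S x
| genN1 : gen_subgroup S (-1)
| gen1 : gen_subgroup S 1
| genM x y : gen_subgroup S x -> gen_subgroup S y -> gen_subgroup S (x * y)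
| genV x : gen_subgroup S x -> gen_subgroup S x^-1.

Section PRS.
Variables (R : comUnitRingType) (S : {pred R}).
Hypothesis S_unit : {subset S <= GRing.unit}.

Definition PRS_elt (x : R) : Prop := x = 0 \/ gen_subgroup S x.

Lemma gen_unit x : gen_subgroup S x -> x \is a GRing.unit.
Proof.
elim=> {x} [x /S_unit //||| x y _ ux _ uy | x _ ux].
- by rewrite unitrN1.
- exact: unitr1.
- by rewrite unitrM ux.
- by rewrite unitrV.
Qed.

Lemma PRS_eltM x y : PRS_elt x -> PRS_elt y -> PRS_elt (x * y).
Proof.
case=> [->|gx]; first by rewrite mul0r; left.
case=> [->|gy]; first by rewrite mulr0; left.
by right; apply: genM.
Qed.

Lemma PRS_eltN x : PRS_elt x -> PRS_elt (- x).
Proof. by move=> Px; rewrite -mulN1r; apply: PRS_eltM => //; right; apply: genN1. Qed.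

Lemma PRS_unit x : PRS_elt x -> x != 0 -> x \is a GRing.unit.
Proof. by case=> [->|gx _]; [rewrite eqxx | apply: gen_unit]. Qed.

Lemma PRS_eltV x : PRS_elt x -> x != 0 -> PRS_elt x^-1.
Proof. by case=> [->|gx _]; [rewrite eqxx | right; apply: genV]. Qed.

Definition PRS : partialField :=
  @PartialField R PRS_elt (or_introl erefl) (or_intror (gen1 S))
    PRS_eltN PRS_eltM PRS_unit PRS_eltV.

End PRS.

Definition pf_of_field (F : fieldType) : partialField :=
  @PartialField F (fun _ => True) I I (fun _ _ => I) (fun _ _ _ _ => I)
    (fun x _ nz_x => etrans (unitfE x) nz_x) (fun _ _ _ => I).

Section Product.
Variables P1 P2 : partialField.

Definition prod_elt (p : P1 * P2) : Prop :=
  [/\ pf_elt p.1, pf_elt p.2 & (p.1 != 0) = (p.2 != 0)].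

Lemma prod_elt0 : prod_elt 0.
Proof. by split; [apply: pf_elt0 | apply: pf_elt0 | rewrite !eqxx]. Qed.

Lemma prod_elt1 : prod_elt 1.
Proof. by split; [apply: pf_elt1 | apply: pf_elt1 | rewrite !oner_neq0]. Qed.

Lemma prod_eltN x : prod_elt x -> prod_elt (- x).
Proof. by case=> *; split; rewrite /= ?oppr_eq0 //; apply: pf_eltN. Qed.

Lemma pf_mulf_neq0 (P : partialField) (x y : P) :
  pf_elt x -> pf_elt y -> (x * y != 0) = (x != 0) && (y != 0).
Proof.
move=> Px Py; have [->|nzx] := eqVneq x 0; first by rewrite mul0r eqxx.
have ux := pf_unit Px nzx.
by rewrite -[in LHS](mulr0 x) (inj_eq (mulrI ux)).
Qed.

Lemma prod_eltM x y : prod_elt x -> prod_elt y -> prod_elt (x * y).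
Proof.
case=> x1 x2 ex [y1 y2 ey]; split; try exact: pf_eltM.
by rewrite /= !pf_mulf_neq0 // ex ey.
Qed.

Lemma prod_neq0 (x : P1 * P2) :
  prod_elt x -> x != 0 -> x.1 != 0 /\ x.2 != 0.
Proof.
case: x => x1 x2 [/= _ _ e]; rewrite xpair_eqE negb_and -e.
by case: (x1 != 0).
Qed.

Lemma prod_unit (x : (P1 * P2)%type) :
  prod_elt x -> x != 0 -> x \is a GRing.unit.
Proof.
move=> Px nzx; have [nz1 nz2] := prod_neq0 Px nzx.
case: Px => e1 e2 _; apply/andP.
by split; apply: pf_unit.
Qed.

Lemma prod_eltV (x : (P1 * P2)%type) :
  prod_elt x -> x != 0 -> prod_elt x^-1.
Proof.
move=> Px nzx; have [nz1 nz2] := prod_neq0 Px nzx.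
have ux := prod_unit Px nzx.
have e : x^-1 = (x.1^-1, x.2^-1).
  case: (Px) => e1 e2 _; apply: (mulrI ux); rewrite divrr //.
  by congr pair; rewrite /= divrr //; apply: pf_unit.
case: Px => e1 e2 _; rewrite e; split => /=; try exact: pf_eltV.
by rewrite !invr_eq0 nz1 nz2.
Qed.

Definition pf_prod : partialField :=
  @PartialField (P1 * P2)%type prod_elt prod_elt0 prod_elt1
    prod_eltN prod_eltM prod_unit prod_eltV.

Lemma prod_sum_definedE (p q : pf_prod) :
  pf_sum_defined p q <->
  [/\ pf_sum_defined p.1 q.1, pf_sum_defined p.2 q.2
    & p.1 + q.1 = 0 <-> p.2 + q.2 = 0].
Proof.
split; case=> h1 h2 h; split=> //.
  by split=> /eqP h'; apply/eqP; move: h; rewrite /= h'; case: eqP.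
by apply/idP/idP; apply: contra => /eqP h'; apply/eqP; apply/h.
Qed.

End Product.

End Constructions.

Section Representability.
Variable P : partialField.

(* The case [k = 1] says that the entries of [A] are elements of [P].         *)
Definition is_pmatrix m n (A : 'M[P]_(m, n)) : Prop :=
  forall k (f : 'I_k -> 'I_m) (g : 'I_k -> 'I_n),
    injective f -> injective g -> pf_elt (\det (mxsub f g A)).

Definition full_row_rank m n (A : 'M[P]_(m, n)) : Prop :=
  exists2 g : 'I_m -> 'I_n, injective g & \det (colsub g A) != 0.

(* Column [j] of [A] is labelled by the element [enum_val j] of [E].          *)
Definition col_basis (E : finType) m (A : 'M[P]_(m, #|E|)) (B : {set E}) : Prop :=
  exists g : 'I_m -> 'I_#|E|,
    [/\ injective g, B = [set enum_val (g i) | i : 'I_m]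
      & \det (colsub g A) != 0].

Definition representable (E : finType) (M : matroid E) : Prop :=
  exists m (A : 'M[P]_(m, #|E|)),
    [/\ is_pmatrix A, full_row_rank A
      & forall B : {set E}, B \in bases M <-> col_basis A B].

End Representability.

Section H2.
Variable R : realType.

Definition H2_gens : {pred R[i]} := [pred x in [:: 'i%C; 1 - 'i%C]].

Lemma H2_gens_unit : {subset H2_gens <= GRing.unit}.
Proof.
move=> x; rewrite !inE => /orP[]/eqP->; rewrite unitfE.
  by apply/eqP=> -[/eqP]; rewrite oner_eq0.
by apply/eqP=> -[/eqP]; rewrite subr0 oner_eq0.
Qed.

Definition H2 : partialField := PRS H2_gens_unit.

End H2.

Definition alpha : {fraction {poly rat}} := FracField.tofrac 'X.

Definition K2_gens : {pred {fraction {poly rat}}} :=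
  [pred x in [:: alpha; alpha - 1; alpha ^+ 2 - 1]].

Lemma K2_gens_unit : {subset K2_gens <= GRing.unit}.
Proof.
have inj p : p != 0 -> FracField.tofrac p \is a @GRing.unit {fraction {poly rat}}.
  by rewrite unitfE tofrac_eq0.
move=> x; rewrite !inE /alpha -!tofracXn -!tofrac1 -!tofracB.
case/or3P=> /eqP->; apply: inj.
- by rewrite polyX_eq0.
- by rewrite -polyC1 polyXsubC_eq0.
- by rewrite -size_poly_eq0 -polyC1 size_XnsubC.
Qed.

Definition K2 : partialField := PRS K2_gens_unit.

(* Main.v *)
(* The theorem is an instance of a lifting principle for matrices over partial   *)
(* fields, in the style of Gerards' proof of Tutte's theorem.  Let [pi] be a     *)
(* ring morphism from a partial field Q to a partial field P such that every     *)
(* cross-ratio of P (an element [p] with [p] and [1 - p] in P) lifts uniquely to *)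
(* a cross-ratio of Q, compatibly with quotients, and such that 2 is not in P.   *)
(* Then every P-matrix is the image of a Q-matrix.  By induction on the number   *)
(* of rows and columns: remove either of two columns (or two rows) whose         *)
(* removal leaves the bipartite graph of nonzero entries connected.  Lifts of    *)
(* connected matrices are unique up to scaling, so the two lifts obtained by     *)
(* induction can be glued; a subdeterminant of the glued matrix can only fail to *)
(* lift if it involves both columns, and pivoting reduces it to a 2 x 2          *)
(* determinant in rows a, b, joined by a path in the graph.  Pivoting again      *)
(* shortens the path to length 2 (five points on a line) or 4 (a configuration   *)
(* of rank 3, where the only obstruction is a Fano plane, hence a determinant 2).*)
(* Here P is the product of GF(4) and H2, and Q is generated, inside the product *)
(* of Q(alpha) with the ring of P, by the pairs (x, phi x) where phi sends alpha *)
(* to (omega, i).  Projecting Q-matrices to Q(alpha) gives K2-matrices.          *)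
(* Conversely the entries of a K2-matrix become polynomials in alpha after       *)
(* scaling, and these can be evaluated at (alpha, (omega, i)).                   *)

(* The signed monomials in [t], [t - 1], [t + 1] are read at three places: at [alpha] they are the
   nonzero elements of [K2], at [(w, i)] they fill those of the product of GF(4) and [H2]
   ([proj_onto]), and at the pair of both they form [liftPF]. Neither projection from [liftPF] kills
   a nonzero element ([pi_neq0], [fst_neq0]), so a matrix over [liftPF] and its two images have the
   same nonsingular maximal submatrices, and [representable_transfer] passes between them.

   In the other direction [has_lift_on] lifts matrices along any [lift_map]. A vertex of degree at
   most 1 is harmless ([has_lift_leaf]); a vertex of degree at least 3 provides two lines of the
   same kind whose removal keeps the graph connected ([has_lift_deg3]); a cycle is a quadrilateral
   or acquires such a vertex by a pivot ([has_lift_cycle]). Gluing rests on [lifts_unique] and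
   [two_columns_lift]. Both shorten walks by pivoting until a statement about a few scalars remains:
   [cross_ratio_uniq], [minor_lift] or [rank3_minor_lift].

   The hypotheses are checked in [lift_proj_lift_map]. Over [alpha], solving three-term relations
   between monomials ([solve1]) leaves 18 cross-ratios besides 0 and 1 ([fundamental_alpha]). In the
   product, the norm on [H2] reduces all cross-ratios to six ([proj_fund]). Uniqueness and
   compatibility are then finite checks on exponents ([fundamental_inj], [fundamental_mul]). *)
From HB Require Import structures.
Require Import Defs.
From mathcomp Require Import all_boot all_order all_algebra.
From mathcomp Require Import fraction finfield complex reals ring zify.

Set Implicit Arguments.
Unset Strict Implicit.
Unset Printing Implicit Defensive.

Import Order.TTheory GRing.Theory Num.Theory.
Local Open Scope ring_scope.

(** * Determinants and pivoting *)

Section Determinants.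
Variable R : comNzRingType.

Lemma det_mxsub_row_noninj m n k (A : 'M[R]_(m, n)) (f : 'I_k -> 'I_m)
  (g : 'I_k -> 'I_n) : ~~ injectiveb f -> \det (mxsub f g A) = 0.
Proof.
move=> /injectivePn[i [j neq_ij eq_f]]; apply: (determinant_alternate neq_ij) => l.
by rewrite !mxE eq_f.
Qed.

Lemma det_mxsub_tr m n k (A : 'M[R]_(m, n)) (f : 'I_k -> 'I_m) (g : 'I_k -> 'I_n) :
  \det (mxsub g f A^T) = \det (mxsub f g A).
Proof. by rewrite -trmx_mxsub det_tr. Qed.

Lemma det_mxsub_col_noninj m n k (A : 'M[R]_(m, n)) (f : 'I_k -> 'I_m)
  (g : 'I_k -> 'I_n) : ~~ injectiveb g -> \det (mxsub f g A) = 0.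
Proof. by rewrite -det_mxsub_tr; apply: det_mxsub_row_noninj. Qed.

(** Multiplying by this matrix on the left scales row [i] by [w i] and adds [w r] times row [i] to
    each other row [r]: a whole elimination step with determinant [w i]. *)
Definition repl_col_mx k (i : 'I_k) (w : 'I_k -> R) : 'M[R]_k :=
  \matrix_(r, s) (if s == i then w r else (r == s)%:R).

Lemma det_repl_col_mx k (i : 'I_k) w : \det (repl_col_mx i w) = w i.
Proof.
rewrite (expand_det_row _ i) (bigD1 i) //= big1 => [|j neq_ji].
  rewrite addr0 mxE eqxx /cofactor addnn -signr_odd odd_double mul1r.
  rewrite (_ : row' _ _ = 1%:M) ?det1 ?mulr1 //.
  apply/matrixP=> r s; rewrite !mxE eq_sym (negPf (neq_lift _ _)).
  by rewrite (inj_eq lift_inj).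
by rewrite mxE (negPf neq_ji) eq_sym (negPf neq_ji) mul0r.
Qed.

Lemma repl_col_mxM k l (i : 'I_k) w (M : 'M[R]_(k, l)) r c :
  (repl_col_mx i w *m M) r c =
  if r == i then w i * M i c else M r c + w r * M i c.
Proof.
rewrite mxE (bigD1 i) //= mxE eqxx.
have [->|neq_ri] := eqVneq r i.
  rewrite big1 ?addr0 // => j neq_ji.
  by rewrite mxE (negPf neq_ji) eq_sym (negPf neq_ji) mul0r.
rewrite addrC; congr (_ + _); rewrite (bigD1 r) //= mxE (negPf neq_ri) eqxx mul1r.
rewrite big1 ?addr0 // => j /andP[neq_ji neq_jr].
by rewrite mxE (negPf neq_ji) eq_sym (negPf neq_jr) mul0r.
Qed.

Lemma det_single_col k (M : 'M[R]_k) i j :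
  (forall r, r != i -> M r j = 0) ->
  \det M = M i j * ((-1) ^+ (i + j) * \det (row' i (col' j M))).
Proof.
move=> M0; rewrite (expand_det_col _ j) (bigD1 i) //= big1 ?addr0 //.
by move=> r /M0->; rewrite mul0r.
Qed.

Lemma row'_col'_mxsub m n k (A : 'M[R]_(m, n)) (f : 'I_k -> 'I_m)
    (g : 'I_k -> 'I_n) i j :
  row' i (col' j (mxsub f g A)) = mxsub (f \o lift i) (g \o lift j) A.
Proof. by apply/matrixP=> r s; rewrite !mxE. Qed.

Definition pair_fun T (x y : T) (i : 'I_2) := if i == ord0 then x else y.

Lemma det2E (M : 'M[R]_2) :
  \det M = M ord0 ord0 * M 1 1 - M ord0 1 * M 1 ord0.
Proof.
rewrite (expand_det_row _ ord0) !big_ord_recl big_ord0 /cofactor !det_mx11 !mxE /=.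
rewrite addr0 expr0 expr1 mul1r mulN1r mulrN; congr (_ * _ - _ * _);
  by congr (M _ _); apply: val_inj.
Qed.

Lemma det_minor2 m n (A : 'M[R]_(m, n)) x x' y y' :
  \det (mxsub (pair_fun x x') (pair_fun y y') A) =
  A x y * A x' y' - A x y' * A x' y.
Proof. by rewrite det2E !mxE. Qed.

Lemma det_minor1 m n (A : 'M[R]_(m, n)) x y :
  \det (mxsub (fun _ : 'I_1 => x) (fun _ => y) A) = A x y.
Proof. by rewrite det_mx11 mxE. Qed.

Definition triple_fun T (x y z : T) (i : 'I_3) :=
  if i == ord0 then x else if i == 1 then y else z.

Lemma det_minor3 m n (A : 'M[R]_(m, n)) x x' x'' y y' y'' :
  \det (mxsub (triple_fun x x' x'') (triple_fun y y' y'') A) =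
  A x y * (A x' y' * A x'' y'' - A x' y'' * A x'' y')
  - A x y' * (A x' y * A x'' y'' - A x' y'' * A x'' y)
  + A x y'' * (A x' y * A x'' y' - A x' y' * A x'' y).
Proof.
rewrite (expand_det_row _ ord0) !big_ord_recl big_ord0 /cofactor !det2E.
rewrite !mxE /= /triple_fun /= /bump /=.
by ring.
Qed.

End Determinants.

Section PivotMatrix.
Variable R : comUnitRingType.

(* The sign of the pivot entry makes pivoting commute with transposition; the    *)
(* price is that pivoting twice gives the identity only up to signs.             *)
Definition pivot m n (A : 'M[R]_(m, n)) x0 y0 : 'M[R]_(m, n) :=
  \matrix_(x, y)
    (if x == x0 then
       if y == y0 then - (A x0 y0)^-1 else A x0 y / A x0 y0
     else if y == y0 then A x y0 / A x0 y0
     else A x y - A x y0 * A x0 y / A x0 y0).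

Lemma pivot_tr m n (A : 'M[R]_(m, n)) x0 y0 : (pivot A x0 y0)^T = pivot A^T y0 x0.
Proof.
apply/matrixP=> y x; rewrite !mxE; rewrite [A x y0 * A x0 y]mulrC.
by case: (x == x0); case: (y == y0).
Qed.

Lemma pivotK m n (A : 'M[R]_(m, n)) x0 y0 : A x0 y0 \is a GRing.unit ->
  pivot (pivot A x0 y0) x0 y0 =
  \matrix_(x, y) ((-1) ^+ (x == x0) * (-1) ^+ (y == y0) * A x y).
Proof.
move=> ua; apply/matrixP=> x y; rewrite !mxE !eqxx !invrN invrK.
have [->|nx] := eqVneq x x0; have [->|ny] := eqVneq y y0;
  rewrite ?expr0 ?expr1 ?mul1r ?mulr1 ?mulN1r ?opprK // ?mulrN ?divrK //.
  by rewrite mul1r.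
by rewrite opprK -(mulrA (_ / _)) divrK // mulrAC addrNK.
Qed.

(** Eliminating column [g j] with row [f i] leaves the Schur complement, which is the part of the
    pivot outside the pivot row and column. *)
Lemma det_mxsub_pivot m n (A : 'M[R]_(m, n)) k (f : 'I_k -> 'I_m) (g : 'I_k -> 'I_n) i j :
  injective f -> injective g -> A (f i) (g j) \is a GRing.unit ->
  \det (mxsub f g A) = A (f i) (g j) * ((-1) ^+ (i + j) *
    \det (mxsub (f \o lift i) (g \o lift j) (pivot A (f i) (g j)))).
Proof.
move=> injf injg ua; set a := A _ _ in ua *.
pose w r := if r == i then 1 else - (A (f r) (g j) / a).
have -> : \det (mxsub f g A) = \det (repl_col_mx i w *m mxsub f g A).
  by rewrite det_mulmx det_repl_col_mx /w eqxx mul1r.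
rewrite (@det_single_col _ _ _ i j) => [|r ri]; rewrite repl_col_mxM !mxE.
  rewrite eqxx /w eqxx mul1r -/a; congr (_ * (_ * \det _)).
  apply/matrixP=> r s; rewrite [LHS]mxE [LHS]mxE repl_col_mxM !mxE.
  rewrite !(inj_eq injf, inj_eq injg) !(eq_sym (lift _ _)) !(negPf (neq_lift _ _)).
  by rewrite mulNr mulrAC.
by rewrite (negPf ri) /w (negPf ri) mulNr -/a divrK // subrr.
Qed.

Lemma det_mxsub_pivot_row m n (A : 'M[R]_(m, n)) k (f : 'I_k -> 'I_m) (g : 'I_k -> 'I_n) i y0 :
  injective f -> (forall j, g j != y0) -> A (f i) y0 \is a GRing.unit ->
  \det (mxsub f g (pivot A (f i) y0)) = (A (f i) y0)^-1 * \det (mxsub f g A).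
Proof.
move=> injf ng ua; set a := A _ _ in ua *.
pose w r := if r == i then a^-1 else - (A (f r) y0 / a).
have <- : \det (repl_col_mx i w) = a^-1 by rewrite det_repl_col_mx /w eqxx.
rewrite -det_mulmx; congr (\det _); apply/matrixP=> r s.
rewrite repl_col_mxM !mxE (negPf (ng _)) (inj_eq injf) /w eqxx.
case: eqVneq => _; first by rewrite mulrC.
by rewrite mulNr mulrAC.
Qed.

(** The elimination is undone: adding multiples of the pivot row clears the pivot column and
    restores the original entries elsewhere. *)
Lemma det_mxsub_pivot_both m n (A : 'M[R]_(m, n)) k (f : 'I_k -> 'I_m) (g : 'I_k -> 'I_n) i j :
  injective f -> injective g -> A (f i) (g j) \is a GRing.unit ->
  \det (mxsub f g (pivot A (f i) (g j))) = - (A (f i) (g j))^-1 *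
   ((-1) ^+ (i + j) * \det (mxsub (f \o lift i) (g \o lift j) A)).
Proof.
move=> injf injg ua; set a := A _ _ in ua *.
pose w r := if r == i then 1 else A (f r) (g j).
set B := mxsub _ _ (pivot _ _ _).
have -> : \det B = \det (repl_col_mx i w *m B).
  by rewrite det_mulmx det_repl_col_mx /w eqxx mul1r.
rewrite (@det_single_col _ _ _ i j) => [|r ri]; rewrite repl_col_mxM !mxE.
  rewrite !eqxx /w eqxx mul1r -/a; congr (_ * (_ * \det _)).
  apply/matrixP=> r s; rewrite [LHS]mxE [LHS]mxE repl_col_mxM !mxE eqxx.
  rewrite !(inj_eq injf, inj_eq injg) !(eq_sym (lift _ _)) !(negPf (neq_lift _ _)).
  by rewrite /w eqxx mulrA addrNK.
by rewrite (negPf ri) !(inj_eq injf, eqxx) /w (negPf ri) -/a mulrN subrr.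
Qed.

End PivotMatrix.

(** * Matrices with all minors in a partial field, restricted to a set of rows and columns *)

Section MinorClosed.
Variable P : partialField.

Definition flip m n (v : 'I_m + 'I_n) : 'I_n + 'I_m :=
  match v with inl x => inr x | inr y => inl y end.

Lemma flipK m n : cancel (@flip m n) (@flip n m).
Proof. by case. Qed.

Definition flip_set m n (S : {set 'I_m + 'I_n}) : {set 'I_n + 'I_m} := @flip n m @^-1: S.

Lemma in_flip_set m n (S : {set 'I_m + 'I_n}) v : (v \in flip_set S) = (flip v \in S).
Proof. by rewrite inE. Qed.

Lemma flip_setK m n (S : {set 'I_m + 'I_n}) : flip_set (flip_set S) = S.
Proof. by apply/setP=> v; rewrite !in_flip_set flipK. Qed.

(** The submatrix is given by a set of vertices of the bipartite graph ([inl] for rows, [inr] for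
    columns), so that deleting a row or column needs no reindexing. *)
Definition pmat_on m n (S : {set 'I_m + 'I_n}) (A : 'M[P]_(m, n)) :=
  forall k (f : 'I_k -> 'I_m) (g : 'I_k -> 'I_n), injective f -> injective g ->
    (forall i, inl (f i) \in S) -> (forall i, inr (g i) \in S) ->
    pf_elt (\det (mxsub f g A)).

Section Basics.
Variables (m n : nat) (S : {set 'I_m + 'I_n}) (A : 'M[P]_(m, n)).

Lemma pmat_on_minor : pmat_on S A ->
  forall k (f : 'I_k -> 'I_m) (g : 'I_k -> 'I_n),
    (forall i, inl (f i) \in S) -> (forall i, inr (g i) \in S) ->
    pf_elt (\det (mxsub f g A)).
Proof.
move=> pA k f g Sf Sg.
case injf: (injectiveb f); last first.
  by rewrite det_mxsub_row_noninj ?injf //; apply: pf_elt0.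
case injg: (injectiveb g); last first.
  by rewrite det_mxsub_col_noninj ?injg //; apply: pf_elt0.
by apply: pA => //; apply/injectiveP.
Qed.

Lemma pmat_on_sub (T : {set 'I_m + 'I_n}) : T \subset S -> pmat_on S A -> pmat_on T A.
Proof.
move=> /subsetP sTS pA k f g injf injg Sf Sg.
by apply: pA => // i; apply: sTS.
Qed.

Lemma pmat_on_tr : pmat_on S A -> pmat_on (flip_set S) A^T.
Proof.
move=> pA k f g injf injg Sf Sg; rewrite det_mxsub_tr.
by apply: pA => // i; [have := Sg i|have := Sf i]; rewrite in_flip_set.
Qed.

Lemma pmat_on_entry : pmat_on S A -> forall x y, inl x \in S -> inr y \in S ->
  pf_elt (A x y).
Proof. by move=> pA x y Sx Sy; rewrite -det_minor1; apply: pmat_on_minor. Qed.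

Lemma pmat_on_minor2 : pmat_on S A -> forall x x' y y',
  inl x \in S -> inl x' \in S -> inr y \in S -> inr y' \in S ->
  pf_elt (A x y * A x' y' - A x y' * A x' y).
Proof.
move=> pA x x' y y' Sx Sx' Sy Sy'; rewrite -det_minor2.
by apply: pmat_on_minor => // i; rewrite /pair_fun; case: ifP.
Qed.

Lemma pmat_on_minor3 : pmat_on S A -> forall x x' x'' y y' y'',
  inl x \in S -> inl x' \in S -> inl x'' \in S ->
  inr y \in S -> inr y' \in S -> inr y'' \in S ->
  pf_elt (A x y * (A x' y' * A x'' y'' - A x' y'' * A x'' y')
  - A x y' * (A x' y * A x'' y'' - A x' y'' * A x'' y)
  + A x y'' * (A x' y * A x'' y' - A x' y' * A x'' y)).
Proof.
move=> pA x x' x'' y y' y'' *; rewrite -det_minor3.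
by apply: pmat_on_minor => // i; rewrite /triple_fun; case: ifP => // _; case: ifP.
Qed.

End Basics.

Lemma pf_elt_sign (b : nat) x : @pf_elt P x -> pf_elt ((-1) ^+ b * x).
Proof.
move=> Px; rewrite -signr_odd; case: (odd b); rewrite ?expr0 ?mul1r //.
by rewrite expr1 mulN1r; apply: pf_eltN.
Qed.

Definition consf T k (x : T) (f : 'I_k -> T) (i : 'I_k.+1) : T :=
  if unlift ord0 i is Some j then f j else x.

Lemma consf0 T k (x : T) (f : 'I_k -> T) : consf x f ord0 = x.
Proof. by rewrite /consf unlift_none. Qed.

Lemma consf_lift T k (x : T) (f : 'I_k -> T) i : consf x f (lift ord0 i) = f i.
Proof. by rewrite /consf liftK. Qed.

Lemma consf_inj (T : eqType) k (x : T) (f : 'I_k -> T) :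
  injective f -> (forall i, f i != x) -> injective (consf x f).
Proof.
move=> injf nfx i j.
case: (unliftP ord0 i) => [i' ->|->]; case: (unliftP ord0 j) => [j' ->|->];
  rewrite ?consf_lift ?consf0 => // e.
- by congr (lift _ _); apply: injf.
- by have := nfx i'; rewrite e eqxx.
- by have := nfx j'; rewrite -e eqxx.
Qed.

(** Each minor of the pivot is a minor of [A] up to sign and division by the pivot entry. It loses
    the pivot row and column if it contains both, gains both if it contains neither, and keeps its
    rows and columns otherwise. *)
Lemma pmat_on_pivot m n (S : {set 'I_m + 'I_n}) (A : 'M[P]_(m, n)) x0 y0 :
  inl x0 \in S -> inr y0 \in S -> A x0 y0 != 0 ->
  pmat_on S A -> pmat_on S (pivot A x0 y0).
Proof.
move=> Sx0 Sy0 nz pA; have ua := pf_unit (pmat_on_entry pA Sx0 Sy0) nz.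
have eV := pf_eltV (pmat_on_entry pA Sx0 Sy0) nz.
move=> k f g injf injg Sf Sg.
have [/existsP[i /eqP fi]|/existsPn nf] := boolP [exists i, f i == x0];
have [/existsP[j /eqP gj]|/existsPn ng] := boolP [exists j, g j == y0].
- subst x0 y0; rewrite det_mxsub_pivot_both //.
  rewrite mulNr; apply/pf_eltN/pf_eltM => //; apply: pf_elt_sign.
  by apply: (pmat_on_minor pA) => r /=.
- subst x0; by rewrite det_mxsub_pivot_row //; apply: pf_eltM => //; apply: pA.
- subst y0; rewrite -det_mxsub_tr pivot_tr.
  rewrite det_mxsub_pivot_row ?mxE //.
  by rewrite det_mxsub_tr; apply: pf_eltM => //; apply: pA.
set a := A x0 y0 in nz ua eV.
have -> : \det (mxsub f g (pivot A x0 y0)) =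
   a^-1 * \det (mxsub (consf x0 f) (consf y0 g) A).
  rewrite (@det_mxsub_pivot _ _ _ _ _ _ _ ord0 ord0) ?consf0 //.
  - rewrite -/a mulrA mulVr // mul1r expr0 mul1r; congr (\det _).
    by apply/matrixP=> r q; rewrite !mxE /= !consf_lift.
  - by apply: consf_inj => // i; have /= -> := nf i.
  - by apply: consf_inj => // i; have /= -> := ng i.
apply: pf_eltM => //; apply: (pmat_on_minor pA) => i; case: (unliftP ord0 i) => [i' ->|->];
  by rewrite ?consf0 ?consf_lift.
Qed.

End MinorClosed.

(** * Connectivity *)

Section Graphs.
Variables (T : finType) (e : rel T).
Hypothesis e_sym : symmetric e.
Implicit Types (S L : {set T}) (v w z : T).

(* Connectedness as a statement about labellings constant along edges: in this   *)
(* form it is visibly preserved by pivoting.                                     *)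
Definition connected_in S :=
  forall p : T -> bool,
    {in S &, forall v w, e v w -> p v = p w} -> {in S &, forall v w, p v = p w}.

Fixpoint walk S k v w : bool :=
  if k is k'.+1 then [exists u in S, e v u && walk S k' u w] else v == w.

Lemma walk_ex S z : connected_in S -> z \in S -> forall v, v \in S -> exists k, walk S k v z.
Proof.
move=> cS Sz v Sv; pose r := [rel a b | e a b && (b \in S)].
have /connectP[s]: connect r v z.
  rewrite (cS (fun v => connect r v z) _ v z) ?connect0 // => a b Sa Sb ab.
  by apply/idP/idP=> /(connect_trans _)-> //; apply: connect1; rewrite /= ?ab // e_sym ab.
elim: s v {Sv} => [|u s IHs] v /=; first by exists 0%N => /=; apply/eqP.
case/andP=> /andP[vu Su] /IHs/[apply] -[k uz].
by exists k.+1; apply/exists_inP; exists u; rewrite // vu.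
Qed.

Definition is_level S z (d : T -> nat) :=
  [/\ d z = 0%N, {in S, forall v, d v = 0%N -> v = z},
      {in S, forall v, v != z -> exists2 w, w \in S & e v w /\ d v = (d w).+1}
    & {in S &, forall v w, e v w -> d v <= (d w).+1}%N].

Lemma level_ex S z : connected_in S -> z \in S -> exists d, is_level S z d.
Proof.
move=> cS Sz.
have /fin_all_exists[d dP]: forall v, exists n,
    v \in S -> walk S n v z /\ forall k, walk S k v z -> (n <= k)%N.
  move=> v; case: (boolP (v \in S)) => [Sv|]; last by exists 0%N.
  have exk := walk_ex cS Sz Sv; exists (ex_minn exk) => _.
  by case: ex_minnP.
have d0 v : v \in S -> d v = 0%N -> v = z.
  by move=> /dP[+ _] d0; rewrite d0 => /eqP.
exists d; split=> //.
- by apply/eqP; rewrite -leqn0; apply: (dP z Sz).2 => /=.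
- move=> v Sv nvz; have [+ dmin] := dP v Sv.
  case: (d v) dmin (d0 v Sv) => [|k] dmin; first by move=> /(_ erefl)/eqP; rewrite (negPf nvz).
  move=> _ /exists_inP[w Sw /andP[vw wz]]; exists w => //; split=> //.
  apply/eqP; rewrite eqSS eqn_leq ((dP w Sw).2 _ wz) andbT -ltnS.
  by apply: dmin; apply/exists_inP; exists w => //; rewrite vw; exact: (dP w Sw).1.
- move=> v w Sv Sw vw; apply: (dP v Sv).2; apply/exists_inP; exists w => //.
  by rewrite vw; exact: (dP w Sw).1.
Qed.

(** Descending level by level leads from any vertex to [z], along edges on which the labelling is
    constant. *)
Lemma connected_in_levels S z d : z \in S ->
  {in S, forall v, v != z -> exists2 w, w \in S & e v w /\ d v = (d w).+1} ->
  connected_in S.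
Proof.
move=> Sz par p pS.
suff pz v : v \in S -> p v = p z by move=> v w Sv Sw; rewrite !pz.
elim: {v}(d v) {-2}v (erefl (d v)) => [|k IHk] v dv Sv; have [->//|nvz] := eqVneq v z;
  have [w Sw [vw]] := par v Sv nvz; rewrite dv // => -[dw].
by rewrite (pS v w) // IHk.
Qed.

Lemma noncut_ex S z : connected_in S -> z \in S -> S != [set z] ->
  exists w, [/\ w \in S, w != z & connected_in (S :\ w)].
Proof.
move=> cS Sz nS; have [d [d0 _ par _]] := level_ex cS Sz.
have [w0]: exists w0, w0 \in S :\ z.
  apply/set0Pn; apply: contraNneq nS => S0; rewrite eqEsubset sub1set Sz andbT.
  by rewrite -setD_eq0 S0.
move=> Sw0; case: (@arg_maxnP _ w0 (fun v => v \in S :\ z) d Sw0) => w.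
rewrite !inE => /andP[wz Sw] wmax; exists w; split=> //.
apply: (@connected_in_levels _ z d); first by rewrite !inE Sz eq_sym wz.
move=> v; rewrite !inE => /andP[nvw Sv] nvz; have [u Su [vu du]] := par v Sv nvz.
exists u => //; rewrite !inE Su andbT; apply/eqP=> uw.
have := wmax v; rewrite !inE Sv nvz => /(_ isT).
by rewrite /= du uw /geq /= ltnn.
Qed.

(* The vertices found are leaves of a breadth-first tree with root [z], one      *)
(* below each of the three given neighbours.                                     *)
Lemma three_leaves S z y1 y2 y3 : connected_in S ->
  z \in S -> uniq [:: z; y1; y2; y3] ->
  {subset [:: y1; y2; y3] <= [pred y in S | e y z]} ->
  exists l1 l2 l3, [/\ uniq [:: l1; l2; l3], {subset [:: l1; l2; l3] <= S} &
    forall L, {subset L <= [:: l1; l2; l3]} -> connected_in (S :\: L)].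
Proof.
move=> cS Sz uy sy; have [d [d0 d0_eq par dle]] := level_ex cS Sz.
have /fin_all_exists[f fP]: forall v, exists w,
    v \in S -> v != z -> [/\ w \in S, e v w & d v = (d w).+1].
  move=> v; case: (boolP (v \in S)) => [Sv|]; last by exists z.
  case: (eqVneq v z) => [->|nvz]; first by exists z.
  by have [w Sw [vw dw]] := par v Sv nvz; exists w.
(* The ancestor of [v] on level 1, that is, the branch of the tree containing [v]. A deepest vertex
   of a branch is a leaf. *)
pose b v := iter (d v).-1 f v.
have bf v : v \in S -> v != z -> f v != z -> b v = b (f v).
  move=> Sv nvz nfz; have [Sf _ dv] := fP v Sv nvz; rewrite /b dv /=.
  case dfv: (d (f v)) => [|k]; last by rewrite iterSr.
  by rewrite (d0_eq _ Sf dfv) eqxx in nfz.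
have leaf y : y != z -> y \in S -> e y z -> exists l,
    [/\ l \in S, l != z, b l = y & forall v, v \in S -> v != z -> f v != l].
  move=> nyz Sy yz; pose B := [set v in S | (v != z) && (b v == y)].
  have By : y \in B.
    rewrite inE Sy nyz /b; suff -> : d y = 1%N by rewrite /= eqxx.
    apply/eqP; rewrite eqn_leq lt0n; have := dle y z Sy Sz yz; rewrite d0 => ->.
    by apply: contraNneq nyz => /(d0_eq _ Sy)->.
  case: (@arg_maxnP _ y (fun v => v \in B) d By) => l; rewrite inE => /and3P[Sl nlz /eqP bl] lmax.
  exists l; split=> // v Sv nvz; apply/eqP=> fvl.
  have [_ _ dv] := fP v Sv nvz.
  have := lmax v; rewrite inE Sv nvz /= bf ?fvl // bl eqxx => /(_ isT).
  by rewrite /geq /= dv fvl ltnn.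
move: uy; rewrite /= !inE !negb_or !(eq_sym z) -!andbA => /and5P[n1 n2 n3 n12 /and3P[n13 n23 _]].
have sy' y : y \in [:: y1; y2; y3] -> y \in S /\ e y z.
  by move=> /sy; rewrite !inE => /andP[].
have [S1 e1] : y1 \in S /\ e y1 z by apply: sy'; rewrite !inE eqxx.
have [S2 e2] : y2 \in S /\ e y2 z by apply: sy'; rewrite !inE eqxx orbT.
have [S3 e3] : y3 \in S /\ e y3 z by apply: sy'; rewrite !inE eqxx !orbT.
have [l1 [Sl1 nl1 b1 p1]] := leaf y1 n1 S1 e1.
have [l2 [Sl2 nl2 b2 p2]] := leaf y2 n2 S2 e2.
have [l3 [Sl3 nl3 b3 p3]] := leaf y3 n3 S3 e3.
have bneq l l' y y' : b l = y -> b l' = y' -> y != y' -> l != l'.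
  by move=> <- <-; apply: contraNneq => ->.
exists l1, l2, l3; split.
- by rewrite /= !inE !negb_or !andbT (bneq l1 l2 y1 y2) ?(bneq l1 l3 y1 y3) ?(bneq l2 l3 y2 y3).
- by apply/allP; rewrite /= Sl1 Sl2 Sl3.
move=> L sL; apply: (@connected_in_levels _ z d).
  rewrite !inE Sz andbT; apply/negP=> /sL; rewrite !inE !(eq_sym z).
  by rewrite (negPf nl1) (negPf nl2) (negPf nl3).
move=> v; rewrite inE => /andP[_ Sv] nvz; have [Sf vf dv] := fP v Sv nvz.
exists (f v) => //; rewrite inE Sf andbT; apply/negP=> /sL; rewrite !inE.
by rewrite (negPf (p1 v Sv nvz)) (negPf (p2 v Sv nvz)) (negPf (p3 v Sv nvz)).
Qed.

End Graphs.

Section Connectivity.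
Variable R : comUnitRingType.

Definition adj m n (A : 'M[R]_(m, n)) (v w : 'I_m + 'I_n) : bool :=
  match v, w with
  | inl x, inr y => A x y != 0
  | inr y, inl x => A x y != 0
  | _, _ => false
  end.

Lemma adj_sym m n (A : 'M[R]_(m, n)) v w : adj A v w = adj A w v.
Proof. by case: v w => [?|?] [?|?]. Qed.

Lemma adj_tr m n (A : 'M[R]_(m, n)) v w : adj A^T v w = adj A (flip v) (flip w).
Proof. by case: v w => [?|?] [?|?] //=; rewrite mxE. Qed.

Definition conn m n (S : {set 'I_m + 'I_n}) (A : 'M[R]_(m, n)) :=
  connected_in (adj A) S.

Lemma conn_tr m n (S : {set 'I_m + 'I_n}) (A : 'M[R]_(m, n)) :
  conn S A -> conn (flip_set S) A^T.
Proof.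
move=> cA p pA v w; rewrite !in_flip_set => Sv Sw.
suff: (p \o @flip m n) (flip v) = (p \o @flip m n) (flip w) by rewrite /= !flipK.
apply: cA => // a b Sa Sb ab /=.
by apply: pA; rewrite ?in_flip_set ?adj_tr !flipK.
Qed.

(** The pivot has the same nonzero positions in row [x0] and column [y0]. If an edge [x - y] of [A]
    disappears elsewhere, then [A x y0] and [A x0 y] are nonzero, and the path [x - y0 - x0 - y]
    replaces it. *)
Lemma conn_pivot m n (S : {set 'I_m + 'I_n}) (A : 'M[R]_(m, n)) x0 y0 :
  inl x0 \in S -> inr y0 \in S -> A x0 y0 \is a GRing.unit ->
  conn S A -> conn S (pivot A x0 y0).
Proof.
move=> Sx0 Sy0 ua cA p pA; apply: cA.
have nz z : z != 0 -> z / A x0 y0 != 0.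
  by apply: contra => /eqP zV; rewrite -(divrK ua z) zV mul0r.
have key x y : inl x \in S -> inr y \in S -> A x y != 0 -> p (inl x) = p (inr y).
  have pE x' y' : inl x' \in S -> inr y' \in S -> pivot A x0 y0 x' y' != 0 ->
    p (inl x') = p (inr y') by move=> *; apply: pA.
  have p0 : p (inl x0) = p (inr y0).
    apply: pE => //; rewrite mxE !eqxx oppr_eq0.
    by apply/negP=> /eqP aV; move: ua; rewrite -unitrV aV unitr0.
  have px x' : inl x' \in S -> A x' y0 != 0 -> p (inl x') = p (inr y0).
    move=> Sx' nzx; have [->//|nx] := eqVneq x' x0.
    by apply: pE => //; rewrite mxE (negPf nx) eqxx nz.
  have py y' : inr y' \in S -> A x0 y' != 0 -> p (inl x0) = p (inr y').
    move=> Sy' nzy; have [->//|ny] := eqVneq y' y0.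
    by apply: pE => //; rewrite mxE (negPf ny) eqxx nz.
  move=> Sx Sy Axy.
  have [ex|nx] := eqVneq x x0; first by subst x; apply: py.
  have [ey|ny] := eqVneq y y0; first by subst y; apply: px.
  have := pE x y Sx Sy; rewrite mxE (negPf nx) (negPf ny).
  have [|_ /(_ isT)//] := eqVneq (A x y - _) 0.
  move=> /eqP; rewrite subr_eq0 => /eqP e _.
  have nz1 : A x y0 != 0 by apply: contraNneq Axy => e1; rewrite e e1 !mul0r.
  have nz2 : A x0 y != 0 by apply: contraNneq Axy => e1; rewrite e e1 mulr0 mul0r.
  by rewrite (px x) // -p0 (py y).
move=> [x|y] [x'|y'] //= Sv Sw; first exact: key.
by move=> nzA; apply/esym/key.
Qed.

Lemma conn_adj m n (S : {set 'I_m + 'I_n}) (A : 'M[R]_(m, n)) v w :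
  conn S A -> v \in S -> w \in S -> v != w -> exists2 z, z \in S & adj A v z.
Proof.
move=> cA Sv Sw nvw; case: (boolP [exists z in S, adj A v z]) => [/exists_inP//|].
move=> /exists_inPn nz.
suff: pred1 v v = pred1 v w by rewrite /= eqxx eq_sym (negPf nvw).
apply: cA => //= a b Sa Sb.
have [->|na] := eqVneq a v; first by move=> ab; have := nz b Sb; rewrite ab.
have [->|//] := eqVneq b v; by rewrite adj_sym => ab; have := nz a Sa; rewrite ab.
Qed.

Definition scale_mx m n (r : 'I_m -> R) (t : 'I_n -> R) (A : 'M[R]_(m, n)) : 'M[R]_(m, n) :=
  \matrix_(x, y) (r x * A x y * t y).

Lemma det_mxsub_scale m n (r : 'I_m -> R) (t : 'I_n -> R) (A : 'M[R]_(m, n))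
    k (f : 'I_k -> 'I_m) (g : 'I_k -> 'I_n) :
  \det (mxsub f g (scale_mx r t A)) =
  (\prod_i r (f i)) * \det (mxsub f g A) * \prod_i t (g i).
Proof.
have -> : mxsub f g (scale_mx r t A) =
   diag_mx (\row_i r (f i)) *m mxsub f g A *m diag_mx (\row_i t (g i)).
  by apply/matrixP=> i j; rewrite mul_mx_diag mul_diag_mx !mxE.
by rewrite !det_mulmx !det_diag; congr (_ * _ * _); apply: eq_bigr => i _; rewrite mxE.
Qed.

End Connectivity.

Section MinorClosedExtensions.
Variable P : partialField.

Lemma pf_elt_prod k (F : 'I_k -> P) : (forall i, pf_elt (F i)) -> pf_elt (\prod_i F i).
Proof.
by move=> PF; elim/big_ind: _ => //; [apply: pf_elt1 | apply: pf_eltM].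
Qed.

Section Fixed.
Variables (m n : nat) (S : {set 'I_m + 'I_n}).
Implicit Types A B : 'M[P]_(m, n).

Lemma eq_pmat_on A B :
  (forall x y, inl x \in S -> inr y \in S -> A x y = B x y) -> pmat_on S A -> pmat_on S B.
Proof.
move=> AB pA k f g injf injg Sf Sg.
have <- : mxsub f g A = mxsub f g B by apply/matrixP=> i j; rewrite !mxE AB.
exact: pA.
Qed.

Lemma pmat_on_scale A r t :
  (forall x, inl x \in S -> pf_elt (r x)) -> (forall y, inr y \in S -> pf_elt (t y)) ->
  pmat_on S A -> pmat_on S (scale_mx r t A).
Proof.
move=> Pr Pt pA k f g injf injg Sf Sg; rewrite det_mxsub_scale.
apply: pf_eltM; last by apply: pf_elt_prod => i; apply: Pt.
by apply: pf_eltM; [apply: pf_elt_prod => i; apply: Pr | apply: pA].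
Qed.

Lemma pmat_on_leaf A u :
  (forall x, inl x \in S -> pf_elt (A x u)) ->
  (forall x x', inl x \in S -> inl x' \in S -> A x u != 0 -> A x' u != 0 -> x = x') ->
  pmat_on (S :\ inr u) A -> pmat_on S A.
Proof.
move=> Pu leaf pA k f g injf injg Sf Sg.
have [/existsP[j /eqP gj]|/existsPn ng] := boolP [exists j, g j == u]; last first.
  apply: pA => // i; rewrite !inE //= Sg andbT.
  by apply: contraTN isT => /eqP[e]; have := ng i; rewrite e eqxx.
have [/existsP[i nzi]|/existsPn nz] := boolP [exists i, A (f i) u != 0]; last first.
  rewrite (expand_det_col _ j) big1 => [|i _]; first exact: pf_elt0.
  by rewrite mxE gj; have := nz i; rewrite negbK => /eqP->; rewrite mul0r.
rewrite (@det_single_col _ _ _ i j) => [|r ri]; last first.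
  rewrite mxE gj; apply: contraNeq ri => nzr.
  by apply/eqP/injf/leaf.
apply: pf_eltM; first by rewrite mxE gj; apply: Pu.
apply: pf_elt_sign; rewrite row'_col'_mxsub; apply: pA.
- exact/inj_comp/lift_inj.
- exact/inj_comp/lift_inj.
- by move=> r; rewrite !inE /=.
- move=> r; rewrite !inE /= Sg andbT -gj.
  by apply/eqP=> -[/injg/eqP]; rewrite eq_sym (negPf (neq_lift _ _)).
Qed.

End Fixed.

(** Induction on the size of the minor. Pivoting on a nonzero entry, which lies in one of the two
    blocks, leaves the other block unchanged and keeps the blocks separate; this avoids sorting the
    minor into block form. *)
Lemma pmat_on_setU m n (S T : {set 'I_m + 'I_n}) (A : 'M[P]_(m, n)) :
  {in S & T, forall v w, ~~ adj A v w} ->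
  pmat_on S A -> pmat_on T A -> pmat_on (S :|: T) A.
Proof.
move=> nST pS pT k; elim: k => [|k IHk] in S T A nST pS pT *.
  by move=> f g *; rewrite det_mx00; apply: pf_elt1.
move=> f g injf injg Sf Sg.
have [/existsP[i /existsP[j nz]]|/existsPn nz] := boolP [exists i, exists j, A (f i) (g j) != 0];
    last first.
  rewrite (expand_det_row _ ord0) big1 => [|j _]; first exact: pf_elt0.
  rewrite mxE; have /existsPn/(_ j) := nz ord0.
  by rewrite negbK => /eqP->; rewrite mul0r.
wlog [Sfi Sgj] : S T nST pS pT Sf Sg / inl (f i) \in S /\ inr (g j) \in S => [wl|].
  have nTS : {in T & S, forall v w, ~~ adj A v w} by move=> v w *; rewrite adj_sym nST.
  have := Sf i; have := Sg j; rewrite !inE.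
  move=> /orP[Sgj|Tgj] /orP[Sfi|Tfi].
  - exact: (wl S T).
  - by have := nTS _ _ Tfi Sgj; rewrite /= nz.
  - by have := nST _ _ Sfi Tgj; rewrite /= nz.
  - by apply: (wl T S) => //; move=> v; rewrite setUC.
have PA := pmat_on_entry pS Sfi Sgj.
rewrite (@det_mxsub_pivot _ _ _ _ _ _ _ i j) //; last exact: pf_unit.
apply/(pf_eltM PA)/pf_elt_sign.
have Tx x : inl x \in T -> (x == f i) = false /\ A x (g j) = 0.
  move=> Tx; have := nST _ _ Sgj Tx; rewrite /= negbK => /eqP e; split=> //.
  by apply: contraTF nz => /eqP<-; rewrite e eqxx.
have Ty y : inr y \in T -> (y == g j) = false /\ A (f i) y = 0.
  move=> Ty; have := nST _ _ Sfi Ty; rewrite /= negbK => /eqP e; split=> //.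
  by apply: contraTF nz => /eqP<-; rewrite e eqxx.
apply: (IHk S T) => //=; first 1 last.
- exact: pmat_on_pivot.
- apply: eq_pmat_on pT => x y /Tx[nx e1] /Ty[ny e2].
  by rewrite mxE nx ny e1 !mul0r subr0.
- exact/inj_comp/lift_inj.
- exact/inj_comp/lift_inj.
move=> [x|y] [x'|y'] //= Sv Tw; rewrite negbK mxE.
  have [-> e] := Ty _ Tw; have := nST _ _ Sv Tw; rewrite /= negbK => /eqP->.
  by rewrite e mulr0 !mul0r subr0; case: ifP; rewrite eqxx.
have [-> e] := Tx _ Tw; have := nST _ _ Sv Tw; rewrite /= negbK => /eqP->.
by rewrite e !mul0r subr0; case: ifP; rewrite eqxx.
Qed.

End MinorClosedExtensions.

(** * Walks between rows, and how pivoting shortens them *)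

Section RowWalks.
Variable P : partialField.

Definition row_rel m n (N : {set 'I_m + 'I_n}) (A : 'M[P]_(m, n)) : rel 'I_m :=
  fun x x' => [exists y, [&& inr y \in N, A x y != 0 & A x' y != 0]].

(** One step passes through a common nonzero column, so [k] steps make a path of length [2k] in the
    bipartite graph. *)
Definition row_walk m n (N : {set 'I_m + 'I_n}) (A : 'M[P]_(m, n)) :=
  walk (row_rel N A) [set x | inl x \in N].

Lemma row_rel_sym m n (N : {set 'I_m + 'I_n}) A : symmetric (row_rel N A).
Proof. by move=> x x'; apply/existsP/existsP=> -[y /and3P[? ? ?]]; exists y; apply/and3P. Qed.

Lemma row_relP m n (N : {set 'I_m + 'I_n}) (A : 'M[P]_(m, n)) x x' y :
  inr y \in N -> A x y != 0 -> A x' y != 0 -> row_rel N A x x'.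
Proof. by move=> *; apply/existsP; exists y; apply/and3P. Qed.

Lemma row_walkS m n (N : {set 'I_m + 'I_n}) (A : 'M[P]_(m, n)) k x x' x'' :
  inl x' \in N -> row_rel N A x x' -> row_walk N A k x' x'' -> row_walk N A k.+1 x x''.
Proof. by move=> Nx' xx' w; apply/exists_inP; exists x'; rewrite ?inE // xx'. Qed.

Lemma row_walk_ex m n (N : {set 'I_m + 'I_n}) (A : 'M[P]_(m, n)) x x' :
  conn N A -> inl x \in N -> inl x' \in N -> exists k, row_walk N A k x x'.
Proof.
move=> cA Nx Nx'; apply: walk_ex; rewrite ?inE //; first exact: row_rel_sym.
move=> p pA a b; rewrite !inE => Na Nb.
pose q v := match v with inl z => p z
  | inr y => [exists z, [&& inl z \in N, A z y != 0 & p z]] end.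
suff: q (inl a) = q (inl b) by [].
have key z y : inl z \in N -> inr y \in N -> A z y != 0 -> p z = q (inr y).
  move=> Nz Ny zy; apply/idP/existsP => [pz|[z' /and3P[Nz' zy' pz']]].
    by exists z; apply/and3P.
  by rewrite (pA z z') ?inE //; apply: row_relP zy zy'.
apply: cA => // -[z|y] [z'|y'] Nv Nw //= vw; first exact: key.
by apply/esym/key.
Qed.

(** Columns with a zero in row [r1] are not changed by the pivot. If the walk uses any other column,
    [r1] can join the walk there. *)
Lemma row_walk_pivot m n (N : {set 'I_m + 'I_n}) (A : 'M[P]_(m, n)) k r b r1 c2 :
  A r1 c2 != 0 -> row_walk N A k r b ->
  row_walk N (pivot A r1 c2) k r b \/ exists2 k', (k' <= k)%N & row_walk N A k' r1 b.
Proof.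
move=> nz; elim: k r => [|k IHk] r; first by left.
case/exists_inP=> r'; rewrite inE => Nr' /andP[rr' r'b].
have [c /and3P[Nc rc r'c]] := existsP rr'.
have [r1c|r1c] := eqVneq (A r1 c) 0; last first.
  by right; exists k.+1 => //; apply: row_walkS r'b => //; apply: row_relP r1c r'c.
have [w|[k' lek' w]] := IHk r' r'b; last by right; exists k' => //; apply: leqW.
left; apply: row_walkS w => //.
have same z : A z c != 0 -> pivot A r1 c2 z c != 0.
  move=> zc; rewrite mxE ifN; last by apply: contraNneq zc => ->; rewrite r1c.
  rewrite ifN; last by apply: contraNneq nz => <-; rewrite r1c.
  by rewrite r1c mulr0 mul0r subr0.
by apply: (@row_relP _ _ _ _ _ _ c) => //; apply: same.
Qed.

(** For a walk [a - c1 - r1 - c2 - r2] without shortcut, [A a c2] and [A r2 c1] vanish. The pivot at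
    [(r1, c2)] then makes the entry at [(r2, c1)] nonzero, so that [a] and [r2] become adjacent. *)
Lemma row_walk_shorten m n (N : {set 'I_m + 'I_n}) (A : 'M[P]_(m, n)) k a b :
  pmat_on N A -> inl a \in N -> row_walk N A k.+2 a b ->
  (exists2 k', (k' <= k.+1)%N & row_walk N A k' a b) \/
  exists r1 c2, [/\ inl r1 \in N /\ inr c2 \in N, row_rel N A a r1, A r1 c2 != 0, A a c2 = 0 /\
      row_walk N A k.+1 r1 b & row_walk N (pivot A r1 c2) k.+1 a b].
Proof.
move=> pA Na /exists_inP[r1]; rewrite inE => Nr1 /andP[ar1 /exists_inP[r2]].
rewrite inE => Nr2 /andP[r12 r2b].
have [c1 /and3P[Nc1 ac1 r1c1]] := existsP ar1.
have [c2 /and3P[Nc2 r1c2 r2c2]] := existsP r12.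
have [ac2|ac2] := eqVneq (A a c2) 0; last first.
  by left; exists k.+1 => //; apply: row_walkS r2b => //; apply: row_relP ac2 r2c2.
have [r2c1|r2c1] := eqVneq (A r2 c1) 0; last first.
  by left; exists k.+1 => //; apply: row_walkS r2b => //; apply: row_relP ac1 r2c1.
have [w|[k' lek' w]] := row_walk_pivot r1c2 r2b; last first.
  by left; exists k'.+1 => //; apply: row_walkS w.
right; exists r1, c2; split=> //.
  by split=> //; apply: row_walkS r2b.
apply: row_walkS w => //; apply: (@row_relP _ _ _ _ _ _ c1) => //.
  rewrite mxE ifN; last by apply: contraNneq r1c2 => <-; rewrite ac2.
  rewrite ifN; last by apply: contraNneq ac1 => ->; rewrite ac2.
  by rewrite ac2 !mul0r subr0.
rewrite mxE ifN; last by apply: contraNneq r1c1 => <-; rewrite r2c1.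
rewrite ifN; last by apply: contraNneq ac1 => ->; rewrite ac2.
rewrite r2c1 sub0r oppr_eq0.
have elt x y : inl x \in N -> inr y \in N -> A x y != 0 -> A x y \is a GRing.unit.
  by move=> Nx Ny; apply: pf_unit; apply: pmat_on_entry pA _ _ _ _.
have : A r2 c2 * A r1 c1 / A r1 c2 \is a GRing.unit by rewrite !unitrM unitrV !elt.
by apply: contraTneq => ->; rewrite unitr0.
Qed.

End RowWalks.

(** * Lifting cross-ratios *)

Section PartialFieldArithmetic.
Variable P : partialField.
Implicit Types u x y : P.

Lemma pf_elt_mulI u x : pf_elt u -> u != 0 -> pf_elt (u * x) -> pf_elt x.
Proof.
move=> Pu nzu; rewrite -{2}(mulKr (pf_unit Pu nzu) x).
by apply/pf_eltM/pf_eltV.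
Qed.

Lemma pf_elt_div x u : pf_elt x -> pf_elt u -> u != 0 -> pf_elt (x / u).
Proof. by move=> Px Pu nzu; apply/pf_eltM/pf_eltV. Qed.

Lemma pf_mul_neq0 x y : pf_elt x -> pf_elt y -> x != 0 -> y != 0 -> x * y != 0.
Proof. by move=> Px Py; rewrite pf_mulf_neq0 // => -> ->. Qed.

Lemma subr_div x y u (v : P) : u \is a GRing.unit -> v \is a GRing.unit ->
  x / u - y / v = (x * v - y * u) / (u * v).
Proof.
move=> uu uv; rewrite invrM // mulrBl; congr (_ - _).
  by rewrite mulrA mulrK.
by rewrite (mulrC v^-1) mulrA mulrK.
Qed.

End PartialFieldArithmetic.

Definition fundamental (P : partialField) (x : P) := pf_elt x /\ pf_elt (1 - x).

Lemma fundamental_1B (P : partialField) (x : P) : fundamental x -> fundamental (1 - x).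
Proof. by case=> Px P1x; split; rewrite // opprB addrC subrK. Qed.

Lemma fundamentalV (P : partialField) (x : P) : fundamental x -> x != 0 -> fundamental x^-1.
Proof.
move=> [Px P1x] nx; have PV := pf_eltV Px nx; split=> //.
have -> : 1 - x^-1 = - ((1 - x) * x^-1).
  by rewrite mulrBl divrr ?mul1r ?opprB // pf_unit.
exact/pf_eltN/pf_eltM.
Qed.

Section Liftable.
Variables (Q P : partialField) (pi : {rmorphism Q -> P}).
Hypothesis pi_elt : forall x : Q, pf_elt x -> pf_elt (pi x).
Hypothesis pi_eq0 : forall x : Q, pf_elt x -> pi x = 0 -> x = 0.

Definition liftable (p : P) := exists2 x : Q, fundamental x & pi x = p.

Lemma liftable_1B p : liftable p -> liftable (1 - p).
Proof.
move=> [x Fx <-]; exists (1 - x); last by rewrite rmorphB rmorph1.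
exact: fundamental_1B.
Qed.

Lemma liftable_mul1 p q : p * q = 1 -> liftable q -> liftable p.
Proof.
move=> pq [x Fx xq]; have nx : x != 0.
  apply: contraTneq (oner_neq0 P) => x0.
  by rewrite -pq -xq x0 rmorph0 mulr0 eqxx.
exists x^-1; first exact: fundamentalV.
have ux : x \is a GRing.unit by case: Fx => Qx _; apply: pf_unit.
rewrite rmorphV // xq; apply/esym; rewrite -[RHS]mul1r -pq mulrK //.
by rewrite -xq; apply: rmorph_unit.
Qed.

(** Since [x - y = x (1 - y / x)], it is enough that [y / x] is fundamental. Its image is, hence
    lifts to some [z], and the hypothesis on products identifies [x z] with [y]. *)
Lemma liftable_sub (x y : Q) :
  (forall p : P, fundamental p -> liftable p) ->
  (forall z, fundamental z -> pi (x * z) = pi y -> x * z = y) ->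
  fundamental x -> fundamental y -> x != 0 -> pf_elt (pi (x - y)) -> pf_elt (x - y).
Proof.
move=> fund mul Fx Fy nx Pxy; have [Qx _] := Fx; have [Qy _] := Fy.
have npx : pi x != 0 by apply: contra_neq nx; apply: pi_eq0.
have upx := pf_unit (pi_elt Qx) npx.
have [z Fz zE] : liftable (pi y / pi x).
  apply: fund; split; first exact/pf_elt_div/npx/pi_elt/Qx/pi_elt.
  have -> : 1 - pi y / pi x = pi (x - y) / pi x by rewrite rmorphB mulrBl divrr.
  by apply: pf_elt_div => //; apply: pi_elt.
have xz : x * z = y by apply: mul => //; rewrite rmorphM zE mulrC divrK.
by rewrite -xz -[X in X - _]mulr1 -mulrBr; case: Fz => _ Q1z; apply: pf_eltM.
Qed.

End Liftable.

(* Elements [x] with both [x] and [1 - x] in the partial field are the        *)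
(* cross-ratios of four points on a line.  The conditions say that they can be *)
(* lifted along [pi], uniquely, and that lifts of two of them are compatible   *)
(* (the case of five points on a line); [no2] excludes the Fano plane.         *)
Record lift_map (Q P : partialField) (pi : {rmorphism Q -> P}) : Prop := LiftMap {
  lm_elt : forall x : Q, pf_elt x -> pf_elt (pi x);
  lm_eq0 : forall x : Q, pf_elt x -> pi x = 0 -> x = 0;
  lm_onto : forall p : P, pf_elt p -> exists2 x : Q, pf_elt x & pi x = p;
  lm_fund : forall p : P, pf_elt p -> pf_elt (1 - p) ->
    exists x : Q, [/\ pf_elt x, pf_elt (1 - x) & pi x = p];
  lm_uniq : forall x x' : Q, pf_elt x -> pf_elt (1 - x) -> pf_elt x' -> pf_elt (1 - x') ->
    pi x = pi x' -> x = x';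
  lm_sub : forall x y : Q, pf_elt x -> pf_elt (1 - x) -> pf_elt y -> pf_elt (1 - y) ->
    pf_elt (pi (x - y)) -> pf_elt (x - y);
  lm_no2 : ~ pf_elt (2 : P)
}.

Section LiftScalars.
Variables (Q P : partialField) (pi : {rmorphism Q -> P}).
Hypothesis lm : lift_map pi.

Lemma pi_neq0 x : pf_elt x -> (pi x != 0) = (x != 0).
Proof.
move=> Qx; congr (~~ _); apply/eqP/eqP => [|->]; last exact: rmorph0.
exact: lm_eq0.
Qed.

(* Five points on a line: the quotient of the columns (a2, b2) and (a3, b3) is   *)
(* compared through the third column (a1, b1).                                   *)
Lemma minor_lift (a1 a2 a3 b1 b2 b3 : Q) :
  pf_elt a1 -> pf_elt a2 -> pf_elt a3 -> pf_elt b1 -> pf_elt b2 -> pf_elt b3 ->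
  a1 != 0 -> b1 != 0 ->
  pf_elt (a1 * b2 - a2 * b1) -> pf_elt (a1 * b3 - a3 * b1) ->
  pf_elt (pi (a2 * b3 - a3 * b2)) -> pf_elt (a2 * b3 - a3 * b2).
Proof.
move=> Qa1 Qa2 Qa3 Qb1 Qb2 Qb3 nza1 nzb1 m12 m13 m23.
have [->|nza2] := eqVneq a2 0; first by rewrite mul0r sub0r; apply/pf_eltN/pf_eltM.
have [->|nza3] := eqVneq a3 0; first by rewrite mul0r subr0; apply/pf_eltM.
pose d2 := a2 * b1; pose d3 := a3 * b1.
have [Qd2 Qd3] : pf_elt d2 /\ pf_elt d3 by split; apply: pf_eltM.
have [nzd2 nzd3] : d2 != 0 /\ d3 != 0 by split; apply: pf_mul_neq0.
have [ud2 ud3] : d2 \is a GRing.unit /\ d3 \is a GRing.unit by split; apply: pf_unit.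
have E d n : d \is a GRing.unit -> 1 - n / d = - ((n - d) / d).
  by move=> ud; rewrite mulrBl divrr // opprB.
(* Two cross-ratios whose difference is the minor in question times a unit, so that [lm_sub]
   applies. *)
pose x := a1 * b2 / d2; pose y := a1 * b3 / d3.
have xyE : x - y = a1 * b1 * - (a2 * b3 - a3 * b2) / (d2 * d3).
  by rewrite subr_div //; congr (_ / _); rewrite /d2 /d3; ring.
have Q23 : pf_elt (d2 * d3) by apply: pf_eltM.
have Q11 : pf_elt (a1 * b1) by apply: pf_eltM.
have nz23 : d2 * d3 != 0 by apply: pf_mul_neq0.
have nz11 : a1 * b1 != 0 by apply: pf_mul_neq0.
have Qxy : pf_elt (x - y).
  apply: (lm_sub lm).
  - by apply: pf_elt_div => //; apply: pf_eltM.
  - by rewrite E //; apply/pf_eltN/pf_elt_div.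
  - by apply: pf_elt_div => //; apply: pf_eltM.
  - by rewrite E //; apply/pf_eltN/pf_elt_div.
  rewrite xyE rmorphM rmorphV ?pf_unit // rmorphM rmorphN.
  apply: pf_elt_div; rewrite ?pi_neq0 //; last exact: lm_elt.
  by apply: pf_eltM; [apply: lm_elt | apply: pf_eltN].
rewrite -[_ - _]opprK; apply: pf_eltN; apply: (pf_elt_mulI Q11) => //.
rewrite -[_ * _](divrK (pf_unit Q23 nz23)) -xyE.
exact: pf_eltM.
Qed.

(** The cross-ratios [a1 b2 / (a2 b1)] and [a1 b3 / (a3 b1)] are fundamental and have the same
    image, so they are equal by [lm_uniq]: two lifts of a column are proportional on these rows. *)
Lemma cross_ratio_uniq (a1 b1 a2 b2 a3 b3 : Q) :
  pf_elt a1 -> pf_elt a2 -> pf_elt a3 -> pf_elt b1 -> pf_elt b2 -> pf_elt b3 ->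
  [&& a1 != 0, b1 != 0, a2 != 0, b2 != 0, a3 != 0 & b3 != 0] ->
  pf_elt (a1 * b2 - a2 * b1) -> pf_elt (a1 * b3 - a3 * b1) ->
  pi a2 = pi a3 -> pi b2 = pi b3 -> a2 * b3 = a3 * b2.
Proof.
move=> Qa1 Qa2 Qa3 Qb1 Qb2 Qb3 /and5P[nza1 nzb1 nza2 nzb2 /andP[nza3 nzb3]] m12 m13 ea eb.
pose d2 := a2 * b1; pose d3 := a3 * b1.
have [Qd2 Qd3] : pf_elt d2 /\ pf_elt d3 by split; apply: pf_eltM.
have [nzd2 nzd3] : d2 != 0 /\ d3 != 0 by split; apply: pf_mul_neq0.
have [ud2 ud3] : d2 \is a GRing.unit /\ d3 \is a GRing.unit by split; apply: pf_unit.
have E d n : d \is a GRing.unit -> 1 - n / d = - ((n - d) / d).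
  by move=> ud; rewrite mulrBl divrr // opprB.
have e : a1 * b2 / d2 = a1 * b3 / d3.
  apply: (lm_uniq lm).
  - by apply: pf_elt_div => //; apply: pf_eltM.
  - by rewrite E //; apply/pf_eltN/pf_elt_div.
  - by apply: pf_elt_div => //; apply: pf_eltM.
  - by rewrite E //; apply/pf_eltN/pf_elt_div.
  by rewrite !rmorphM !rmorphV // !rmorphM ea eb.
have u11 : a1 * b1 \is a GRing.unit by rewrite unitrM !pf_unit.
have h : a1 * b2 * d3 = a1 * b3 * d2.
  by rewrite -(divrK ud2 (a1 * b2)) e mulrAC divrK.
apply: (mulrI u11); rewrite /d2 /d3 in h.
transitivity (a1 * b3 * (a2 * b1)); first by ring.
by rewrite -h; ring.
Qed.

Section Rank3.

(* The quadrangle (1, 0, 0), (0, 1, 0), (1, 0, 1), (0, 1, 1) has diagonal points *)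
(* (0, 0, 1), (1, -1, 0) and (1, 1, 1); [special] says that u is one of the last *)
(* two.                                                                          *)
Definition special (u1 u2 u3 : Q) :=
  u3 = 0 /\ u1 + u2 = 0 \/ u1 = u3 /\ u2 = u3.

Section Half.
Variables u1 u2 u3 v1 v2 v3 : Q.
Let X := u1 * v2 - v1 * u2.
Let M23 := u2 * v3 - v2 * u3.
Let M13 := u1 * v3 - v1 * u3.
Hypotheses (Qu1 : pf_elt u1) (Qu2 : pf_elt u2) (Qu3 : pf_elt u3).
Hypotheses (Qu13 : pf_elt (u1 - u3)) (Qu23 : pf_elt (u2 - u3)) (Qu123 : pf_elt (u1 + u2 - u3)).
Hypotheses (nzu1 : u1 != 0) (nzu2 : u2 != 0).
Hypotheses (QM23 : pf_elt M23) (QM13 : pf_elt M13).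
Hypotheses (QC : pf_elt (X + M23)) (QD : pf_elt (X - M13)).
Hypothesis piX : pf_elt (pi X).

Let step (w a1 a2 a3 b1 b2 b3 : Q) :
  pf_elt w -> w != 0 ->
  pf_elt a1 -> pf_elt a2 -> pf_elt a3 -> pf_elt b1 -> pf_elt b2 -> pf_elt b3 ->
  a1 != 0 -> b1 != 0 ->
  pf_elt (a1 * b2 - a2 * b1) -> pf_elt (a1 * b3 - a3 * b1) ->
  a2 * b3 - a3 * b2 = w * X -> pf_elt X.
Proof.
move=> Qw nzw Qa1 Qa2 Qa3 Qb1 Qb2 Qb3 nza1 nzb1 m12 m13 E.
apply: (pf_elt_mulI Qw nzw); rewrite -E; apply: (minor_lift Qa1 Qa2 Qa3 Qb1) => //.
by rewrite E rmorphM; apply/pf_eltM/piX/lm_elt.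
Qed.

(* Unless u is special, three of the four lines joining u to the quadrangle are  *)
(* distinct, and [minor_lift] applies in the projection from u.                  *)
Lemma rank3_half : pf_elt X \/ special u1 u2 u3.
Proof.
have N1 := pf_eltN Qu1; have NM13 := pf_eltN QM13.
have Qu32 : pf_elt (u3 - u2) by rewrite -opprB; apply: pf_eltN.
have P12 (x y z : Q) : pf_elt x -> pf_elt y -> z = x * y -> pf_elt z.
  by move=> Qx Qy ->; apply: pf_eltM.
have [u30|nzu3] := eqVneq u3 0.
  have [e|ne] := eqVneq (u1 + u2) 0; first by right; left.
  left; apply: (@step u2 (u2 - u3) u2 M23 (u1 + u2 - u3) u2 (X + M23)) => //.
  - by rewrite u30 subr0.
  - by rewrite u30 subr0.
  - by apply: (P12 _ _ _ N1 Qu2); ring.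
  - by apply: (P12 _ _ _ Qu2 QD); rewrite /M23 /M13 /X; ring.
  by ring.
have [e13|n13] := eqVneq (u1 - u3) 0; last first.
  left; apply: (@step u2 (- u3) u2 M23 (u1 - u3) u2 (X + M23)) => //.
  - exact: pf_eltN.
  - by rewrite oppr_eq0.
  - by apply: (P12 _ _ _ N1 Qu2); ring.
  - by apply: (P12 _ _ _ Qu2 NM13); rewrite /M23 /M13 /X; ring.
  by ring.
have [e23|n23] := eqVneq (u2 - u3) 0.
  by right; right; split; apply/eqP; rewrite -subr_eq0 ?e13 ?e23.
left; apply: (@step (- u1) u3 (- u1) (- M13) (u3 - u2) (- u1) (X - M13)) => //.
- by rewrite oppr_eq0.
- by rewrite -opprB oppr_eq0.
- by apply: (P12 _ _ _ N1 Qu2); ring.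
- by apply: (P12 _ _ _ N1 QM23); rewrite /M23 /M13 /X; ring.
by ring.
Qed.

End Half.

(** The goal is the determinant of u, v and the diagonal point (0, 0, 1). The determinants of u, v
    with the four points of the quadrangle lie in Q by [minor_lift], so [rank3_half] applies to u,
    and to v by symmetry. *)
Lemma rank3_minor_lift (u1 u2 u3 v1 v2 v3 : Q) :
  pf_elt u1 -> pf_elt u2 -> pf_elt u3 -> pf_elt v1 -> pf_elt v2 -> pf_elt v3 ->
  pf_elt (u1 - u3) -> pf_elt (u2 - u3) -> pf_elt (u1 + u2 - u3) ->
  pf_elt (v1 - v3) -> pf_elt (v2 - v3) -> pf_elt (v1 + v2 - v3) ->
  pf_elt (pi (u1 * v2 - v1 * u2)) ->
  pf_elt (pi (u2 * v3 - v2 * u3)) -> pf_elt (pi (u1 * v3 - v1 * u3)) ->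
  pf_elt (pi (u1 * v2 - v1 * u2 + (u2 * v3 - v2 * u3))) ->
  pf_elt (pi (u1 * v2 - v1 * u2 - (u1 * v3 - v1 * u3))) ->
  pf_elt (u1 * v2 - v1 * u2).
Proof.
move=> Qu1 Qu2 Qu3 Qv1 Qv2 Qv3 Qu13 Qu23 Qu123 Qv13 Qv23 Qv123 PX P23 P13 PC PD.
have Q1 := pf_elt1 Q; have QN1 := pf_eltN Q1.
have nz1 : 1 != 0 :> Q by rewrite oner_neq0.
have nzN1 : -1 != 0 :> Q by rewrite oppr_eq0.
have opp (x y : Q) : pf_elt x -> y = - x -> pf_elt y by move=> Qx ->; apply: pf_eltN.
have QM23 : pf_elt (u2 * v3 - v2 * u3).
  apply: (@minor_lift 1 u2 v2 1 u3 v3); rewrite // mul1r mulr1.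
    exact: opp Qu23 (esym (opprB _ _)).
  exact: opp Qv23 (esym (opprB _ _)).
have QM13 : pf_elt (u1 * v3 - v1 * u3).
  apply: (@minor_lift 1 u1 v1 1 u3 v3); rewrite // mul1r mulr1.
    exact: opp Qu13 (esym (opprB _ _)).
  exact: opp Qv13 (esym (opprB _ _)).
have QC : pf_elt (u1 * v2 - v1 * u2 + (u2 * v3 - v2 * u3)).
  have E : u1 * v2 - v1 * u2 + (u2 * v3 - v2 * u3) = (u1 - u3) * v2 - (v1 - v3) * u2 by ring.
  rewrite E in PC *; apply: (@minor_lift (-1) _ _ 1) => //.
    by apply: opp Qu123 _; ring.
  by apply: opp Qv123 _; ring.
have QD : pf_elt (u1 * v2 - v1 * u2 - (u1 * v3 - v1 * u3)).
  have E : u1 * v2 - v1 * u2 - (u1 * v3 - v1 * u3) = u1 * (v2 - v3) - v1 * (u2 - u3) by ring.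
  rewrite E in PD *; apply: (@minor_lift 1 _ _ (-1)) => //.
    by rewrite (_ : _ - _ = u1 + u2 - u3) //; ring.
  by rewrite (_ : _ - _ = v1 + v2 - v3) //; ring.
have [->|nzu1] := eqVneq u1 0; first by rewrite mul0r sub0r; apply/pf_eltN/pf_eltM.
have [->|nzu2] := eqVneq u2 0; first by rewrite mulr0 subr0; apply/pf_eltM.
have [->|nzv1] := eqVneq v1 0; first by rewrite mul0r subr0; apply/pf_eltM.
have [->|nzv2] := eqVneq v2 0; first by rewrite mulr0 sub0r; apply/pf_eltN/pf_eltM.
have [e23|n23] := eqVneq (u2 * v3 - v2 * u3) 0; first by move: QC; rewrite e23 addr0.
have [//|su] := rank3_half Qu1 Qu2 Qu3 Qu13 Qu23 Qu123 nzu1 nzu2 QM23 QM13 QC QD PX.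
have [Qvu|sv] : pf_elt (v1 * u2 - u1 * v2) \/ special v1 v2 v3.
  apply: (@rank3_half v1 v2 v3 u1 u2 u3) => //.
  - by apply: opp QM23 _; ring.
  - by apply: opp QM13 _; ring.
  - by apply: opp QC _; ring.
  - by apply: opp QD _; ring.
  - by rewrite -opprB rmorphN; apply: pf_eltN.
- by apply: opp Qvu _; ring.
(* Both points are special. If they are the same diagonal point, a minor known to be nonzero
   vanishes; if they are the two different ones, the determinant is [2 u1 v1] up to sign, which puts
   2 in P. *)
exfalso; case: su sv => -[e1 e2] [] [f1 f2].
- by move: n23; rewrite e1 f1 !mulr0 subrr eqxx.
- move: PX; have -> : u1 * v2 - v1 * u2 = 2 * (u1 * v1).
    by rewrite -[u2](addKr u1) e2 f2 -f1; ring.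
  rewrite rmorphM rmorph_nat mulrC => h; apply: (lm_no2 lm); apply: (pf_elt_mulI _ _ h).
    exact/lm_elt/pf_eltM.
  by rewrite pi_neq0; [apply: pf_mul_neq0 | apply: pf_eltM].
- move: PX; have -> : u1 * v2 - v1 * u2 = - (2 * (u1 * v1)).
    by rewrite -[v2](addKr v1) f2 e2 -e1; ring.
  rewrite rmorphN => /pf_eltN; rewrite opprK.
  rewrite rmorphM rmorph_nat mulrC => h; apply: (lm_no2 lm); apply: (pf_elt_mulI _ _ h).
    exact/lm_elt/pf_eltM.
  by rewrite pi_neq0; [apply: pf_mul_neq0 | apply: pf_eltM].
- by move: n23; rewrite e2 f2 mulrC subrr eqxx.
Qed.

End Rank3.

End LiftScalars.

(** * Gluing along two columns *)

Section TwoColumns.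
Variables (Q P : partialField) (pi : {rmorphism Q -> P}).
Hypothesis lm : lift_map pi.
Variables (m n : nat) (S : {set 'I_m + 'I_n}) (u v : 'I_n).
Implicit Types A : 'M[Q]_(m, n).
Hypotheses (Su : inr u \in S) (Sv : inr v \in S) (neq_uv : u != v).
Let N := S :\ inr u :\ inr v.

Let NE w : (w \in N) = [&& w != inr v, w != inr u & w \in S].
Proof. by rewrite !inE. Qed.

Let Nrow x : (inl x \in N) = (inl x \in S).
Proof. by rewrite NE. Qed.

(** The glued matrix before its minors through both [u] and [v] are known to lie in Q. *)
Definition two_lifts A :=
  [/\ pmat_on (S :\ inr u) A, pmat_on (S :\ inr v) A & pmat_on S (map_mx pi A)].

Lemma map_pivot A x0 y0 : A x0 y0 \is a GRing.unit ->
  map_mx pi (pivot A x0 y0) = pivot (map_mx pi A) x0 y0.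
Proof.
move=> ua; apply/matrixP=> x y; rewrite !mxE.
by case: ifP => _; case: ifP => _; rewrite ?(rmorphB, rmorphN, rmorphM, rmorphV _ ua).
Qed.

Section Entries.
Variable A : 'M[Q]_(m, n).
Hypothesis lA : two_lifts A.

Lemma two_lifts_entry x y : inl x \in S -> inr y \in S -> pf_elt (A x y).
Proof.
case: lA => pu pv _ Sx Sy; have [e|ne] := eqVneq y u; last first.
  by apply: (pmat_on_entry pu); rewrite !inE //= Sy andbT.
by apply: (pmat_on_entry pv); rewrite !inE //= Sy andbT e.
Qed.

Lemma two_lifts_N : pmat_on N A.
Proof. by case: lA => pu _ _; apply: pmat_on_sub pu; apply: subsetDl. Qed.

Lemma two_lifts_minor2 x x' c w : inl x \in S -> inl x' \in S -> inr c \in N ->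
  w \in [:: u; v] -> pf_elt (A x c * A x' w - A x w * A x' c).
Proof.
case: lA => pu pv _ Sx Sx'; rewrite NE => /and3P[nv nu Sc].
rewrite !inE => /orP[]/eqP->.
  by apply: (pmat_on_minor2 pv); rewrite !inE //= ?nv ?Sc ?Su ?andbT.
by apply: (pmat_on_minor2 pu); rewrite !inE //= ?nu ?Sc ?Sv ?andbT // eq_sym.
Qed.

Lemma two_lifts_minor3 x x' x'' c d w :
  inl x \in S -> inl x' \in S -> inl x'' \in S -> inr c \in N -> inr d \in N ->
  w \in [:: u; v] ->
  pf_elt (A x c * (A x' d * A x'' w - A x' w * A x'' d)
  - A x d * (A x' c * A x'' w - A x' w * A x'' c)
  + A x w * (A x' c * A x'' d - A x' d * A x'' c)).
Proof.
case: lA => pu pv _ Sx Sx' Sx''; rewrite !NE => /and3P[nv nu Sc] /and3P[nv' nu' Sd].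
rewrite !inE => /orP[]/eqP->.
  by apply: (pmat_on_minor3 pv); rewrite !inE //= ?nv ?nv' ?Sc ?Sd ?Su ?andbT.
by apply: (pmat_on_minor3 pu); rewrite !inE //= ?nu ?nu' ?Sc ?Sd ?Sv ?andbT // eq_sym.
Qed.

Lemma two_lifts_pivot x0 y0 : inl x0 \in S -> inr y0 \in N -> A x0 y0 != 0 ->
  two_lifts (pivot A x0 y0).
Proof.
move=> Sx0 Ny0 nz; have := Ny0; rewrite NE => /and3P[nv nu Sy0].
have Q0 := two_lifts_entry Sx0 Sy0.
case: lA => pu pv pP; split.
- by apply: pmat_on_pivot => //; rewrite !inE ?nu.
- by apply: pmat_on_pivot => //; rewrite !inE ?nv.
rewrite map_pivot; last exact: pf_unit.
by apply: pmat_on_pivot; rewrite ?mxE ?pi_neq0.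
Qed.

End Entries.

(** Induction on the distance between the rows. Distance 1 is the case of five points on a line; a
    longer walk is shortened by a pivot, unless the pivot would change the minor, and then three
    rows form the rank 3 configuration. *)
Lemma two_columns_minor2 k A a b : two_lifts A -> inl a \in S -> inl b \in S ->
  row_walk N A k a b -> pf_elt (A a u * A b v - A a v * A b u).
Proof.
elim/ltn_ind: k A a b => k IHk A a b lA Sa Sb wab.
have E := two_lifts_entry lA.
have [_ _ pP] := lA; have NS w : w \in N -> w \in S by rewrite NE => /and3P[].
have piP2 x x' y y' : inl x \in S -> inl x' \in S -> inr y \in S -> inr y' \in S ->
    pf_elt (pi (A x y * A x' y' - A x y' * A x' y)).
  move=> Sx Sx' Sy Sy'; have := pmat_on_minor2 pP Sx Sx' Sy Sy'.
  by rewrite !mxE -!rmorphM -rmorphB.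
have [iu iv] : u \in [:: u; v] /\ v \in [:: u; v] by rewrite !inE !eqxx orbT.
case: k IHk wab => [_ /eqP <-|[|k] IHk wab].
- by rewrite mulrC subrr; apply: pf_elt0.
- have /exists_inP[b' _ /andP[ab /eqP eb]] := wab; subst b'.
  have [c /and3P[Nc ac bc]] := existsP ab; have Sc := NS _ Nc.
  apply: (minor_lift lm (E _ _ Sa Sc) _ _ (E _ _ Sb Sc)); rewrite //; try exact: E.
  - exact: two_lifts_minor2.
  - exact: two_lifts_minor2.
  exact: piP2.
have Na : inl a \in N by rewrite Nrow.
have [[k' lek' w]|] := row_walk_shorten (two_lifts_N lA) Na wab; first exact: (IHk k').
case=> [p [d [[Np Nd] ap pd [ad _] w]]].
have Sp := NS _ Np; have Sd := NS _ Nd.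
(* Rows [a] and [b] both vanish in the pivot column, so the pivot does not change their entries in
   [u] and [v]. *)
have [bd|bd] := eqVneq (A b d) 0.
  have same x w' : A x d = 0 -> inr w' \notin N -> pivot A p d x w' = A x w'.
    move=> xd Nw'; rewrite mxE ifN; last by apply: contraNneq pd => <-; rewrite xd.
    rewrite ifN; last by apply: contraNneq Nw' => ->.
    by rewrite xd !mul0r subr0.
  have Nu : inr u \notin N by rewrite NE eqxx andbF.
  have Nv : inr v \notin N by rewrite NE eqxx.
  have := IHk k.+1 (ltnSn _) (pivot A p d) a b (two_lifts_pivot lA Sp Nd pd) Sa Sb w.
  by rewrite !same.
have [c /and3P[Nc ac pc]] := existsP ap; have Sc := NS _ Nc.
have [bc|bc] := eqVneq (A b c) 0; last first.
  apply: (IHk 1%N) => //; apply: (@row_walkS _ _ _ _ _ _ _ b); rewrite ?Nrow //.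
    exact: row_relP ac bc.
  exact: eqxx.
(* After scaling row [a] by [s] and row [b] by [t], columns [c] and [d] in rows [a], [b], [p] are
   multiples of (1, 0, 1) and (0, 1, 1). With two unit vectors they form the quadrangle of
   [rank3_minor_lift]. *)
pose s := A p c / A a c; pose t := A p d / A b d.
have pcE : A p c = A a c * s by rewrite mulrC divrK // pf_unit //; apply: E.
have pdE : A p d = A b d * t by rewrite mulrC divrK // pf_unit //; apply: E.
have Qs : pf_elt s by apply: pf_elt_div => //; apply: E.
have Qt : pf_elt t by apply: pf_elt_div => //; apply: E.
have nzs : s != 0 by apply: contraNneq pc => s0; rewrite pcE s0 mulr0.
have nzt : t != 0 by apply: contraNneq pd => t0; rewrite pdE t0 mulr0.
have Eac := E _ _ Sa Sc; have Ebd := E _ _ Sb Sd.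
have [Q13 Q23 Q123] : [/\ forall w, w \in [:: u; v] -> pf_elt (s * A a w - A p w),
    forall w, w \in [:: u; v] -> pf_elt (t * A b w - A p w) &
    forall w, w \in [:: u; v] -> pf_elt (s * A a w + t * A b w - A p w)].
  split=> w' w'uv.
  - apply: (pf_elt_mulI Eac ac); have := two_lifts_minor2 lA Sp Sa Nc w'uv.
    by rewrite pcE; congr pf_elt; ring.
  - apply: (pf_elt_mulI Ebd bd); have := two_lifts_minor2 lA Sp Sb Nd w'uv.
    by rewrite pdE; congr pf_elt; ring.
  - apply: (pf_elt_mulI Eac ac); apply: (pf_elt_mulI Ebd bd).
    have := pf_eltN (two_lifts_minor3 lA Sa Sb Sp Nc Nd w'uv).
    by rewrite pcE pdE ad bc; congr pf_elt; ring.
have piP3 y y' y'' : inr y \in S -> inr y' \in S -> inr y'' \in S ->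
   pf_elt (pi (A a y * (A b y' * A p y'' - A b y'' * A p y')
  - A a y' * (A b y * A p y'' - A b y'' * A p y)
  + A a y'' * (A b y * A p y' - A b y' * A p y))).
  move=> Sy Sy' Sy''; have := pmat_on_minor3 pP Sa Sb Sp Sy Sy' Sy''.
  by rewrite !mxE !(rmorphB, rmorphD, rmorphM).
have piI K x : pf_elt K -> K != 0 -> pf_elt (pi (K * x)) -> pf_elt (pi x).
  by move=> QK nzK; rewrite rmorphM; apply: pf_elt_mulI; rewrite ?(pi_neq0 lm) //; apply: lm_elt.
have piM K x : pf_elt K -> pf_elt (pi x) -> pf_elt (pi (K * x)).
  by move=> QK Px; rewrite rmorphM; apply: pf_eltM => //; apply: lm_elt.
have Qst : pf_elt (s * t) by apply: pf_eltM.
have nzst : s * t != 0 by apply: pf_mul_neq0.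
apply: (pf_elt_mulI Qst nzst).
have -> : s * t * (A a u * A b v - A a v * A b u) =
    s * A a u * (t * A b v) - s * A a v * (t * A b u) by ring.
apply: (rank3_minor_lift lm (u3 := A p u) (v3 := A p v));
  try by [apply: pf_eltM => //; apply: E | apply: E | apply: Q13 | apply: Q23 | apply: Q123].
- have := piM _ _ Qst (piP2 a b u v Sa Sb Su Sv).
  by congr pf_elt; congr (pi _); ring.
- have := piM _ _ Qt (piP2 b p u v Sb Sp Su Sv).
  by congr pf_elt; congr (pi _); ring.
- have := piM _ _ Qs (piP2 a p u v Sa Sp Su Sv).
  by congr pf_elt; congr (pi _); ring.
- apply: (piI _ _ Eac ac); have := piM _ _ Qt (piP3 c u v Sc Su Sv).
  by rewrite pcE bc; congr pf_elt; congr (pi _); ring.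
apply: (piI _ _ Ebd bd); have := piM _ _ Qs (piP3 d u v Sd Su Sv).
by rewrite pdE ad; congr pf_elt; congr (pi _); ring.
Qed.

(** Pivots on nonzero entries outside [u] and [v] reduce the size of the minor and preserve the
    hypotheses. Without such entries the minor has a zero column, misses [u] or [v], or is a 2 x 2
    minor in [u] and [v]; connectedness provides the row walk for the last case. *)
Lemma two_columns_lift A : two_lifts A -> conn N A -> pmat_on S A.
Proof.
move=> lA cA k; elim: k A lA cA => [|k IHk] A lA cA f g injf injg Sf Sg.
  by rewrite det_mx00; apply: pf_elt1.
have E := two_lifts_entry lA.
have [/existsP[i /existsP[j /andP[Ngj nz]]]|noij] :=
    boolP [exists i, exists j, (inr (g j) \in N) && (A (f i) (g j) != 0)].
  rewrite (@det_mxsub_pivot _ _ _ _ _ _ _ i j) //; last first.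
    by apply: pf_unit => //; apply: E.
  have Sfi := Sf i; apply: pf_eltM; first exact: E.
  apply: pf_elt_sign; apply: IHk => //.
  - exact: two_lifts_pivot.
  - apply: conn_pivot; rewrite ?Nrow //; apply: pf_unit => //; exact: E.
  - exact/inj_comp/lift_inj.
  - exact/inj_comp/lift_inj.
  - by move=> r; apply: Sf.
  - by move=> r; apply: Sg.
have zero j : inr (g j) \in N -> forall i, A (f i) (g j) = 0.
  move=> Nj i; apply/eqP; apply: contraNT noij => nz.
  by apply/existsP; exists i; apply/existsP; exists j; rewrite Nj.
have [/existsP[j Nj]|/existsPn gN] := boolP [exists j, inr (g j) \in N].
  rewrite (expand_det_col _ j) big1 => [|i _]; first exact: pf_elt0.
  by rewrite mxE zero ?mul0r.
have guv j : g j \in [set u; v].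
  have := gN j; rewrite NE Sg andbT negb_and !negbK !inE orbC.
  by move=> /orP[]/eqP[->]; rewrite eqxx ?orbT.
case: lA => pu pv pP.
have [/existsP[j1 /eqP gj1]|/existsPn nu] := boolP [exists j, g j == u]; last first.
  apply: pu => // j; rewrite !inE ?Sf // Sg andbT.
  by apply/eqP=> -[gj]; have := nu j; rewrite gj eqxx.
have [/existsP[j2 /eqP gj2]|/existsPn nv] := boolP [exists j, g j == v]; last first.
  apply: pv => // j; rewrite !inE ?Sf // Sg andbT.
  by apply/eqP=> -[gj]; have := nv j; rewrite gj eqxx.
have gS : g @: setT = [set u; v].
  apply/setP=> w; apply/imsetP/idP=> [[j _ ->]//|]; rewrite !inE => /orP[]/eqP->.
    by exists j1.
  by exists j2.
have k1 : k = 1%N.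
  by apply/eqP; rewrite -eqSS -[k.+1]card_ord -cardsT -(card_imset _ injg) gS cards2 neq_uv.
subst k; rewrite det2E !mxE.
have [r row] : exists r, row_walk N A r (f ord0) (f 1).
  by apply: row_walk_ex; rewrite ?Nrow.
have X := two_columns_minor2 (And3 pu pv pP) (Sf _) (Sf _) row.
have := guv ord0; have := guv 1; rewrite !inE.
have n01 : g ord0 != g 1 by rewrite (inj_eq injg).
move=> /orP[]/eqP g1 /orP[]/eqP g0.
- by rewrite g0 g1 eqxx in n01.
- by rewrite g0 g1; have := pf_eltN X; rewrite opprB.
- by rewrite g0 g1.
- by rewrite g0 g1 eqxx in n01.
Qed.

End TwoColumns.

(** * Uniqueness of lifts *)

Section Uniqueness.
Variables (Q P : partialField) (pi : {rmorphism Q -> P}).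
Hypothesis lm : lift_map pi.

Definition agree_on m n (S : {set 'I_m + 'I_n}) (A B : 'M[Q]_(m, n)) :=
  forall x y, inl x \in S -> inr y \in S -> pi (A x y) = pi (B x y).

(** Adjacent rows are compared by [cross_ratio_uniq]. On a longer walk, an intermediate row nonzero
    in [w] splits the comparison; one that vanishes in [w] can be pivoted on without changing column
    [w]. *)
Lemma column_ratio m n (S : {set 'I_m + 'I_n}) w k (A B : 'M[Q]_(m, n)) a b :
  inr w \in S -> pmat_on S A -> pmat_on S B ->
  (forall x y, inl x \in S -> inr y \in S -> y != w -> A x y = B x y) ->
  (forall x, inl x \in S -> pi (A x w) = pi (B x w)) ->
  inl a \in S -> inl b \in S -> A a w != 0 -> A b w != 0 ->
  row_walk (S :\ inr w) A k a b -> A a w * B b w = A b w * B a w.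
Proof.
move=> Sw; elim/ltn_ind: k A B a b => k IHk A B a b pA pB AB piAB Sa Sb aw bw wab.
have EA := pmat_on_entry pA; have EB := pmat_on_entry pB.
have zB x : inl x \in S -> (B x w == 0) = (A x w == 0).
  move=> Sx; apply: negb_inj.
  by rewrite -(pi_neq0 lm (EB _ _ Sx Sw)) -(pi_neq0 lm (EA _ _ Sx Sw)) piAB.
case: k IHk wab => [_ /eqP <-//|[|k] IHk wab].
  have /exists_inP[b' _ /andP[ab /eqP eb]] := wab; subst b'.
  have [c /and3P[]] := existsP ab; rewrite !inE => /andP[ncw Sc] ac bc.
  have {}ncw : c != w by apply: contraNneq ncw => ->.
  rewrite [RHS]mulrC; apply: (@cross_ratio_uniq _ _ _ lm (A a c) (A b c));
    rewrite ?zB ?ac ?bc ?aw ?bw ?zB ?aw ?bw ?piAB //; try by [apply: EA | apply: EB].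
    exact: pmat_on_minor2 pA _ _ _ _ Sa Sb Sc Sw.
  by rewrite !AB //; exact: pmat_on_minor2 pB _ _ _ _ Sa Sb Sc Sw.
have pA' : pmat_on (S :\ inr w) A by apply: pmat_on_sub pA; apply: subD1set.
have Sa' : inl a \in S :\ inr w by rewrite !inE Sa.
have [[k' lek' w']|] := row_walk_shorten pA' Sa' wab; first exact: (IHk k').
case=> [p [d [[]]]]; rewrite !inE => Sp /andP[ndw Sd] ap pd [ad pb] w'.
have {}ndw : d != w by apply: contraNneq ndw => ->.
rewrite /= in Sp.
have [pw|pw] := eqVneq (A p w) 0; last first.
  have e1 : A a w * B p w = A p w * B a w.
    apply: (IHk 1%N) => //; apply: (@row_walkS _ _ _ _ _ _ _ p); rewrite ?inE ?Sp //.
    exact: eqxx.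
  have e2 : A p w * B b w = A b w * B p w by apply: (IHk k.+1).
  have up : A p w \is a GRing.unit by apply: pf_unit => //; apply: EA.
  by apply: (mulrI up); rewrite mulrCA e2 mulrCA e1; ring.
have pwB : B p w = 0 by apply/eqP; rewrite zB // pw.
have piv (C : 'M[Q]_(m, n)) x : C p w = 0 -> x != p -> pivot C p d x w = C x w.
  by move=> Cpw nx; rewrite mxE (negPf nx) (eq_sym w) (negPf ndw) Cpw mulr0 mul0r subr0.
have nap : a != p by apply: contraNneq aw => ->; rewrite pw.
have nbp : b != p by apply: contraNneq bw => ->; rewrite pw.
rewrite -(piv A a) // -(piv A b) // -(piv B a) // -(piv B b) //.
apply: (IHk k.+1); rewrite ?piv //.
- exact: pmat_on_pivot.
- by apply: pmat_on_pivot; rewrite // -AB.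
- by move=> x y Sx Sy ny; rewrite !mxE !AB.
move=> x Sx; have [->|nx] := eqVneq x p; last by rewrite !piv // piAB.
by rewrite !mxE eqxx (eq_sym w) (negPf ndw) pw pwB !mul0r.
Qed.

Definition kernel_fun T (r : T -> Q) := forall x, pf_elt (r x) /\ pi (r x) = 1.

Definition scale_equiv m n (S : {set 'I_m + 'I_n}) (A B : 'M[Q]_(m, n)) :=
  exists r t, [/\ kernel_fun r, kernel_fun t &
    forall x y, inl x \in S -> inr y \in S -> A x y = scale_mx r t B x y].

Lemma scale_equiv_tr m n (S : {set 'I_m + 'I_n}) (A B : 'M[Q]_(m, n)) :
  scale_equiv (flip_set S) A^T B^T -> scale_equiv S A B.
Proof.
move=> [r [t [kr kt E]]]; exists t, r; split=> // x y Sx Sy.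
by have := E y x; rewrite !in_flip_set !mxE => -> //; ring.
Qed.

Lemma agree_tr m n (S : {set 'I_m + 'I_n}) (A B : 'M[Q]_(m, n)) :
  agree_on S A B -> agree_on (flip_set S) A^T B^T.
Proof. by move=> AB x y; rewrite !in_flip_set !mxE => Sx Sy; apply: AB. Qed.

Lemma flip_setD1 m n (S : {set 'I_m + 'I_n}) v :
  flip_set (S :\ v) = flip_set S :\ flip v.
Proof. by apply/setP=> w; rewrite !inE (can2_eq (@flipK n m) (@flipK m n)). Qed.

Lemma card_flip_set m n (S : {set 'I_m + 'I_n}) : #|flip_set S| = #|S|.
Proof.
rewrite -(card_imset _ (can_inj (@flipK n m))); apply: eq_card => v.
apply/imsetP/idP=> [[w + ->]|Sv]; first by rewrite in_flip_set.
by exists (flip v); rewrite ?in_flip_set flipK.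
Qed.

(** A vertex whose deletion keeps the graph connected is removed; up to transposition it is a
    column. Once the rest is rescaled by induction, [column_ratio] shows that the two versions of
    this column are proportional, with a factor that [pi] sends to 1. *)
Lemma lifts_unique m n (S : {set 'I_m + 'I_n}) (A B : 'M[Q]_(m, n)) :
  conn S A -> pmat_on S A -> pmat_on S B -> agree_on S A B -> scale_equiv S A B.
Proof.
move: {2}_.+1 (ltnSn #|S|) => N; elim: N => // N IHN in m n S A B *.
rewrite ltnS => leSN cA pA pB AB.
have k1 T : kernel_fun (fun _ : T => 1) by move=> x; rewrite rmorph1; split=> //; apply: pf_elt1.
have [S0|[z Sz]] := set_0Vmem S.
  by exists (fun=> 1), (fun=> 1); split=> // x y; rewrite S0 inE.
have [Sz1|nSz] := eqVneq S [set z].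
  exists (fun=> 1), (fun=> 1); split=> // x y; rewrite Sz1 !inE => /eqP<- /eqP//.
have [v [Sv nvz cSv]] := noncut_ex (@adj_sym _ _ _ A) cA Sz nSz.
have cardv : (#|S :\ v| < N)%N by move: leSN; rewrite (cardsD1 v) Sv.
wlog [w vE] : m n S A B leSN cA pA pB AB z Sz nSz v Sv nvz cSv cardv / exists w, v = inr w => [wl|].
  case: v => [x|w] in Sv nvz cSv cardv *; last by apply: wl Sz _ _ Sv _ _ _ _ => //; exists w.
  apply: scale_equiv_tr; apply: (wl _ _ (flip_set S) _ _ _ _ _ _ _ (flip z) _ _ (flip (inl x))).
  - by rewrite card_flip_set.
  - exact: conn_tr.
  - exact: pmat_on_tr.
  - exact: pmat_on_tr.
  - exact: agree_tr.
  - by rewrite in_flip_set flipK.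
  - by apply: contra nSz => /eqP e; rewrite -[S]flip_setK e; apply/eqP/setP=> a;
       rewrite !inE (can2_eq (@flipK _ _) (@flipK _ _)) flipK.
  - by rewrite in_flip_set.
  - by rewrite (can_eq (@flipK _ _)).
  - by rewrite -flip_setD1; apply: conn_tr.
  - by rewrite -flip_setD1 card_flip_set.
  by exists x.
subst v.
have sub : S :\ inr w \subset S by apply: subD1set.
have [r [t [kr kt E]]] : scale_equiv (S :\ inr w) A B.
  apply: IHN => //; [exact: pmat_on_sub pA | exact: pmat_on_sub pB |].
  by move=> x y; rewrite !inE => /andP[_ Sx] /andP[_ Sy]; apply: AB.
pose B' := scale_mx r t B.
have pB' : pmat_on S B' by apply: pmat_on_scale => // x _; [case: (kr x)|case: (kt x)].
have AB' : agree_on S A B'.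
  by move=> x y Sx Sy; rewrite mxE !rmorphM (kr x).2 (kt y).2 mul1r mulr1 AB.
have [[x0|//] Sx0 nzw] := conn_adj cA Sv Sz nvz; rewrite /= in nzw.
have EA := pmat_on_entry pA; have EB := pmat_on_entry pB'.
have nzB : B' x0 w != 0.
  by rewrite -(pi_neq0 lm (EB _ _ Sx0 Sv)) -AB' // (pi_neq0 lm (EA _ _ Sx0 Sv)).
have uB : B' x0 w \is a GRing.unit by apply: pf_unit => //; apply: EB.
pose rho := A x0 w / B' x0 w.
have key x : inl x \in S -> A x w = B' x w * rho.
  move=> Sx; have [xw|nzx] := eqVneq (A x w) 0.
    rewrite xw (_ : B' x w = 0) ?mul0r //; apply: (lm_eq0 lm); first exact: EB.
    by rewrite -AB' // xw rmorph0.
  apply: (mulIr uB); rewrite /rho mulrA divrK // [RHS]mulrC.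
  have [k wk] : exists k, row_walk (S :\ inr w) A k x x0.
    by apply: row_walk_ex; rewrite ?inE ?Sx.
  apply: column_ratio wk => //.
    by move=> a y Sa Sy ny; apply: E; rewrite !inE ?Sa ?Sy ?andbT //=; apply: contraNneq ny => -[->].
  by move=> a Sa; apply: AB'.
have krho : pf_elt rho /\ pi rho = 1.
  split; first by apply: pf_elt_div => //; [apply: EA | apply: EB].
  rewrite rmorphM rmorphV // AB' // divrr //.
  by rewrite rmorph_unit.
exists r, (fun y => if y == w then t y * rho else t y); split=> //.
  move=> y; case: ifP => // _; have [kt1 kt2] := kt y; rewrite rmorphM kt2 krho.2 mulr1.
  by split=> //; apply: pf_eltM => //; case: krho.
move=> x y Sx Sy; rewrite mxE; have [->|ny] := eqVneq y w.
  by rewrite key // mxE mulrA.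
by rewrite E ?mxE // !inE ?Sx ?Sy ?andbT.
Qed.

End Uniqueness.

(** * Existence of lifts *)

Section Components.
Variables (T : finType) (e : rel T).

Lemma component_split (S : {set T}) z : z \in S -> connected_in e S \/
  exists S1 : {set T}, [/\ S1 \subset S, z \in S1, S1 != S &
    {in S1 & S :\: S1, forall v w, ~~ e v w}].
Proof.
move=> Sz; pose r := [rel a b | [&& e a b, a \in S & b \in S]].
pose S1 := [set v in S | connect r z v].
have sS1 : S1 \subset S by apply/subsetP=> v; rewrite inE => /andP[].
have S1z : z \in S1 by rewrite inE Sz connect0.
have [S1S|nS1] := eqVneq S1 S; [left | right; exists S1; split=> //].
  move=> p pS; suff pz v : v \in S -> p v = p z by move=> v w Sv Sw; rewrite !pz.
  rewrite -S1S inE => /andP[_ /connectP[s]].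
  elim/last_ind: s v => [|s w IHs] v /=; first by move=> _ ->.
  rewrite rcons_path last_rcons => /andP[ps /and3P[ew Sl Sw]] ->.
  by rewrite -(pS _ _ Sl Sw ew); apply: IHs.
move=> v w; rewrite !inE => /andP[Sv zv] /andP[+ Sw]; rewrite Sw /=.
apply: contra => vw; apply: connect_trans zv (connect1 _).
by rewrite /= vw Sv.
Qed.

End Components.

Lemma eq_conn (R R' : comUnitRingType) m n (S : {set 'I_m + 'I_n})
    (A : 'M[R]_(m, n)) (B : 'M[R']_(m, n)) :
  (forall x y, inl x \in S -> inr y \in S -> (A x y != 0) = (B x y != 0)) ->
  conn S A -> conn S B.
Proof.
move=> AB cA p pB; apply: cA => v w Sv Sw vw; apply: pB => //.
by case: v w Sv Sw vw => [x|y] [x'|y'] //= Sv Sw; rewrite AB.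
Qed.

Section Existence.
Variables (Q P : partialField) (pi : {rmorphism Q -> P}).
Hypothesis lm : lift_map pi.

Definition lift_of m n (S : {set 'I_m + 'I_n}) (A : 'M[Q]_(m, n)) (D : 'M[P]_(m, n)) :=
  pmat_on S A /\ forall x y, inl x \in S -> inr y \in S -> pi (A x y) = D x y.

Definition has_lift m n (S : {set 'I_m + 'I_n}) (D : 'M[P]_(m, n)) :=
  exists A, lift_of S A D.

Lemma lift_of_neq0 m n (S : {set 'I_m + 'I_n}) A D x y : lift_of S A D ->
  inl x \in S -> inr y \in S -> (A x y != 0) = (D x y != 0).
Proof.
by move=> [pA AD] Sx Sy; rewrite -(pi_neq0 lm (pmat_on_entry pA Sx Sy)) AD.
Qed.

Lemma has_lift_tr m n (S : {set 'I_m + 'I_n}) D :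
  has_lift (flip_set S) D^T -> has_lift S D.
Proof.
move=> [A [pA AD]]; exists A^T; split; first by rewrite -[S]flip_setK; apply: pmat_on_tr.
by move=> x y Sx Sy; have := AD y x; rewrite !in_flip_set !mxE => ->.
Qed.

Lemma has_lift_setU m n (S T : {set 'I_m + 'I_n}) D :
  [disjoint S & T] -> {in S & T, forall v w, ~~ adj D v w} ->
  has_lift S D -> has_lift T D -> has_lift (S :|: T) D.
Proof.
move=> dST nST [A [pA AD]] [B [pB BD]].
pose C : 'M[Q]_(m, n) := \matrix_(x, y)
  (if (inl x \in S) && (inr y \in S) then A x y
   else if (inl x \in T) && (inr y \in T) then B x y else 0).
have notS v : v \in T -> (v \in S) = false by move=> Tv; apply: (disjointFl dST).
have CS x y : inl x \in S -> inr y \in S -> C x y = A x y by move=> Sx Sy; rewrite mxE Sx Sy.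
have CT x y : inl x \in T -> inr y \in T -> C x y = B x y.
  by move=> Tx Ty; rewrite mxE (notS _ Tx) Tx Ty.
have CST x y : inl x \in S -> inr y \in T -> C x y = 0.
  by move=> Sx Ty; rewrite mxE Sx (notS _ Ty) (disjointFr dST Sx).
have CTS x y : inl x \in T -> inr y \in S -> C x y = 0.
  by move=> Tx Sy; rewrite mxE Tx (notS _ Tx) (disjointFr dST Sy).
exists C; split.
  apply: pmat_on_setU.
  - by move=> [x|y] [x'|y'] //= Sv Tw; [rewrite CST // eqxx | rewrite CTS // eqxx].
  - by apply: eq_pmat_on pA => x y Sx Sy; rewrite CS.
  by apply: eq_pmat_on pB => x y Sx Sy; rewrite CT.
move=> x y; rewrite !inE => /orP[Sx|Tx] /orP[Sy|Ty].
- by rewrite CS ?AD.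
- by rewrite CST // rmorph0; have := nST _ _ Sx Ty; rewrite negbK => /eqP.
- by rewrite CTS // rmorph0; have := nST _ _ Sy Tx; rewrite negbK => /eqP.
- by rewrite CT ?BD.
Qed.

Definition nbrs m n (S : {set 'I_m + 'I_n}) (D : 'M[P]_(m, n)) v := [set w in S | adj D v w].

Lemma card_nbrs_tr m n (S : {set 'I_m + 'I_n}) (D : 'M[P]_(m, n)) v :
  #|nbrs (flip_set S) D^T (flip v)| = #|nbrs S D v|.
Proof.
rewrite -[RHS]card_flip_set; apply: eq_card => w.
by rewrite !inE adj_tr flipK.
Qed.

(** With at most one nonzero entry in the line [v], any lift of that entry works, by expansion along
    the line. *)
Lemma has_lift_leaf m n (S : {set 'I_m + 'I_n}) (D : 'M[P]_(m, n)) v :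
  pmat_on S D -> v \in S -> (#|nbrs S D v| <= 1)%N -> has_lift (S :\ v) D -> has_lift S D.
Proof.
wlog [u ->] : m n S D v / exists u, v = inr u => [wl|].
  case: v => [x|u] pD Sv dv hl; last by apply: wl pD Sv dv hl; exists u.
  apply: has_lift_tr; apply: (wl _ _ _ _ (flip (inl x))).
  - by exists x.
  - exact: pmat_on_tr.
  - by rewrite in_flip_set.
  - by rewrite card_nbrs_tr.
  - by apply: has_lift_tr; rewrite -flip_setD1 flip_setK trmxK.
move=> pD Su leaf [A [pA AD]].
have /fin_all_exists[a aP]: forall x, exists z : Q,
    inl x \in S -> pf_elt z /\ pi z = D x u.
  move=> x; case: (boolP (inl x \in S)) => [Sx|]; last by exists 0.
  by have [z Qz zD] := lm_onto lm (pmat_on_entry pD Sx Su); exists z.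
have nza x : inl x \in S -> a x != 0 -> inl x \in nbrs S D (inr u).
  by move=> Sx; have [Qa aD] := aP x Sx; rewrite -(pi_neq0 lm Qa) aD inE Sx.
pose C : 'M[Q]_(m, n) := \matrix_(x, y) (if y == u then a x else A x y).
exists C; split.
  apply: (@pmat_on_leaf _ _ _ _ _ u).
  - by move=> x Sx; rewrite mxE eqxx; case: (aP x Sx).
  - move=> x x' Sx Sx'; rewrite !mxE eqxx => nx nx'.
    by have /card_le1_eqP/(_ _ _ (nza x Sx nx) (nza x' Sx' nx'))[] := leaf.
  apply: eq_pmat_on pA => x y _; rewrite !inE mxE => /andP[nyu _].
  by rewrite ifN //; apply: contraNneq nyu => ->.
move=> x y Sx Sy; rewrite mxE; case: eqVneq => [->|ny]; first by case: (aP x Sx).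
by apply: AD; rewrite !inE ?Sx ?Sy ?andbT.
Qed.

(** By [lifts_unique] the two lifts agree off [u] and [v] after a scaling trivial in P. The rescaled
    second lift takes its column [v] from the first one. *)
Lemma has_lift_glue m n (S : {set 'I_m + 'I_n}) (D : 'M[P]_(m, n)) u v :
  pmat_on S D -> inr u \in S -> inr v \in S -> u != v ->
  conn (S :\ inr u :\ inr v) D -> has_lift (S :\ inr u) D -> has_lift (S :\ inr v) D ->
  has_lift S D.
Proof.
move=> pD Su Sv nuv cD [A hA] [B hB]; set N := _ :\ inr v in cD.
have sNu : N \subset S :\ inr u by apply: subD1set.
have sNv : N \subset S :\ inr v.
  by apply/subsetP=> w; rewrite !inE => /and3P[-> _ ->].
have cA : conn N A.
  by apply: eq_conn cD => x y Nx Ny; rewrite (lift_of_neq0 hA) //; apply: (subsetP sNu).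
case: hA hB => pA AD [pB BD].
have [r [t [kr kt E]]] : scale_equiv pi N A B.
  apply: (lifts_unique lm cA).
  - exact: pmat_on_sub pA.
  - exact: pmat_on_sub pB.
  move=> x y Nx Ny; rewrite AD ?(subsetP sNu) // BD //; exact: (subsetP sNv).
pose C : 'M[Q]_(m, n) := \matrix_(x, y) (if y == v then A x v else scale_mx r t B x y).
have CA x y : inl x \in S -> inr y \in S -> y != u -> C x y = A x y.
  move=> Sx Sy nyu; rewrite mxE; case: eqVneq => [->//|nyv].
  by rewrite E // !inE ?Sx ?Sy ?andbT //=; apply/andP; split.
have CB x y : y != v -> C x y = scale_mx r t B x y by move=> ny; rewrite mxE (negPf ny).
have pCu : pmat_on (S :\ inr u) C.
  apply: eq_pmat_on pA => x y; rewrite !inE => /andP[_ Sx] /andP[nyu Sy].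
  by rewrite CA //; apply: contraNneq nyu => ->.
have pCv : pmat_on (S :\ inr v) C.
  apply: (@eq_pmat_on _ _ _ _ (scale_mx r t B)).
    by move=> x y _; rewrite !inE => /andP[nyv Sy]; rewrite CB //; apply: contraNneq nyv => ->.
  by apply: pmat_on_scale => // x _; [case: (kr x)|case: (kt x)].
have CD x y : inl x \in S -> inr y \in S -> pi (C x y) = D x y.
  move=> Sx Sy; have [->|nyu] := eqVneq y u.
    rewrite CB // !mxE !rmorphM (kr x).2 (kt u).2 mul1r mulr1 BD // !inE ?Sx //.
    by rewrite Su andbT; apply: contraNneq nuv => -[->].
  by rewrite CA // AD // !inE ?Sx ?Sy ?andbT //; apply: contraNneq nyu => -[->].
exists C; split=> //; apply: (two_columns_lift lm Su Sv nuv).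
  by split=> //; apply: eq_pmat_on pD => x y Sx Sy; rewrite mxE CD.
apply: eq_conn cA => x y Nx Ny; rewrite CA //.
- by move: Nx; rewrite !inE => /andP[].
- by move: Ny; rewrite !inE => /and3P[].
- by move: Ny; rewrite !inE => /and3P[_ + _]; apply: contraNneq => ->.
Qed.

Definition is_row m n (v : 'I_m + 'I_n) := if v is inl _ then true else false.

Lemma has_lift_glue_same m n (S : {set 'I_m + 'I_n}) (D : 'M[P]_(m, n)) u v :
  pmat_on S D -> u \in S -> v \in S -> u != v ->
  is_row u = is_row v ->
  conn (S :\ u :\ v) D -> has_lift (S :\ u) D -> has_lift (S :\ v) D ->
  has_lift S D.
Proof.
case: u v => [x|u] [x'|v] // pD Su Sv nuv _ cD hu hv; last exact: has_lift_glue cD hu hv.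
apply: has_lift_tr; apply: (@has_lift_glue _ _ _ _ x x').
- exact: pmat_on_tr.
- by rewrite in_flip_set.
- by rewrite in_flip_set.
- by apply: contraNneq nuv => ->.
- by rewrite -!(flip_setD1 _ (inl _)); apply: conn_tr.
- by rewrite -(flip_setD1 _ (inl _)); apply: has_lift_tr; rewrite flip_setK trmxK.
- by rewrite -(flip_setD1 _ (inl _)); apply: has_lift_tr; rewrite flip_setK trmxK.
Qed.

(** Among the three leaves given by [three_leaves], two are both rows or both columns, and deleting
    them keeps the graph connected. *)
Lemma has_lift_deg3 m n (S : {set 'I_m + 'I_n}) (D : 'M[P]_(m, n)) z :
  (forall v, v \in S -> has_lift (S :\ v) D) ->
  pmat_on S D -> conn S D -> z \in S -> (2 < #|nbrs S D z|)%N -> has_lift S D.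
Proof.
move=> IH pD cD Sz /card_gt2P[y1 [y2 [y3 [[n1 n2 n3] [n12 n23 n31]]]]].
have nbrE y : y \in nbrs S D z -> [&& y \in S, y != z & adj D y z].
  rewrite inE => /andP[Sy zy]; rewrite Sy adj_sym zy andbT.
  by apply: contraTneq zy => ->; case: (z) => ?.
have /and3P[S1 nz1 e1] := nbrE _ n1; have /and3P[S2 nz2 e2] := nbrE _ n2.
have /and3P[S3 nz3 e3] := nbrE _ n3.
have [||l1 [l2 [l3 [ul Sl cl]]]] := @three_leaves _ _ (@adj_sym _ _ _ D) S z y1 y2 y3 cD Sz.
- by rewrite /= !inE !negb_or !(eq_sym z) nz1 nz2 nz3 n12 n23 (eq_sym y1 y3) n31.
- by move=> y; rewrite !inE => /or3P[]/eqP->; apply/andP.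
have glue u v : u \in [:: l1; l2; l3] -> v \in [:: l1; l2; l3] -> u != v ->
    is_row u = is_row v ->
    has_lift S D.
  move=> Lu Lv nuv same; have [Su Sv] := (Sl _ Lu, Sl _ Lv).
  apply: (has_lift_glue_same pD Su Sv nuv same); try exact: IH.
  rewrite /conn setDDl; apply: cl => w; rewrite !inE => /orP[]/eqP->; [move: Lu | move: Lv];
    by rewrite !inE.
have L1 : l1 \in [:: l1; l2; l3] by rewrite !inE eqxx.
have L2 : l2 \in [:: l1; l2; l3] by rewrite !inE eqxx orbT.
have L3 : l3 \in [:: l1; l2; l3] by rewrite !inE eqxx !orbT.
move: ul; rewrite /= !inE negb_or andbT => /andP[/andP[d12 d13] d23].
case E1: l1 => [a1|b1]; case E2: l2 => [a2|b2]; case E3: l3 => [a3|b3];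
  by first [by apply: (glue l1 l2); rewrite // E1 E2 | by apply: (glue l1 l3); rewrite // E1 E3
     | by apply: (glue l2 l3); rewrite // E2 E3].
Qed.

Lemma has_lift_pivot m n (S : {set 'I_m + 'I_n}) (D : 'M[P]_(m, n)) x0 y0 :
  pmat_on S D -> inl x0 \in S -> inr y0 \in S -> D x0 y0 != 0 ->
  has_lift S (pivot D x0 y0) -> has_lift S D.
Proof.
move=> pD Sx0 Sy0 nz [A hA]; have ua := pf_unit (pmat_on_entry pD Sx0 Sy0) nz.
have nzA : A x0 y0 != 0.
  rewrite (lift_of_neq0 hA) // mxE !eqxx oppr_eq0.
  by apply: contraTneq ua; rewrite -unitrV => ->; rewrite unitr0.
have [pA AD] := hA; have uA := pf_unit (pmat_on_entry pA Sx0 Sy0) nzA.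
(* Compensates the signs in [pivotK]. *)
pose sg k (z : 'I_k) (w : 'I_k) : Q := (-1) ^+ (w == z).
have sgE k z w : pf_elt (@sg k z w).
  by rewrite /sg -[_ ^+ _]mulr1; apply: pf_elt_sign; apply: pf_elt1.
exists (scale_mx (sg _ x0) (sg _ y0) (pivot A x0 y0)); split.
  by apply: pmat_on_scale => //; apply: pmat_on_pivot.
move=> x y Sx Sy; rewrite mxE.
have -> : pi (sg m x0 x * pivot A x0 y0 x y * sg n y0 y) =
    (-1) ^+ (x == x0) * pivot (pivot D x0 y0) x0 y0 x y * (-1) ^+ (y == y0).
  rewrite !rmorphM /sg !rmorphXn !rmorphN1; congr (_ * _ * _).
  rewrite [in LHS]mxE [in RHS]mxE -!AD //.
  by case: ifP => _; case: ifP => _; rewrite ?(rmorphB, rmorphN, rmorphM, rmorphV _ uA).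
rewrite pivotK // mxE; case: (x == x0); case: (y == y0);
  by rewrite /= ?expr0 ?expr1; ring.
Qed.

(** Three entries are lifted arbitrarily; the fourth is dictated by the lift [c] of the cross-ratio,
    and then the determinant is [a00 a11 (1 - c)]. *)
Lemma has_lift_2x2 m n (S : {set 'I_m + 'I_n}) (D : 'M[P]_(m, n)) x0 x1 y0 y1 :
  pmat_on S D -> S = [set inl x0; inl x1; inr y0; inr y1] -> x0 != x1 -> y0 != y1 ->
  [&& D x0 y0 != 0, D x0 y1 != 0, D x1 y0 != 0 & D x1 y1 != 0] -> has_lift S D.
Proof.
move=> pD SE nx ny /and4P[nz00 nz01 nz10 nz11].
have [Sx0 Sx1 Sy0 Sy1] : [/\ inl x0 \in S, inl x1 \in S, inr y0 \in S & inr y1 \in S].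
  by rewrite SE !inE !eqxx !orbT.
have E := pmat_on_entry pD.
have [[[E00 E01] E10] E11] := (E _ _ Sx0 Sy0, E _ _ Sx0 Sy1, E _ _ Sx1 Sy0, E _ _ Sx1 Sy1).
have [a00 Q00 pi00] := lm_onto lm E00.
have [a01 Q01 pi01] := lm_onto lm E01.
have [a10 Q10 pi10] := lm_onto lm E10.
have Edd : pf_elt (D x0 y0 * D x1 y1) by apply: pf_eltM.
have nzdd : D x0 y0 * D x1 y1 != 0 by apply: pf_mul_neq0.
have Edd' : pf_elt (D x0 y1 * D x1 y0) by apply: pf_eltM.
have nzdd' : D x0 y1 * D x1 y0 != 0 by apply: pf_mul_neq0.
have [c [Qc Q1c pic]] : exists x : Q, [/\ pf_elt x, pf_elt (1 - x) &
    pi x = D x0 y1 * D x1 y0 / (D x0 y0 * D x1 y1)].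
  apply: (lm_fund lm); first exact: pf_elt_div.
  have -> : 1 - D x0 y1 * D x1 y0 / (D x0 y0 * D x1 y1) =
      (D x0 y0 * D x1 y1 - D x0 y1 * D x1 y0) / (D x0 y0 * D x1 y1).
    by rewrite mulrBl divrr // pf_unit.
  by apply: pf_elt_div => //; apply: pmat_on_minor2 pD _ _ _ _ _ _ _ _.
have nzc : c != 0.
  rewrite -(pi_neq0 lm Qc) pic; apply: contra_neq nzdd' => e0.
  by rewrite -[LHS](divrK (pf_unit Edd nzdd)) e0 mul0r.
have nza00 : a00 != 0 by rewrite -(pi_neq0 lm Q00) pi00.
have Qac : pf_elt (a00 * c) by apply: pf_eltM.
have nzac : a00 * c != 0 by apply: pf_mul_neq0.
have uac := pf_unit Qac nzac.
pose a11 := a01 * a10 / (a00 * c).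
have Q11 : pf_elt a11 by apply: pf_elt_div => //; apply: pf_eltM.
have pi11 : pi a11 = D x1 y1.
  have uK : pi (a00 * c) \is a GRing.unit by apply: rmorph_unit.
  rewrite /a11 rmorphM rmorphV // rmorphM pi01 pi10.
  rewrite (_ : D x0 y1 * D x1 y0 = D x1 y1 * pi (a00 * c)) ?mulrK //.
  rewrite rmorphM pi00 pic mulrA [D x1 y1 * _]mulrC [RHS]mulrC divrK //.
  exact: pf_unit.
have det : a00 * a11 - a01 * a10 = a00 * a11 * (1 - c).
  rewrite mulrBr mulr1 (_ : a00 * a11 * c = a11 * (a00 * c)); last by ring.
  by rewrite divrK.
have Qdet : pf_elt (a00 * a11 - a01 * a10) by rewrite det; apply: pf_eltM => //; apply: pf_eltM.
pose A : 'M[Q]_(m, n) := \matrix_(x, y)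
  (if x == x0 then if y == y0 then a00 else a01 else if y == y0 then a10 else a11).
have rowE x : inl x \in S -> x = x0 \/ x = x1.
  by rewrite SE !inE => /orP[/orP[/orP[/eqP[->]|/eqP[->]]|//]|//]; auto.
have colE y : inr y \in S -> y = y0 \/ y = y1.
  by rewrite SE !inE => /orP[/orP[/orP[//|//]|/eqP[->]]|/eqP[->]]; auto.
have nx' : (x1 == x0) = false by rewrite eq_sym (negPf nx).
have ny' : (y1 == y0) = false by rewrite eq_sym (negPf ny).
exists A; split; last first.
  by move=> x y /rowE[->|->] /colE[->|->]; rewrite !mxE ?eqxx ?nx' ?ny'.
case=> [|[|[|k]]] f g injf injg Sf Sg.
- by rewrite det_mx00; apply: pf_elt1.
- by rewrite det_mx11 !mxE; do 2?case: ifP => _.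
- have nf : f ord0 != f 1 by rewrite (inj_eq injf).
  have ng : g ord0 != g 1 by rewrite (inj_eq injg).
  have Ndet : pf_elt (a01 * a10 - a00 * a11) by rewrite -opprB; apply: pf_eltN.
  rewrite det2E !mxE.
  have [ef|ef] := rowE _ (Sf ord0); have [ef'|ef'] := rowE _ (Sf 1);
    move: nf; rewrite ef ef' ?eqxx ?nx' // => _;
  have [eg|eg] := colE _ (Sg ord0); have [eg'|eg'] := colE _ (Sg 1);
    move: ng; rewrite eg eg' ?eqxx ?ny' // => _.
  + by rewrite [a11 * a00]mulrC [a10 * a01]mulrC.
  by rewrite [a11 * a00]mulrC [a10 * a01]mulrC.
have SfE i : f i \in [set x0; x1] by rewrite !inE; case: (rowE _ (Sf i)) => ->; rewrite eqxx ?orbT.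
have : (#|f @: setT| <= #|[set x0; x1]|)%N.
  by apply: subset_leq_card; apply/subsetP=> _ /imsetP[i _ ->].
by rewrite card_imset // cardsT card_ord cards2; case: (_ != _).
Qed.

(* On a cycle of length at least 6, a pivot creates a vertex of degree 3.        *)
Lemma has_lift_cycle m n (S : {set 'I_m + 'I_n}) (D : 'M[P]_(m, n)) x0 :
  (forall D' v, pmat_on S D' -> v \in S -> has_lift (S :\ v) D') ->
  pmat_on S D -> conn S D -> inl x0 \in S ->
  (forall v, v \in S -> #|nbrs S D v| = 2%N) -> has_lift S D.
Proof.
move=> IH pD cD Sx0 deg2.
have other v a : v \in S -> a \in nbrs S D v ->
    exists2 b, a != b & nbrs S D v = [set a; b].
  move=> Sv na; have /eqP/cards2P[b [c [nbc E]]] := deg2 v Sv.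
  move: na; rewrite E !inE => /orP[]/eqP->; first by exists c.
  by exists b; rewrite 1?eq_sym // setUC.
have inb v a : (a \in nbrs S D v) = (a \in S) && adj D v a by rewrite inE.
have otherc x y : inl x \in S -> inr y \in S -> D x y != 0 -> exists x',
    [/\ x != x', inl x' \in S, D x' y != 0 & nbrs S D (inr y) = [set inl x; inl x']].
  move=> Sx Sy xy; have [|b nb E] := other (inr y) (inl x) Sy; first by rewrite inb Sx.
  have : b \in nbrs S D (inr y) by rewrite E !inE eqxx orbT.
  rewrite inb; case: b nb E => [x'|y'] nb E; rewrite ?andbF //= => /andP[Sx' x'y].
  by exists x'; split=> //; apply: contraNneq nb => ->.
have otherr x y : inl x \in S -> inr y \in S -> D x y != 0 -> exists y',
    [/\ y != y', inr y' \in S, D x y' != 0 & nbrs S D (inl x) = [set inr y; inr y']].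
  move=> Sx Sy xy; have [|b nb E] := other (inl x) (inr y) Sx; first by rewrite inb Sy.
  have : b \in nbrs S D (inl x) by rewrite E !inE eqxx orbT.
  rewrite inb; case: b nb E => [x'|y'] nb E; rewrite ?andbF //= => /andP[Sy' xy'].
  by exists y'; split=> //; apply: contraNneq nb => ->.
have [w0 nw0] : exists w, w \in nbrs S D (inl x0).
  by apply/set0Pn; rewrite -card_gt0 deg2.
move: nw0; rewrite inb; case: w0 => [x'|y0]; rewrite ?andbF //= => /andP[Sy0 d00].
have [y1 [ny01 Sy1 d01 Ex0]] := otherr _ _ Sx0 Sy0 d00.
have [x1 [nx01 Sx1 d11 Ey1]] := otherc _ _ Sx0 Sy1 d01.
have [y2 [ny12 Sy2 d12 Ex1]] := otherr _ _ Sx1 Sy1 d11.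
(* If [D x0 y2] is nonzero, then [y2 = y0] and the cycle is a quadrilateral. *)
have [d02|d02] := eqVneq (D x0 y2) 0; last first.
  have y20 : y2 = y0.
    have : inr y2 \in nbrs S D (inl x0) by rewrite inb Sy2.
    by rewrite Ex0 !inE => /orP[]/eqP[] // e; rewrite e eqxx in ny12.
  subst y2; have [x2 [nx02 Sx2 d20 Ey0]] := otherc _ _ Sx0 Sy0 d00.
  have x21 : x2 = x1.
    have : inl x1 \in nbrs S D (inr y0) by rewrite inb Sx1.
    by rewrite Ey0 !inE => /orP[]/eqP[] // e; rewrite e eqxx in nx01.
  subst x2; apply: (has_lift_2x2 pD _ nx01 ny01); last by rewrite d00 d01 d12 d11.
  apply/setP=> v; set S0 := [set _; _; _; _].
  have S0S : {subset S0 <= S}.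
    by move=> a; rewrite !inE -!orbA => /or4P[]/eqP->.
  apply/idP/idP=> [Sv|]; last exact: S0S.
  suff -> : (v \in S0) = (inl x0 \in S0) by rewrite !inE eqxx.
  have closed a b : a \in S -> b \in S -> adj D a b -> a \in S0 -> b \in S0.
    move=> Sa Sb ab; rewrite !inE -!orbA => /or4P[]/eqP ea.
    - have : b \in nbrs S D a by rewrite inb Sb.
      by rewrite ea Ex0 !inE => /orP[]/eqP->; rewrite eqxx ?orbT.
    - have : b \in nbrs S D a by rewrite inb Sb.
      by rewrite ea Ex1 !inE => /orP[]/eqP->; rewrite eqxx ?orbT.
    - have : b \in nbrs S D a by rewrite inb Sb.
      by rewrite ea Ey0 !inE => /orP[]/eqP->; rewrite eqxx ?orbT.
    - have : b \in nbrs S D a by rewrite inb Sb.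
      by rewrite ea Ey1 !inE => /orP[]/eqP->; rewrite eqxx ?orbT.
  apply: (cD (mem S0)) => // a b Sa Sb ab; apply/idP/idP; first exact: closed.
  by apply: closed; rewrite // adj_sym.
have ny20 : y2 != y0 by apply: contraNneq d00 => <-; rewrite d02.
have d10 : D x1 y0 = 0.
  apply/eqP; apply: contraTT isT => nz.
  have : inr y0 \in nbrs S D (inl x1) by rewrite inb Sy0.
  rewrite Ex1 !inE => /orP[]/eqP[] e; first by rewrite e eqxx in ny01.
  by rewrite e eqxx in ny20.
have u11 : D x1 y1 \is a GRing.unit by apply: pf_unit => //; apply: pmat_on_entry pD _ _ _ _.
have u01 : D x0 y1 \is a GRing.unit by apply: pf_unit => //; apply: pmat_on_entry pD _ _ _ _.
have u12 : D x1 y2 \is a GRing.unit by apply: pf_unit => //; apply: pmat_on_entry pD _ _ _ _.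
have unit_neq0 (z : P) : z \is a GRing.unit -> z != 0.
  by apply: contraTneq => ->; rewrite unitr0.
(* The pivot at [(x1, y1)] keeps the entries of row [x0] at [y0] and [y1] nonzero and creates one at
   [y2]. *)
apply: (has_lift_pivot pD Sx1 Sy1 d11).
have pD' : pmat_on S (pivot D x1 y1) by apply: pmat_on_pivot.
apply: (has_lift_deg3 (z := inl x0)) => //.
- by move=> v Sv; apply: IH.
- exact: conn_pivot.
have inb' y : (inr y \in nbrs S (pivot D x1 y1) (inl x0)) =
    (inr y \in S) && (pivot D x1 y1 x0 y != 0) by rewrite inE.
apply/card_gt2P; exists (inr y0), (inr y1), (inr y2); split; split.
- by rewrite inb' Sy0 mxE (negPf nx01) (negPf ny01) d10 mulr0 mul0r subr0.
- by rewrite inb' Sy1 mxE (negPf nx01) eqxx unit_neq0 // unitrM u01 unitrV.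
- rewrite inb' Sy2 mxE (negPf nx01) (eq_sym y2) (negPf ny12) d02 sub0r oppr_eq0.
  by rewrite unit_neq0 // !unitrM u01 u12 unitrV.
- by apply: contraNneq ny01 => -[->].
- by apply: contraNneq ny12 => -[->].
- by apply: contraNneq ny20 => -[->].
Qed.

Theorem has_lift_on m n (S : {set 'I_m + 'I_n}) (D : 'M[P]_(m, n)) :
  pmat_on S D -> has_lift S D.
Proof.
move: {2}_.+1 (ltnSn #|S|) => N; elim: N => // N IHN in S D *; rewrite ltnS => leSN pD.
(* The matrix must vary: [has_lift_cycle] needs the induction hypothesis for a pivot of [D]. *)
have IH D' v : pmat_on S D' -> v \in S -> has_lift (S :\ v) D'.
  move=> pD' Sv; apply: IHN; last by apply: pmat_on_sub pD'; apply: subD1set.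
  by move: leSN; rewrite (cardsD1 v) Sv.
have [S0|[z Sz]] := set_0Vmem S.
  exists 0; split=> [|x y]; last by rewrite S0 inE.
  case=> [|k] f g _ _ Sf _; first by rewrite det_mx00; apply: pf_elt1.
  by have := Sf ord0; rewrite S0 inE.
have [cD|[S1 [sS1 S1z nS1 nadj]]] := component_split (adj D) Sz; last first.
  have SE : S = S1 :|: (S :\: S1) by rewrite setDE setUIr setUCr setIT (setUidPr sS1).
  have cardS : #|S| = (#|S1| + #|S :\: S1|)%N by rewrite -(cardsID S1 S) (setIidPr sS1).
  have pos1 : (0 < #|S1|)%N by apply/card_gt0P; exists z.
  have pos2 : (0 < #|S :\: S1|)%N.
    by rewrite card_gt0 setD_eq0; apply: contra nS1 => ?; rewrite eqEsubset sS1.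
  rewrite SE; apply: has_lift_setU => //.
  - by rewrite -setI_eq0; apply/eqP/setP=> a; rewrite !inE; case: (a \in S1).
  - apply: IHN; last exact: pmat_on_sub pD.
    by apply: leq_trans leSN; rewrite cardS -[X in (X < _)%N]addn0 ltn_add2l.
  - apply: IHN; last by apply: pmat_on_sub pD; apply: subsetDl.
    by apply: leq_trans leSN; rewrite cardS -[X in (X < _)%N]add0n ltn_add2r.
have [/exists_inP[v Sv leaf]|/exists_inPn noleaf] :=
    boolP [exists v in S, (#|nbrs S D v| <= 1)%N].
  exact: has_lift_leaf leaf (IH _ _ pD Sv).
have [/exists_inP[v Sv deg3]|/exists_inPn nodeg3] :=
    boolP [exists v in S, (2 < #|nbrs S D v|)%N].
  by apply: has_lift_deg3 deg3 => // w; apply: IH.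
have deg2 v : v \in S -> #|nbrs S D v| = 2%N.
  by move=> Sv; have := noleaf v Sv; have := nodeg3 v Sv; lia.
have [x0 Sx0] : exists x0, inl x0 \in S.
  case: z Sz => [x|y] Sz; first by exists x.
  have [w] : exists w, w \in nbrs S D (inr y) by apply/set0Pn; rewrite -card_gt0 deg2.
  by rewrite inE; case: w => [x|y'] /andP[Sw] //; exists x.
exact: (has_lift_cycle IH pD cD Sx0 deg2).
Qed.

End Existence.

(** * Monomials in t, t - 1 and t + 1 *)

Section Monomials.
Variable U : comUnitRingType.
Implicit Types (t x : U) (s : bool) (a b c : int).

(** As [t^2 - 1 = (t - 1)(t + 1)], the factor [t + 1] can replace the third generator of [K2]. *)
Definition mono t s a b c : U := (-1) ^+ s * t ^ a * (t - 1) ^ b * (t + 1) ^ c.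

Lemma gen_expz (S : {pred U}) y (k : int) : gen_subgroup S y -> gen_subgroup S (y ^ k).
Proof.
move=> gy; have gn n : gen_subgroup S (y ^+ n).
  by elim: n => [|n IHn]; [exact: gen1 | rewrite exprS; apply: genM].
by case: k => n; rewrite ?NegzE -?invr_expz; [|apply: genV]; apply: gn.
Qed.

Definition mono_gens t : {pred U} := [pred x in [:: t; t - 1; t ^+ 2 - 1]].

Definition mono_units t := [/\ t \is a GRing.unit, t - 1 \is a GRing.unit & t + 1 \is a GRing.unit].

Lemma sqr_sub1 t : t ^+ 2 - 1 = (t - 1) * (t + 1).
Proof. by ring. Qed.

Lemma mono_gens_unit t : mono_units t -> {subset mono_gens t <= GRing.unit}.
Proof.
move=> [u0 u1 u2] x; rewrite !inE => /or3P[]/eqP-> //.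
by rewrite sqr_sub1 unitrM u1.
Qed.

Lemma exprz_unit x a : x \is a GRing.unit -> x ^ a \is a GRing.unit.
Proof. by case: a => k ux; rewrite ?NegzE -?invr_expz ?unitrV unitrX. Qed.

Section Units.
Variable t : U.
Hypothesis ut : mono_units t.

Lemma mono_unit s a b c : mono t s a b c \is a GRing.unit.
Proof. by case: ut => *; rewrite !unitrM unitrX ?unitrN1 // !exprz_unit. Qed.

Lemma monoM s a b c s' a' b' c' :
  mono t s a b c * mono t s' a' b' c' = mono t (s (+) s') (a + a') (b + b') (c + c').
Proof.
case: ut => u0 u1 u2; rewrite /mono !exprzDr // signr_addb.
by ring.
Qed.

Lemma mono0 : mono t false 0 0 0 = 1.
Proof. by rewrite /mono !expr0z !mulr1. Qed.

Lemma monoV s a b c : (mono t s a b c)^-1 = mono t s (- a) (- b) (- c).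
Proof.
apply: (mulrI (mono_unit s a b c)); rewrite divrr ?mono_unit //.
by rewrite monoM addbb !subrr mono0.
Qed.

Lemma mono_PRS x : PRS_elt (mono_gens t) x <->
  x = 0 \/ exists s a b c, x = mono t s a b c.
Proof.
case: ut => u0 u1 u2; split=> [[->|gx]|[->|[s [a [b [c ->]]]]]]; [by left | right | by left | right].
  elim: gx => {x} [x|||x y _ [s [a [b [c ->]]]] _ [s' [a' [b' [c' ->]]]]|x _ [s [a [b [c ->]]]]].
  - rewrite !inE => /or3P[]/eqP->.
    + by exists false, 1, 0, 0; rewrite /mono !expr0z !mulr1 mul1r.
    + by exists false, 0, 1, 0; rewrite /mono !expr0z !mulr1 !mul1r.
    + exists false, 0, 1, 1; rewrite /mono !expr0z mulr1 !mul1r !expr1z.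
      exact: sqr_sub1.
  - by exists true, 0, 0, 0; rewrite /mono !expr0z !mulr1.
  - by exists false, 0, 0, 0; rewrite mono0.
  - by rewrite monoM; do 4!eexists.
  - by rewrite monoV; do 4!eexists.
have gX y k := @gen_expz (mono_gens t) y k.
have g0 : gen_subgroup (mono_gens t) t by apply: gen_in; rewrite !inE eqxx.
have g1 : gen_subgroup (mono_gens t) (t - 1) by apply: gen_in; rewrite !inE eqxx orbT.
have g2 : gen_subgroup (mono_gens t) (t + 1).
  have -> : t + 1 = (t ^+ 2 - 1) * (t - 1)^-1.
    by rewrite sqr_sub1 mulrAC divrr // mul1r.
  by apply/genM/genV/g1; apply: gen_in; rewrite !inE eqxx !orbT.
apply: genM; last exact: gX.
apply: genM; last exact: gX.
apply: genM; last exact: gX.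
by case: s; [rewrite expr1; apply: genN1 | apply: gen1].
Qed.

End Units.
End Monomials.

Lemma rmorph_mono (U V : comUnitRingType) (f : {rmorphism U -> V}) t s a b c :
  mono_units t -> f (mono t s a b c) = mono (f t) s a b c.
Proof.
case=> u0 u1 u2; rewrite /mono !rmorphM rmorphXn rmorphN1.
have fz x k : x \is a GRing.unit -> f (x ^ k) = f x ^ k.
  by case: k => n ux; rewrite ?NegzE -?invr_expz ?rmorphV ?unitrX // rmorphXn.
by rewrite !fz // rmorphB rmorphD rmorph1.
Qed.

(** * Cross-ratios of GF(4) x H2 *)

Section FieldOfOrderFour.
Variable F : finFieldType.
Hypothesis cardF : #|F| = 4.

Lemma GF4_two : 2 = 0 :> F.
Proof.
have := expf_card (-1 : F); rewrite cardF -signr_odd expr0 => /eqP.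
by rewrite -subr_eq0 opprK => /eqP.
Qed.

Lemma GF4_cubic (x : F) : x * (x - 1) * (x ^+ 2 + x + 1) = 0.
Proof.
have := expf_card x; rewrite cardF => /eqP; rewrite -subr_eq0 => /eqP <-.
by ring.
Qed.

Lemma GF4_omega : exists w : F, w ^+ 2 + w + 1 = 0.
Proof.
have /subsetPn[w _]: ~~ ([set: F] \subset [set 0; 1]).
  apply/negP=> /subset_leq_card; rewrite cardsT cardF cards2.
  by case: (_ != _).
rewrite !inE negb_or => /andP[w0 w1]; exists w.
have /eqP := GF4_cubic w; rewrite !mulf_eq0 subr_eq0 (negPf w0) (negPf w1).
by move/eqP.
Qed.

Lemma GF4_elts (w x : F) : w ^+ 2 + w + 1 = 0 -> x != 0 -> [\/ x = 1, x = w | x = w ^+ 2].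
Proof.
move=> hw x0; have /eqP := GF4_cubic x.
have -> : x ^+ 2 + x + 1 = (x - w) * (x - w ^+ 2).
  have e : w ^+ 2 = - w - 1 by apply/eqP; rewrite -subr_eq0; apply/eqP; rewrite -hw; ring.
  have -> : (x - w) * (x - w ^+ 2) = x ^+ 2 - x * (w + w ^+ 2) + w * w ^+ 2 by ring.
  by rewrite !e; transitivity (x ^+ 2 + x - w ^+ 2 - w); [rewrite e|]; ring.
rewrite !mulf_eq0 !subr_eq0 (negPf x0) /= => /orP[|/orP[]] /eqP->.
- by constructor 1.
- by constructor 2.
- by constructor 3.
Qed.

End FieldOfOrderFour.

Section GaussianUnits.
Variable R : realType.
Local Notation i := ('i%C : R[i]).

(** Multiplicative, with value 1 at i and 2 at [1 - i], so on [H2] it reads off the exponent of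
    [1 - i]. *)
Definition sqnorm (z : R[i]) : R := complex.Re z ^+ 2 + complex.Im z ^+ 2.

Lemma sqnormM z z' : sqnorm (z * z') = sqnorm z * sqnorm z'.
Proof. by case: z z' => [a b] [c d]; rewrite /sqnorm /=; ring. Qed.

Lemma sqnorm1 : sqnorm 1 = 1.
Proof. by rewrite /sqnorm /= expr1n expr0n addr0. Qed.

Lemma sqnormV z : z != 0 -> sqnorm z^-1 = (sqnorm z)^-1.
Proof.
move=> nz; have e : sqnorm z * sqnorm z^-1 = 1 by rewrite -sqnormM divff // sqnorm1.
have nN : sqnorm z != 0 by apply: contra_eq_neq e => ->; rewrite mul0r eq_sym oner_neq0.
by apply: (mulfI nN); rewrite e divff.
Qed.

Lemma one_sub_i_neq0 : 1 - i != 0.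
Proof. by rewrite -unitfE; apply: H2_gens_unit; rewrite !inE eqxx orbT. Qed.

Lemma i_neq0 : i != 0.
Proof. by rewrite -unitfE; apply: H2_gens_unit; rewrite !inE eqxx. Qed.

Lemma i4 l : i ^+ (4 * l) = 1.
Proof. by rewrite exprM (exprM i 2 2) sqr_i sqrrN !expr1n. Qed.

Lemma sqnorm_exp z (l : nat) : sqnorm (z ^+ l) = sqnorm z ^+ l.
Proof. by elim: l => [|l IHl]; rewrite ?sqnorm1 // !exprS sqnormM IHl. Qed.

Lemma sqnorm_i : sqnorm i = 1.
Proof. by rewrite /sqnorm /= expr1n expr0n add0r. Qed.

Lemma sqnorm_one_sub_i : sqnorm (1 - i) = 2.
Proof. by rewrite /sqnorm /= subr0 sub0r sqrrN !expr1n. Qed.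

Lemma H2_form y : gen_subgroup (@H2_gens R) y ->
  exists (l : nat) (c : int), y = i ^+ l * (1 - i) ^ c.
Proof.
have u1 : 1 - i \is a GRing.unit by rewrite unitfE one_sub_i_neq0.
elim=> {y} [y|||x y _ [l [c ->]] _ [l' [c' ->]]|x _ [l [c ->]]].
- rewrite !inE => /orP[]/eqP->; first by exists 1%N, 0; rewrite expr0z mulr1.
  by exists 0%N, 1; rewrite mul1r expr1z.
- by exists 2%N, 0; rewrite expr0z mulr1 sqr_i.
- by exists 0%N, 0; rewrite expr0z mulr1.
- by exists (l + l')%N, (c + c'); rewrite exprD exprzDr // mulrACA.
exists (3 * l)%N, (- c); rewrite invfM invr_expz; congr (_ * _).
by apply: (mulfI (expf_neq0 l i_neq0)); rewrite divff ?expf_neq0 ?i_neq0 // -exprD -mulSn i4.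
Qed.

Lemma sqnorm_form l (c : int) : sqnorm (i ^+ l * (1 - i) ^ c) = 2 ^ c.
Proof.
rewrite sqnormM sqnorm_exp sqnorm_i expr1n mul1r.
case: c => n; first by rewrite sqnorm_exp sqnorm_one_sub_i.
by rewrite NegzE -!invr_expz sqnormV ?expf_neq0 ?one_sub_i_neq0 // sqnorm_exp sqnorm_one_sub_i.
Qed.

Lemma two_expz_inj (c c' : int) : (2 : R) ^ c = 2 ^ c' -> c = c'.
Proof. by apply: ieexprIz; rewrite ?ltr0n // gt_eqF ?ltr1n. Qed.

Lemma gaussian_int (l n : nat) : exists p q : int,
  i ^+ l * (1 - i) ^+ n = (p%:~R +i* q%:~R)%C.
Proof.
elim: n => [|n [p [q IH]]].
  elim: l => [|l [p [q IH]]]; first by exists 1, 0; rewrite !expr0 mulr1.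
  exists (- q), p; rewrite exprS -mulrA IH; apply/eqP; rewrite eq_complex /= rmorphN.
  by apply/andP; split; apply/eqP; ring.
exists (p + q), (q - p); rewrite exprSr mulrA IH; apply/eqP; rewrite eq_complex /= rmorphB rmorphD /=.
by apply/andP; split; apply/eqP; ring.
Qed.

Lemma H2_fundamental_unit y : gen_subgroup (@H2_gens R) y -> y != 1 -> sqnorm y = 1 ->
  [\/ y = i, y = - i | y = -1].
Proof.
move=> /H2_form[l [c ->]] n1; rewrite sqnorm_form -(expr0z 2) => /two_expz_inj c0.
move: n1; rewrite {}c0 expr0z mulr1 (divn_eq l 4) exprD mulnC i4 mul1r.
have : (l %% 4 < 4)%N by rewrite ltn_mod.
case: (l %% 4)%N => [|[|[|[|//]]]] _; first by rewrite eqxx.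
- by constructor 1.
- by rewrite sqr_i; constructor 3.
- by rewrite exprS sqr_i mulrN1; constructor 2.
Qed.

(** Such a [y] is a Gaussian integer with real part [p] and norm [2^(n+1)]. The norm of [1 - y] is
    therefore the odd integer [1 - 2p + 2^(n+1)], and it is also a power of 2. *)
Lemma H2_fundamental_large y : gen_subgroup (@H2_gens R) y ->
  gen_subgroup (@H2_gens R) (1 - y) -> 1 < sqnorm y -> sqnorm (1 - y) = 1.
Proof.
move=> /H2_form[l [c ->]] /H2_form[l' [c' E]].
rewrite sqnorm_form; case: c E => [n|n] E; last first.
  move=> gt1; exfalso; move: gt1; apply/negP; rewrite -leNgt NegzE -invr_expz invf_le1 ?exprn_gt0 ?ltr0n //.
  by rewrite exprn_ege1 // ler1n.
case: n E => [|n] E; first by rewrite expr0z ltxx.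
move=> _; have := sqnorm_form l' c'; rewrite -E; have := sqnorm_form l n.+1.
have [p [q ->]] := gaussian_int l n.+1.
rewrite /sqnorm /= => Nz N1.
have N2 : ((1 - 2 * p + 2 ^+ n.+1)%:~R : R) = 2 ^ c'.
  rewrite -N1 rmorphD rmorphB rmorphM rmorph1 rmorphXn /= -exprnP in Nz *.
  by rewrite -Nz; ring.
suff c0 : c' = 0 by rewrite N1 c0.
case: c' {E N1} N2 => [[//|k]|k] N2; exfalso.
  have /intr_inj : ((1 - 2 * p + 2 ^+ n.+1)%:~R : R) = (2 ^+ k.+1 : int)%:~R.
    by rewrite N2 rmorphXn.
  by rewrite !exprS; move: (2 ^+ n) (2 ^+ k) => a b; lia.
have /intr_inj : ((1 - 2 * p + 2 ^+ n.+1) * 2 ^+ k.+1)%:~R = (1 : int)%:~R :> R.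
  rewrite intrM N2 NegzE -invr_expz rmorphXn /= mulVf //.
  by rewrite expf_neq0 // gt_eqF ?ltr0n.
by rewrite !exprS mulrCA; move: (_ * 2 ^+ k) => b; lia.
Qed.

End GaussianUnits.

(** * Cross-ratios of K2 *)

Section ThreeTerms.

Definition pmono (a b c : nat) : {poly int} := 'X ^+ a * ('X - 1) ^+ b * ('X + 1) ^+ c.

Lemma horner_pmono a b c x : (pmono a b c).[x] = x ^+ a * (x - 1) ^+ b * (x + 1) ^+ c.
Proof. by rewrite /pmono !hornerE. Qed.

Definition three_terms (s1 s2 s3 : bool) (a1 a2 a3 b1 b2 b3 c1 c2 c3 : nat) :=
  (-1) ^+ s1 * pmono a1 b1 c1 + (-1) ^+ s2 * pmono a2 b2 c2 + (-1) ^+ s3 * pmono a3 b3 c3 = 0.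

Lemma sign_eval (s : bool) (p : {poly int}) x : ((-1) ^+ s * p).[x] = (-1) ^+ s * p.[x].
Proof. by case: s; rewrite ?expr0 ?expr1 ?mul1r ?mulN1r ?hornerN. Qed.

Lemma three_terms_eval s1 s2 s3 a1 a2 a3 b1 b2 b3 c1 c2 c3 :
  three_terms s1 s2 s3 a1 a2 a3 b1 b2 b3 c1 c2 c3 -> forall x : int,
  (-1) ^+ s1 * (x ^+ a1 * (x - 1) ^+ b1 * (x + 1) ^+ c1) +
  (-1) ^+ s2 * (x ^+ a2 * (x - 1) ^+ b2 * (x + 1) ^+ c2) +
  (-1) ^+ s3 * (x ^+ a3 * (x - 1) ^+ b3 * (x + 1) ^+ c3) = 0.
Proof.
move=> E x; have := congr1 (horner^~ x) E.
by rewrite !hornerD !sign_eval !horner_pmono horner0.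
Qed.

(* For the exponents of X, X - 1 or X + 1 in three terms with sum 0: evaluating  *)
(* at the root shows that the factor cannot divide exactly two of them.          *)
Definition one_pos (a1 a2 a3 : nat) :=
  [|| [&& a1 == 0, a2 == 0 & a3 == 0], [&& (0 < a1), a2 == 0 & a3 == 0],
      [&& a1 == 0, (0 < a2) & a3 == 0] | [&& a1 == 0, a2 == 0 & (0 < a3)]]%N.

Lemma one_posP (u1 u2 u3 : int) a1 a2 a3 : u1 != 0 -> u2 != 0 -> u3 != 0 ->
  [|| a1 == 0, a2 == 0 | a3 == 0]%N ->
  u1 * (0 ^+ a1) + u2 * (0 ^+ a2) + u3 * (0 ^+ a3) = 0 -> one_pos a1 a2 a3.
Proof.
move=> n1 n2 n3; rewrite /one_pos !expr0n !lt0n.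
case: (a1 == 0)%N; case: (a2 == 0)%N; case: (a3 == 0)%N => //= _ /eqP;
  by rewrite ?mulr0 ?mulr1 ?addr0 ?add0r ?(negPf n1) ?(negPf n2) ?(negPf n3).
Qed.

Lemma double_root_deriv (q r : {poly int}) z :
  ('X - z%:P) ^+ 2 * q + r = 0 -> r^`().[z] = 0.
Proof.
move=> E; have := congr1 (fun p => p^`().[z]) E.
rewrite derivD derivM expr2 derivM deriv0 derivXsubC !hornerE /= subrr.
by rewrite !(mul0r, mulr0, add0r, subrr).
Qed.

Lemma pow2_inj c c' : (2 : int) ^+ c = 2 ^+ c' -> c = c'.
Proof. by rewrite -!natrX => /eqP; rewrite eqr_nat => /eqP/(expnI (isT : (1 < 2)%N)). Qed.

Lemma sign_pow2 (s s' : bool) c c' :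
  (-1) ^+ s * (2 : int) ^+ c + (-1) ^+ s' * 2 ^+ c' = 0 -> c = c'.
Proof.
move=> h; apply: pow2_inj; move: h; have := exprn_gt0 c (isT : 0 < 2 :> int).
have := exprn_gt0 c' (isT : 0 < 2 :> int).
by move: (2 ^+ c) (2 ^+ c') => x y; case: s; case: s'; rewrite ?expr0 ?expr1; lia.
Qed.

Lemma sign_pow_N2 (s : bool) a b :
  (-1) ^+ s * ((-1) ^+ a * (-1 - 1) ^+ b) = (-1) ^+ odd (s + a + b) * 2 ^+ b :> int.
Proof. by rewrite (_ : -1 - 1 = -1 * 2) // exprMn !mulrA -!exprD signr_odd. Qed.

Section Core.
Variables (s1 s2 s3 : bool) (a1 a2 a3 b1 b2 b3 c1 c2 c3 : nat).
Hypothesis T : three_terms s1 s2 s3 a1 a2 a3 b1 b2 b3 c1 c2 c3.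
Hypothesis min_a : [|| a1 == 0, a2 == 0 | a3 == 0]%N.
Hypothesis min_b : [|| b1 == 0, b2 == 0 | b3 == 0]%N.
Hypothesis min_c : [|| c1 == 0, c2 == 0 | c3 == 0]%N.

Let E := three_terms_eval T.
Let nzs (s : bool) : (-1) ^+ s != 0 :> int. Proof. by rewrite signr_eq0. Qed.

Lemma one_pos_a : one_pos a1 a2 a3.
Proof.
apply: (@one_posP ((-1) ^+ s1 * (-1) ^+ b1) ((-1) ^+ s2 * (-1) ^+ b2) ((-1) ^+ s3 * (-1) ^+ b3)) => //;
  rewrite ?mulf_neq0 ?expf_neq0 //.
have := E 0; rewrite sub0r add0r !expr1n !mulr1 => h; rewrite -[RHS]h.
by congr (_ + _ + _); rewrite -mulrA; congr (_ * _); apply: mulrC.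
Qed.

Lemma one_pos_b : one_pos b1 b2 b3.
Proof.
apply: (@one_posP ((-1) ^+ s1 * 2 ^+ c1) ((-1) ^+ s2 * 2 ^+ c2) ((-1) ^+ s3 * 2 ^+ c3)) => //;
  rewrite ?mulf_neq0 ?expf_neq0 //.
have := E 1; rewrite subrr !expr1n !mul1r => h; rewrite -[RHS]h.
by congr (_ + _ + _); rewrite -mulrA; congr (_ * _); apply: mulrC.
Qed.

Lemma one_pos_c : one_pos c1 c2 c3.
Proof.
pose u (s : bool) a b : int := (-1) ^+ s * ((-1) ^+ a * (-1 - 1) ^+ b).
apply: (@one_posP (u s1 a1 b1) (u s2 a2 b2) (u s3 a3 b3)) => //;
  rewrite ?mulf_neq0 ?expf_neq0 //.
have := E (-1); rewrite addNr => h; rewrite -[RHS]h /u.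
by rewrite -!mulrA.
Qed.

(* The relations (X - 1) - X + 1 = 0, (X + 1) - X - 1 = 0 and                    *)
(* (X - 1)(X + 1) - X^2 + 1 = 0, up to sign and exchange of the last two terms.  *)
Definition solution1 := [&& a1 == 0, b2 == 0, b3 == 0, c2 == 0, c3 == 0 &
  ((b1, c1, a2, a3, s2), s3) \in
  [:: ((1, 0, 1, 0, ~~ s1), s1); ((0, 1, 1, 0, ~~ s1), ~~ s1); ((1, 1, 2, 0, ~~ s1), s1);
      ((1, 0, 0, 1, s1), ~~ s1); ((0, 1, 0, 1, ~~ s1), ~~ s1); ((1, 1, 0, 2, s1), ~~ s1)]]%N.

(** If [X - 1] divides the first term, it divides no other, and the values at 1 of the other two are
    powers of 2 up to sign. These cancel, so [c2 = c3], and [one_pos_c] makes both zero. For [X + 1]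
    the argument is the same at -1. *)
Lemma others_eq0 : (0 < b1 + c1)%N -> [/\ b2 = 0, b3 = 0, c2 = 0 & c3 = 0]%N.
Proof.
move=> pos; have pb := one_pos_b; have pc := one_pos_c.
case: (posnP b1) => [b10|b1_gt0]; last first.
  have [b20 b30] : b2 = 0%N /\ b3 = 0%N by move: pb b1_gt0; rewrite /one_pos; clear; lia.
  have := E 1; rewrite b20 b30 subrr expr0n eqn0Ngt b1_gt0 !expr1n !expr0 !(mul1r, mul0r, mulr0, add0r).
  by move=> /sign_pow2 c23; split=> //; move: c23 pc; rewrite /one_pos; clear; lia.
have c1_gt0 : (0 < c1)%N by move: pos; rewrite b10.
have [c20 c30] : c2 = 0%N /\ c3 = 0%N by move: pc c1_gt0; rewrite /one_pos; clear; lia.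
have := E (-1); rewrite c20 c30 addNr expr0n eqn0Ngt c1_gt0 !expr0 !(mulr1, mulr0, add0r).
rewrite !sign_pow_N2.
by move=> /sign_pow2 b23; split=> //; move: b23 pb; rewrite /one_pos; clear; lia.
Qed.

(** The relation becomes [(X - 1)^b1 (X + 1)^c1 = X^n + 1] up to signs. The right side has no double
    root at 1 or -1, so [b1] and [c1] are at most 1, and the value at 2 bounds [n]. *)
Lemma solve1 : (0 < b1 + c1)%N -> solution1.
Proof.
move=> pos; have [b20 b30 c20 c30] := others_eq0 pos.
have E' (x : int) : (-1) ^+ s1 * (x ^+ a1 * (x - 1) ^+ b1 * (x + 1) ^+ c1) +
  (-1) ^+ s2 * x ^+ a2 + (-1) ^+ s3 * x ^+ a3 = 0.
  by have := E x; rewrite b20 b30 c20 c30 !expr0 !mulr1.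
have a10 : a1 = 0%N.
  apply/eqP; rewrite eqn0Ngt; apply/negP=> a1_gt0.
  have [a20 a30] : a2 = 0%N /\ a3 = 0%N by move: one_pos_a a1_gt0; rewrite /one_pos; clear; lia.
  have z23 : (-1) ^+ s2 + (-1) ^+ s3 = 0 :> int.
    case: (posnP b1) => [b10|b1_gt0]; last first.
      by have := E' 1; rewrite subrr expr0n eqn0Ngt b1_gt0 !expr1n !(mul0r, mulr0, mulr1, add0r).
    have c1_gt0 : (0 < c1)%N by move: pos; rewrite b10.
    by have := E' (-1); rewrite addNr expr0n eqn0Ngt c1_gt0 a20 a30 !expr0 !(mul0r, mulr0, mulr1, add0r).
  have /eqP := E' 2; rewrite a20 a30 !expr0 !mulr1 -addrA z23 addr0.
  by apply/negP; rewrite !mulf_neq0 ?expf_neq0.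
have E'' (x : int) : (-1) ^+ s1 * ((x - 1) ^+ b1 * (x + 1) ^+ c1) +
  (-1) ^+ s2 * x ^+ a2 + (-1) ^+ s3 * x ^+ a3 = 0.
  by have := E' x; rewrite a10 expr0 mul1r.
have pa : (0 < a2)%N && (a3 == 0)%N || (a2 == 0)%N && (0 < a3)%N.
  have : ~~ ((a2 == 0) && (a3 == 0))%N.
    apply/negP=> /andP[/eqP a20 /eqP a30]; have := E'' 0.
    rewrite a20 a30 !expr0 !mulr1 sub0r add0r expr1n mulr1 -(signr_odd _ b1).
    by case: (s1); case: (s2); case: (s3); case: (odd b1); rewrite ?expr0 ?expr1; lia.
  by move: one_pos_a a10; rewrite /one_pos; clear; lia.
pose r : {poly int} := (-1) ^+ s2 * 'X ^+ a2 + (-1) ^+ s3 * 'X ^+ a3.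
have rE : (-1) ^+ s1 * (('X - 1%:P) ^+ b1 * ('X - (-1)%:P) ^+ c1) + r = 0.
  by move: T; rewrite /three_terms /pmono a10 b20 b30 c20 c30 !expr0 !mulr1 mul1r addrA polyCN opprK polyC1.
have r' z : z != 0 -> r^`().[z] != 0.
  move=> nz; have nzX (s : bool) k l : (0 < k)%N -> l = 0%N ->
      ((-1) ^+ s * 'X ^+ k : {poly int})^`().[z] != 0 /\ ((-1) ^+ s * 'X ^+ l : {poly int})^`() = 0.
    move=> k0 ->; rewrite expr0 mulr1.
    case: s; rewrite ?expr0 ?expr1 ?mul1r ?mulN1r ?derivN ?derivC ?deriv1 ?oppr0 ?derivXn;
      by rewrite ?hornerN hornerMn hornerXn ?oppr_eq0 -mulr_natr mulf_neq0 ?expf_neq0 ?pnatr_eq0 -?lt0n.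
  case/orP: pa => /andP[p2 p3]; rewrite /r derivD.
    by have [h _] := nzX s2 _ 0%N p2 erefl; have [_ ->] := nzX s3 1%N _ isT (eqP p3); rewrite addr0.
  by have [h _] := nzX s3 _ 0%N p3 erefl; have [_ ->] := nzX s2 1%N _ isT (eqP p2); rewrite add0r.
(* 'X^n +- 1 has no double root at 1 or -1. *)
have b1_le1 : (b1 <= 1)%N.
  rewrite leqNgt; apply/negP=> b1_gt1; have /negP := r' 1 isT; apply; apply/eqP.
  apply: (@double_root_deriv ((-1) ^+ s1 * (('X - 1%:P) ^+ (b1 - 2) * ('X - (-1)%:P) ^+ c1))).
  by rewrite -rE -[in RHS](subnKC b1_gt1) exprD; ring.
have c1_le1 : (c1 <= 1)%N.
  rewrite leqNgt; apply/negP=> c1_gt1; have /negP := r' (-1) isT; apply; apply/eqP.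
  apply: (@double_root_deriv ((-1) ^+ s1 * (('X - 1%:P) ^+ b1 * ('X - (-1)%:P) ^+ (c1 - 2)))).
  by rewrite -rE -[in RHS](subnKC c1_gt1) exprD; ring.
(* At 2 the factor [X - 1] has value 1 and [X + 1] has value 3, which bounds the power of 2. *)
have small (s s' s'' : bool) k : 
    (-1) ^+ s * 3 ^+ c1 + (-1) ^+ s' * 2 ^+ k + (-1) ^+ s'' = 0 :> int -> (k <= 2)%N.
  case: k => [|[|[|k]]] //; rewrite !exprS.
  have : 0 < (2 : int) ^+ k by rewrite exprn_gt0.
  move: (2 ^+ k) => y; move: c1 c1_le1 => [|[|//]] _;
    by case: s; case: s'; case: s''; rewrite ?expr0 ?expr1; lia.
have E0 := E'' 0; have E1 := E'' 1; have Em1 := E'' (-1); have E2 := E'' 2.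
rewrite /solution1 a10 b20 b30 c20 c30.
have le2 : (a2 <= 2)%N && (a3 <= 2)%N.
  move: E2; rewrite expr1n mul1r; case/orP: pa => /andP[p2 p3].
    by rewrite (eqP p3) expr0 mulr1 => /small->.
  rewrite (eqP p2) expr0 mulr1 -addrA [X in _ + X]addrC addrA => /small->.
  by [].
(* The values at 0, 1, -1 and 2 decide the finitely many remaining cases. *)
move: E0 E1 Em1 E2 pos b1_le1 c1_le1 pa le2 => /eqP + /eqP + /eqP + /eqP.
case: (b1) => [|[|//]]; case: (c1) => [|[|//]] //; case: (a2) => [|[|[|//]]];
  case: (a3) => [|[|[|//]]] //; case: (s1); case: (s2); case: (s3); by vm_compute.
Qed.

End Core.
End ThreeTerms.

(** * The fundamental elements of K2 as exponent vectors *)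

Section FundamentalExponents.

(** Some term contains [X - 1] or [X + 1], since at 1 three signs cannot sum to 0; that term is
    moved to the front. *)
Lemma three_terms_sol s1 s2 s3 a1 a2 a3 b1 b2 b3 c1 c2 c3 :
  three_terms s1 s2 s3 a1 a2 a3 b1 b2 b3 c1 c2 c3 ->
  [|| a1 == 0, a2 == 0 | a3 == 0]%N -> [|| b1 == 0, b2 == 0 | b3 == 0]%N ->
  [|| c1 == 0, c2 == 0 | c3 == 0]%N ->
  [\/ solution1 s1 s2 s3 a1 a2 a3 b1 b2 b3 c1 c2 c3,
      solution1 s2 s1 s3 a2 a1 a3 b2 b1 b3 c2 c1 c3 |
      solution1 s3 s1 s2 a3 a1 a2 b3 b1 b2 c3 c1 c2].
Proof.
move=> T ma mb mc; case: (posnP (b1 + c1)) => [e1|p1]; last by constructor 1; apply: solve1.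
case: (posnP (b2 + c2)) => [e2|p2].
  case: (posnP (b3 + c3)) => [e3|p3].
    move: e1 e2 e3 => /eqP + /eqP + /eqP; rewrite !addn_eq0.
    move=> /andP[/eqP b10 /eqP c10] /andP[/eqP b20 /eqP c20] /andP[/eqP b30 /eqP c30].
    have := three_terms_eval T 1; rewrite b10 c10 b20 c20 b30 c30 !expr0 !expr1n !mulr1.
    by case: (s1); case: (s2); case: (s3); rewrite ?expr0 ?expr1; lia.
  constructor 3; apply: solve1 => //; last 3 first.
  - by move: ma; clear; lia.
  - by move: mb; clear; lia.
  - by move: mc; clear; lia.
  by move: T; rewrite /three_terms => <-; ring.
constructor 2; apply: solve1 => //; last 3 first.
- by move: ma; clear; lia.
- by move: mb; clear; lia.
- by move: mc; clear; lia.
by move: T; rewrite /three_terms => <-; ring.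
Qed.

(* (s, a, b, c) stands for (-1)^s t^a (t - 1)^b (t + 1)^c. *)
Definition exponents := (bool * int * int * int)%type.

Definition emono (U : comUnitRingType) (t : U) (e : exponents) :=
  let: (s, a, b, c) := e in mono t s a b c.

(* The six associates of alpha, of - alpha and of alpha^2. *)
Definition fundamental_exponents : seq exponents :=
  [:: (false, 1, 0, 0); (true, 0, 1, 0); (false, -1, 0, 0); (true, 0, -1, 0);
      (false, -1, 1, 0); (false, 1, -1, 0);
      (true, 1, 0, 0); (false, 0, 0, 1); (true, -1, 0, 0); (false, 0, 0, -1);
      (false, -1, 0, 1); (false, 1, 0, -1);
      (false, 2, 0, 0); (true, 0, 1, 1); (false, -2, 0, 0); (true, 0, -1, -1);
      (false, -2, 1, 1); (false, 2, -1, -1)].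

Section Eval.
Variables (U : comUnitRingType) (t : U).

Definition int_comm : commr_rmorph (intr : int -> U) t := fun x => mulrC t x%:~R.

Definition ev (p : {poly int}) : U := horner_morph int_comm p.

HB.instance Definition _ := GRing.RMorphism.copy ev (horner_morph int_comm).

Lemma evX : ev 'X = t.
Proof. exact: horner_morphX. Qed.

Lemma ev_pmono (s : bool) a b c : ev ((-1) ^+ s * pmono a b c) = mono t s a b c.
Proof.
by rewrite /pmono !rmorphM !rmorphXn rmorphN1 rmorphB rmorphD rmorph1 /= evX /mono !mulrA.
Qed.

End Eval.

Lemma rmorph_ev (U V : comUnitRingType) (f : {rmorphism U -> V}) t p :
  f (ev t p) = ev (f t) p.
Proof.
elim/poly_ind: p => [|p c IH]; first by rewrite !rmorph0.
have evC (W : comUnitRingType) (u : W) : ev u c%:P = c%:~R by rewrite /ev horner_morphC.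
by rewrite !rmorphD !rmorphM /= IH !evX !evC rmorph_int.
Qed.

Lemma ev_alpha (p : {poly int}) :
  ev alpha p = FracField.tofrac (map_poly intr p : {poly rat}).
Proof.
elim/poly_ind: p => [|p c IH]; first by rewrite !rmorph0.
rewrite !rmorphD !rmorphM /= IH evX map_polyX map_polyC /=; congr (_ + _).
by rewrite /ev horner_morphC (_ : (c%:~R)%:P = c%:~R :> {poly rat}) ?rmorph_int.
Qed.

Lemma ev_alpha_inj : injective (ev alpha).
Proof.
move=> p q /eqP; rewrite !ev_alpha tofrac_eq => /eqP.
by apply: map_inj_poly; [apply: intr_inj | rewrite rmorph0].
Qed.

Lemma alpha_units : mono_units alpha.
Proof.
have inj (p : {poly rat}) : p != 0 -> FracField.tofrac p \is a @GRing.unit {fraction {poly rat}}.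
  by rewrite unitfE tofrac_eq0.
rewrite /mono_units /alpha -tofrac1 -tofracB -tofracD; split; apply: inj.
- by rewrite polyX_eq0.
- by rewrite -polyC1 polyXsubC_eq0.
- by rewrite -polyC1 -[1%:P]opprK -polyCN polyXsubC_eq0.
Qed.

(** [a3] is minus the minimum of [a], [a'] and 0. This turns a relation between 1 and two Laurent
    monomials into one between polynomials without common factor. *)
Lemma clear_exponent (a a' : int) : exists a1 a2 a3 : nat,
  [/\ a + a3%:Z = a1, a' + a3%:Z = a2 & [|| a1 == 0, a2 == 0 | a3 == 0]%N].
Proof.
case: (lerP 0 a) => [a0|a0].
  case: (lerP 0 a') => [a'0|a'0]; first by exists `|a|%N, `|a'|%N, 0%N; split; lia.
  by exists `|a - a'|%N, 0%N, `|a'|%N; split; lia.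
case: (lerP a a') => aa'; first by exists 0%N, `|a' - a|%N, `|a|%N; split; lia.
by exists `|a - a'|%N, 0%N, `|a'|%N; split; lia.
Qed.

Lemma fundamental_alpha e e' : emono alpha e + emono alpha e' = 1 ->
  e \in fundamental_exponents.
Proof.
case: e => [[[s a] b] c]; case: e' => [[[s' a'] b'] c'] /= E.
have [a1 [a2 [a3 [ea ea' ma]]]] := clear_exponent a a'.
have [b1 [b2 [b3 [eb eb' mb]]]] := clear_exponent b b'.
have [c1 [c2 [c3 [ec ec' mc]]]] := clear_exponent c c'.
(* The third term is -1 times the monomial used to clear denominators. *)
have T : three_terms s s' true a1 a2 a3 b1 b2 b3 c1 c2 c3.
  apply: ev_alpha_inj; rewrite rmorph0 !rmorphD /= !ev_pmono (ev_pmono _ true).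
  rewrite -ea -ea' -eb -eb' -ec -ec' -[s]addbF -[s']addbF -!(monoM alpha_units) -mulrDl E mul1r.
  by rewrite /mono expr0 expr1; ring.
have {ea} -> : a = a1%:Z - a3%:Z by rewrite -ea addrK.
have {eb} -> : b = b1%:Z - b3%:Z by rewrite -eb addrK.
have {ec} -> : c = c1%:Z - c3%:Z by rewrite -ec addrK.
case: (three_terms_sol T ma mb mc) => /and5P[/eqP z1 /eqP z2 /eqP z3 /eqP z4 /andP[/eqP z5]];
  subst; rewrite !inE;
  do ?[case/orP]; move=> /eqP[e1 e2 e3 e4 es es']; rewrite ?(e1, e2, e3, e4);
  move: es es'; clear;
  by case: s; case: s' => // *; vm_compute.
Qed.

End FundamentalExponents.

(** * The lifting map onto GF(4) x H2 *)

Section Product.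
Variables (R : realType) (F : finFieldType) (w : F).
Hypotheses (cardF : #|F| = 4) (hw : w ^+ 2 + w + 1 = 0).

Let P := pf_prod (pf_of_field F) (H2 R).
Let K : fieldType := {fraction {poly rat}}.
Let Qring : comUnitRingType := (K * P)%type.

Definition tP : P := (w, 'i%C).
Definition tQ : Qring := (alpha, tP).

Lemma pair_unit (U V : comUnitRingType) (x : (U * V)%type) :
  (x \is a GRing.unit) = (x.1 \is a GRing.unit) && (x.2 \is a GRing.unit).
Proof. by []. Qed.

Lemma mono_units_pair (U V : comUnitRingType) (x : (U * V)%type) :
  mono_units x.1 -> mono_units x.2 -> mono_units x.
Proof. by case=> ? ? ? [? ? ?]; split; rewrite pair_unit; apply/andP. Qed.

Lemma w_units : mono_units w.
Proof.
have w0 : w != 0.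
  by apply: contra_eq_neq hw => ->; rewrite expr0n !add0r oner_neq0.
have two := GF4_two cardF.
have w1 : w + 1 != 0.
  apply: contra_eq_neq hw => e; rewrite -addrA e addr0 expf_neq0 //.
split; rewrite unitfE // (_ : w - 1 = w + 1) //.
by apply/eqP; rewrite -subr_eq0 opprD addrACA subrr add0r -opprD oppr_eq0; apply/eqP.
Qed.

Lemma i_units : mono_units ('i%C : R[i]).
Proof.
have u0 := i_neq0 R; have u1 := one_sub_i_neq0 R.
split; rewrite unitfE //; first by rewrite -opprB oppr_eq0.
rewrite (_ : 'i%C + 1 = 'i%C * (1 - 'i%C)) ?mulf_neq0 //.
by rewrite mulrBr mulr1 -expr2 sqr_i opprK.
Qed.

Lemma tP_units : mono_units (tP : P).
Proof. exact (@mono_units_pair F R[i] tP w_units i_units). Qed.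

Lemma tQ_units : mono_units tQ.
Proof. exact (@mono_units_pair K P tQ alpha_units tP_units). Qed.

(** No ring morphism goes from Q(alpha) to GF(4), where 2 is not invertible. Working inside the
    product ring makes the map from [alpha] to [(w, i)] a projection, hence a ring morphism. *)
Definition liftPF : partialField := PRS (mono_gens_unit tQ_units).
Definition lift_proj : {rmorphism liftPF -> P} := @snd K P.

Lemma liftPF_elt (q : liftPF) : pf_elt q <-> q = 0 \/ exists e, q = emono tQ e.
Proof.
split=> [/(mono_PRS tQ_units)[->|[s [a [b [c ->]]]]]|].
- by left.
- by right; exists (s, a, b, c).
move=> h; apply/(mono_PRS tQ_units); case: h => [->|[[[[s a] b] c] ->]]; first by left.
by right; exists s, a, b, c.
Qed.

Lemma emono_unit e : emono tQ e \is a GRing.unit.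
Proof. by case: e => [[[s a] b] c]; apply: mono_unit tQ_units _ _ _ _. Qed.

Lemma fst_emono e : (emono tQ e).1 = emono alpha e.
Proof. by case: e => [[[s a] b] c]; apply: (rmorph_mono (@fst K P) _ _ _ _ tQ_units). Qed.

Lemma snd_emono e : (emono tQ e).2 = emono tP e.
Proof. by case: e => [[[s a] b] c]; apply: (rmorph_mono (@snd K P) _ _ _ _ tQ_units). Qed.

Lemma snd_snd_emono e : (emono tP e).2 = emono 'i%C e.
Proof. by case: e => [[[s a] b] c]; apply: (rmorph_mono (@snd F R[i]) _ _ _ _ tP_units). Qed.

Lemma fst_snd_emono e : (emono tP e).1 = emono w e.
Proof. by case: e => [[[s a] b] c]; apply: (rmorph_mono (@fst F R[i]) _ _ _ _ tP_units). Qed.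

Lemma sign_w s : (-1) ^+ s = 1 :> F.
Proof.
have e : -1 = 1 :> F by apply/eqP; rewrite eq_sym -subr_eq0 opprK -(GF4_two cardF).
by rewrite e expr1n.
Qed.

Lemma w3 : w ^+ 3 = 1.
Proof.
have e : w ^+ 3 - 1 = (w - 1) * (w ^+ 2 + w + 1) by ring.
by apply/eqP; rewrite -subr_eq0 e hw mulr0.
Qed.

Lemma w_sqr : w ^+ 2 = w + 1 /\ w - 1 = w + 1.
Proof.
have e : -1 = 1 :> F by have := sign_w 1; rewrite expr1.
split; last by rewrite e.
have e' : w ^+ 2 = -1 * (w + 1) by apply/eqP; rewrite -subr_eq0 mulN1r opprK addrA hw.
by rewrite e' e mul1r.
Qed.

Lemma expz_eq1_dvd (U : comUnitRingType) (x : U) (n : nat) (k : int) :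
  x ^+ n.+1 = 1 -> (forall r, (r < n)%N -> x ^+ r.+1 != 1) -> x ^ k = 1 -> (n.+1 %| k)%Z.
Proof.
move=> xn min; have ux : x \is a GRing.unit by rewrite -(unitrX_pos _ (ltn0Sn n)) xn unitr1.
rewrite {1}(divz_eq k n.+1) exprzDr // (mulrC (k %/ _)%Z) -exprz_exp -exprnP xn exp1rz mul1r.
have : (0 <= k %% n.+1 < n.+1)%Z by rewrite modz_ge0 // ltz_pmod.
case E: (k %% n.+1)%Z => [[|r]|//] rn h; first exact/dvdz_mod0P.
by have := min r; rewrite -ltnS => /(_ rn); rewrite exprnP h eqxx.
Qed.

Lemma expz_w_eq1 (k : int) : w ^ k = 1 -> (3 %| k)%Z.
Proof.
have [w2 _] := w_sqr; case: w_units; rewrite !unitfE => nw0 nw1 nw2.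
apply: expz_eq1_dvd; first exact: w3.
case=> [|[|//]] _; first by rewrite expr1 -subr_eq0.
by rewrite w2 -subr_eq0 addrK.
Qed.

Lemma sqnorm_expz_i (k : int) : sqnorm (('i%C : R[i]) ^ k) = 1.
Proof.
case: k => n; first by rewrite sqnorm_exp sqnorm_i expr1n.
by rewrite NegzE -invr_expz sqnormV ?expf_neq0 ?i_neq0 // sqnorm_exp sqnorm_i expr1n invr1.
Qed.

Lemma expz_i_eq1 (k : int) : ('i%C : R[i]) ^ k = 1 -> (4 %| k)%Z.
Proof.
apply: expz_eq1_dvd; first by rewrite (i4 R 1).
case=> [|[|[|//]]] _.
- by rewrite expr1; apply/eqP=> -[/eqP]; rewrite eq_sym oner_eq0.
- by rewrite sqr_i -subr_eq0 -opprD oppr_eq0 -mulr2n pnatr_eq0.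
- by rewrite exprS sqr_i mulrN1; apply/eqP=> -[/eqP]; rewrite oppr0 eq_sym oner_eq0.
Qed.

(** In GF(4) signs disappear and [w - 1 = w + 1 = w^2]. *)
Lemma mono_w (s : bool) a b c : mono w s a b c = w ^ (a + 2 * b + 2 * c).
Proof.
have [w2 w1] := w_sqr; case: w_units => u0 _ _.
by rewrite /mono sign_w mul1r w1 -w2 (exprnP w 2) !exprz_exp -!exprzDr.
Qed.

(** From [t^2 = -1] follow [t - 1 = t^2 (1 - t)] and [t + 1 = t (1 - t)]. *)
Lemma mono_sqrtN1 (U : comUnitRingType) (t : U) (s : bool) a b c :
  t ^+ 2 = -1 -> mono_units t ->
  mono t s a b c = t ^ (2 * s%:Z + a + 2 * b + c) * (1 - t) ^ (b + c).
Proof.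
move=> t2 [u0 u1 _]; have u1' : 1 - t \is a GRing.unit by rewrite -opprB unitrN.
rewrite /mono (_ : t - 1 = t ^ 2 * (1 - t)); last by rewrite -exprnP t2 mulN1r opprB.
rewrite (_ : t + 1 = t * (1 - t)); last by rewrite mulrBr mulr1 -expr2 t2 opprK.
have pM (x y : U) k : x \is a GRing.unit -> y \is a GRing.unit -> (x * y) ^ k = x ^ k * y ^ k.
  by move=> ux uy; apply: exprMz_comm => //; apply: mulrC.
rewrite !pM ?exprz_unit // -t2 -exprM (exprnP _ (2 * s)) PoszM.
rewrite (_ : 2 * b = b + b) ?exprzDr //; last by lia.
by ring.
Qed.

Definition eadd (e e' : exponents) : exponents :=
  let: (s, a, b, c) := e in let: (s', a', b', c') := e' in
  (s (+) s', a + a', b + b', c + c').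

Definition eopp (e : exponents) : exponents :=
  let: (s, a, b, c) := e in (s, - a, - b, - c).

Lemma emonoD (U : comUnitRingType) (t : U) e e' : mono_units t ->
  emono t (eadd e e') = emono t e * emono t e'.
Proof. by move: e e' => [[[s a] b] c] [[[s' a'] b'] c'] ut /=; rewrite monoM. Qed.

Lemma emonoN (U : comUnitRingType) (t : U) e : mono_units t ->
  emono t (eopp e) = (emono t e)^-1.
Proof. by move: e => [[[s a] b] c] ut /=; rewrite monoV. Qed.

(* The image is (w^(a+2b+2c), i^(2s+a+2b+c) (1-i)^(b+c)).                        *)
Definition trivial_image (e : exponents) : bool :=
  let: (s, a, b, c) := e in
  [&& (3 %| a + 2 * b + 2 * c)%Z, b + c == 0 & (4 %| 2 * s%:Z + a + 2 * b + c)%Z].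

Lemma emono_tP_eq1 e : emono tP e = 1 -> trivial_image e.
Proof.
move=> E; have := congr1 fst E; have := congr1 snd E; rewrite fst_snd_emono snd_snd_emono.
case: e {E} => [[[s a] b] c] /= Ei Ew; apply/and3P.
rewrite mono_w in Ew; rewrite mono_sqrtN1 ?sqr_i // in Ei; last exact: i_units.
have bc0 : b + c = 0.
  apply: (@two_expz_inj R); rewrite expr0z -[RHS](sqnorm1 R) -Ei sqnormM sqnorm_expz_i mul1r.
  by have := sqnorm_form R 0 (b + c); rewrite expr0 mul1r => ->.
split; [exact: expz_w_eq1 | exact/eqP |].
by apply: expz_i_eq1; rewrite bc0 expr0z mulr1 in Ei.
Qed.

Lemma emono_tP_inj e e' : emono tP e = emono tP e' -> trivial_image (eadd e (eopp e')).
Proof.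
move=> E; apply: emono_tP_eq1; rewrite emonoD ?emonoN ?E ?divrr //; try exact: tP_units.
by case: e' {E} => [[[s a] b] c]; apply: mono_unit; apply: tP_units.
Qed.

Lemma fundamental_inj e e' : e \in fundamental_exponents -> e' \in fundamental_exponents ->
  trivial_image (eadd e (eopp e')) -> e = e'.
Proof.
have /allP chk : all (fun e1 => all (fun e2 => trivial_image (eadd e1 (eopp e2)) ==> (e1 == e2))
  fundamental_exponents) fundamental_exponents by vm_compute.
by move=> Le Le' h; have /allP/(_ _ Le') := chk _ Le; rewrite h => /eqP.
Qed.

(* The case of five points on a line comes down to these 18^3 instances. *)
Lemma fundamental_mul e1 e2 e3 : e1 \in fundamental_exponents ->
  e2 \in fundamental_exponents -> e3 \in fundamental_exponents ->
  trivial_image (eadd (eadd e1 e2) (eopp e3)) -> eadd e1 e2 = e3.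
Proof.
have /allP chk : all (fun e1 => all (fun e2 => all (fun e3 =>
  trivial_image (eadd (eadd e1 e2) (eopp e3)) ==> (eadd e1 e2 == e3))
  fundamental_exponents) fundamental_exponents) fundamental_exponents by vm_compute.
by move=> L1 L2 L3 h; have /allP/(_ _ L2)/allP/(_ _ L3) := chk _ L1; rewrite h => /eqP.
Qed.

(** If [x] and [1 - x] are both monomials, their first coordinates sum to 1 and [fundamental_alpha]
    applies. *)
Lemma fundamentalE (x : liftPF) : fundamental x ->
  [\/ x = 0, x = 1 | exists2 e, e \in fundamental_exponents & x = emono tQ e].
Proof.
move=> [/liftPF_elt[->|[e xE]]]; first by constructor 1.
move=> /liftPF_elt[/eqP|[e' yE]]; first by rewrite subr_eq0 => /eqP<-; constructor 2.
constructor 3; exists e => //; apply: (@fundamental_alpha e e').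
by rewrite -!fst_emono -xE -yE -[RHS]/((1 : liftPF).1) -(rmorphD (@fst K P)) /= addrC subrK.
Qed.

Lemma pi_emono_neq0 e : lift_proj (emono tQ e) != 0.
Proof.
have := rmorph_unit lift_proj (emono_unit e); apply: contraTneq => ->.
by rewrite unitr0.
Qed.

Lemma proj_eq0 (x : liftPF) : pf_elt x -> lift_proj x = 0 -> x = 0.
Proof. by move=> /liftPF_elt[//|[e ->]] /eqP; rewrite (negPf (pi_emono_neq0 e)). Qed.

Lemma fundamental_uniq (x x' : liftPF) : fundamental x -> fundamental x' ->
  lift_proj x = lift_proj x' -> x = x'.
Proof.
move=> Fx Fx' E; case: (fundamentalE Fx) (Fx) => [xE|xE|[e Le xE]] [Qx Q1x].
- by rewrite xE; apply/esym/proj_eq0; [case: Fx' | rewrite -E xE rmorph0].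
- rewrite xE; apply/eqP; rewrite -subr_eq0; apply/eqP/proj_eq0; first by case: Fx'.
  by rewrite rmorphB -E xE subrr.
case: (fundamentalE Fx') (Fx') => [yE|yE|[e' Le' yE]] [Qy Q1y].
- by rewrite yE; apply/proj_eq0; rewrite // E yE rmorph0.
- rewrite yE; apply/esym/eqP; rewrite -subr_eq0; apply/eqP/proj_eq0; first by case: Fx.
  by rewrite rmorphB E yE subrr.
rewrite xE yE; congr emono; apply: fundamental_inj => //; apply: emono_tP_inj.
by rewrite -!snd_emono -xE -yE.
Qed.

Lemma proj_elt (x : liftPF) : pf_elt x -> pf_elt (lift_proj x).
Proof.
move=> /liftPF_elt[->|[e ->]]; first by rewrite rmorph0; apply: pf_elt0.
have := rmorph_unit lift_proj (emono_unit e); rewrite /= snd_emono pair_unit => /andP[].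
rewrite !unitfE => n1 n2; split=> //; last by rewrite n1 n2.
right; rewrite snd_snd_emono; case: e {n1 n2} => [[[s a] b] c] /=.
have gi : gen_subgroup (@H2_gens R) 'i%C by apply: gen_in; rewrite !inE eqxx.
have g1 : gen_subgroup (@H2_gens R) (1 - 'i%C) by apply: gen_in; rewrite !inE eqxx orbT.
rewrite mono_sqrtN1 ?sqr_i //; last exact: i_units.
by apply: genM; apply: gen_expz.
Qed.

Definition in_image (p : P) := exists2 x : liftPF, pf_elt x & lift_proj x = p.

Lemma in_imageM p q : in_image p -> in_image q -> in_image (p * q).
Proof.
move=> [x Qx <-] [y Qy <-]; exists (x * y); last exact: rmorphM.
exact: pf_eltM.
Qed.

Lemma in_imageX p n : in_image p -> in_image (p ^+ n).
Proof.
move=> Ip; elim: n => [|n IHn]; last by rewrite exprS; apply: in_imageM.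
by exists 1; [apply: pf_elt1 | rewrite rmorph1].
Qed.

Lemma in_imageV p : in_image p -> p \is a GRing.unit -> in_image p^-1.
Proof.
move=> [x Qx <-] up; have nx : x != 0.
  by apply: contraTneq up => ->; rewrite rmorph0 unitr0.
exists x^-1; first exact: pf_eltV.
by rewrite rmorphV //; apply: pf_unit.
Qed.

Lemma emono_elt e : @pf_elt liftPF (emono tQ e).
Proof. by apply/liftPF_elt; right; exists e. Qed.

Lemma tQE : tQ = emono tQ (false, 1, 0, 0).
Proof. by rewrite /= /mono expr0 !expr0z !mulr1 mul1r. Qed.

Lemma tQB1E : tQ - 1 = emono tQ (false, 0, 1, 0).
Proof. by rewrite /= /mono expr0 !expr0z !mulr1 !mul1r. Qed.

Lemma tQD1E : tQ + 1 = emono tQ (false, 0, 0, 1).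
Proof. by rewrite /= /mono expr0 !expr0z !mul1r. Qed.

Lemma tQ_elt : @pf_elt liftPF tQ.
Proof. by rewrite tQE; apply: emono_elt. Qed.

Lemma tQB1_elt : @pf_elt liftPF (tQ - 1).
Proof. by rewrite tQB1E; apply: emono_elt. Qed.

Lemma tQD1_elt : @pf_elt liftPF (tQ + 1).
Proof. by rewrite tQD1E; apply: emono_elt. Qed.

Lemma image_t : in_image tP.
Proof. by exists tQ => //; apply: tQ_elt. Qed.

Lemma w_exp k : w ^+ (3 * k) = 1.
Proof. by rewrite exprM w3 expr1n. Qed.

Lemma P_ext (p q : P) : p.1 = q.1 -> p.2 = q.2 -> p = q.
Proof. by case: p q => [x y] [x' y'] /= -> ->. Qed.

Lemma P_fstX (p : P) n : (p ^+ n).1 = (p.1 : F) ^+ n.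
Proof. by elim: n => // n IHn; rewrite !exprS -IHn. Qed.

Lemma P_sndX (p : P) n : (p ^+ n).2 = (p.2 : R[i]) ^+ n.
Proof. by elim: n => // n IHn; rewrite !exprS -IHn. Qed.

Lemma image_w : in_image (w, 1).
Proof.
(* As [w] has order 3 and i has order 4, powers of [tP] separate the coordinates: 4 is 1 modulo 3
   and 0 modulo 4, and 9 below is 0 modulo 3 and 1 modulo 4. *)
suff -> : (w, 1) = tP ^+ 4 by apply/in_imageX/image_t.
apply: P_ext; first by rewrite P_fstX /= (exprD w 3 1) w3 mul1r.
by rewrite P_sndX /= (i4 R 1).
Qed.

Lemma image_i : in_image (1, 'i%C).
Proof.
suff -> : (1, 'i%C) = tP ^+ 9 by apply/in_imageX/image_t.
apply: P_ext; first by rewrite P_fstX /= (w_exp 3).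
by rewrite P_sndX /= (exprD _ 8 1) (i4 R 2) mul1r.
Qed.

Lemma image_1i : in_image (1, 1 - 'i%C).
Proof.
(* [w - 1 = w^2] needs an exponent 1 modulo 3, and the sign of [i - 1] needs 2 modulo 4; hence
   10. *)
suff -> : (1, 1 - 'i%C) = (tP - 1) * tP ^+ 10.
  apply/in_imageM/in_imageX/image_t; exists (tQ - 1); last by rewrite rmorphB rmorph1.
  exact: tQB1_elt.
have [w2 w1] := w_sqr.
apply: P_ext.
  rewrite -[RHS]/((w - 1) * (tP ^+ 10).1) P_fstX /= w1 -w2.
  by rewrite (exprD w 9 1) (w_exp 3) mul1r expr1 -exprSr w3.
rewrite -[RHS]/(('i%C - 1) * (tP ^+ 10).2) P_sndX /=.
by rewrite (exprD _ 8 2) (i4 R 2) mul1r sqr_i mulrN1 opprB.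
Qed.

Lemma image_N1 : in_image (1, -1).
Proof.
have e : -1 = 1 :> F by have := sign_w 1; rewrite expr1.
by exists (-1); [apply/pf_eltN/pf_elt1 | rewrite rmorphN1 -[in RHS]e].
Qed.

Lemma proj_onto (p : P) : pf_elt p -> in_image p.
Proof.
case: p => x y [_ /= [->|gy] nx].
  move: nx; rewrite eqxx => /negbFE/eqP->.
  by exists 0; [apply: pf_elt0 | rewrite rmorph0].
have uy := gen_unit (@H2_gens_unit R) gy.
rewrite -(unitfE y) uy in nx.
have -> : (x, y) = (x, 1) * (1, y) :> P by congr pair; rewrite /= ?mulr1 ?mul1r.
apply: in_imageM.
  have I1 : in_image 1 by exact: (in_imageX 0 image_t).
  case: (GF4_elts cardF hw nx) => ->; [exact: I1 | exact: image_w |].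
  have -> : (w ^+ 2, 1) = (w, 1) ^+ 2 :> P by apply: P_ext; rewrite ?P_fstX ?P_sndX /= ?expr1n.
  exact: in_imageX image_w.
elim: gy {uy nx} => {y} [y|||y z _ Iy _ Iz|y gy Iy].
- by rewrite !inE => /orP[]/eqP->; [exact: image_i | exact: image_1i].
- exact: image_N1.
- exact: (in_imageX 0 image_t).
- have -> : (1, y * z) = (1, y) * (1, z) :> P by congr pair; rewrite /= mulr1.
  exact: in_imageM.
have uy := gen_unit (@H2_gens_unit R) gy.
have u1y : ((1, y) : P) \is a GRing.unit by rewrite pair_unit unitr1.
have -> : (1, y^-1) = (1, y)^-1 :> P.
  by apply: (mulrI u1y); rewrite divrr //; congr pair; rewrite /= ?mulr1 ?divrr.
exact: in_imageV.
Qed.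

End Product.

(** * Lifting the cross-ratios of the product *)

Section LiftMap.
Variables (R : realType) (F : finFieldType) (w : F).
Hypotheses (cardF : #|F| = 4) (hw : w ^+ 2 + w + 1 = 0).

Local Notation P := (pf_prod (pf_of_field F) (H2 R)).
Local Notation Q := (liftPF R cardF hw).
Local Notation pi := (lift_proj R cardF hw).
Local Notation t := (tQ R w).
Local Notation tP := (tP R w).

Lemma liftable_t : liftable pi tP.
Proof.
exists t => //; split; first exact: tQ_elt.
by rewrite -opprB; apply/pf_eltN/tQB1_elt.
Qed.

Lemma liftable_Nt : liftable pi (- tP).
Proof.
exists (- t); last exact: rmorphN.
by split; rewrite ?opprK 1?addrC; [apply/pf_eltN/tQ_elt | apply: tQD1_elt].
Qed.

Lemma liftable_t2 : liftable pi (tP ^+ 2).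
Proof.
exists (t ^+ 2); last exact: rmorphXn.
split; first by rewrite expr2; apply: pf_eltM; apply: tQ_elt.
by rewrite -opprB sqr_sub1; apply/pf_eltN/pf_eltM; [apply: tQB1_elt | apply: tQD1_elt].
Qed.

Definition P_cross_ratio (p : P) :=
  [/\ p.1 != 0, p.1 != 1, p.2 != 0, p.2 != 1 &
      gen_subgroup (@H2_gens R) p.2 /\ gen_subgroup (@H2_gens R) (1 - p.2)].

Lemma P_cross_ratio_1B p : P_cross_ratio p -> P_cross_ratio (1 - p).
Proof.
move=> [n1 n2 n3 n4 [g1 g2]]; split=> /=.
- by rewrite subr_eq0 eq_sym.
- by rewrite -subr_eq0 addrAC subrr add0r oppr_eq0.
- by rewrite subr_eq0 eq_sym.
- by rewrite -subr_eq0 addrAC subrr add0r oppr_eq0.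
by split; rewrite // opprB addrC subrK.
Qed.

Lemma P_cross_ratio_V p : P_cross_ratio p ->
  exists q, [/\ P_cross_ratio q, p * q = 1 & sqnorm q.2 = (sqnorm p.2)^-1].
Proof.
move=> [n1 n2 n3 n4 [g1 g2]]; exists (p.1^-1, p.2^-1); split; last by rewrite /= sqnormV.
  split=> /=; rewrite ?invr_eq0 ?invr_eq1 //; split; first exact: genV.
  have -> : 1 - p.2^-1 = -1 * ((1 - p.2) * p.2^-1) :> R[i].
    by rewrite mulrBl divff // mul1r mulN1r opprB.
  by apply/genM/genM/genV/g1; [apply: genN1 | ].
by apply: P_ext => /=; rewrite divff.
Qed.

(** The first coordinate is [w] or [w^2], the second is i, -i or -1. The six pairs are [tP], [- tP],
    [tP ^+ 2] and their inverses, because [- w = w]. *)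
Lemma liftable_unit p : P_cross_ratio p -> sqnorm p.2 = 1 -> liftable pi p.
Proof.
case: p => x y [/= n1 n2 n3 n4 [g1 g2]] N1.
have w3 := w3 hw.
have eN : -1 = 1 :> F by have := sign_w cardF 1; rewrite expr1.
have eNw : - w = w by rewrite -mulN1r eN mul1r.
have : x = w \/ x = w ^+ 2.
  by case: (GF4_elts cardF hw n1) n2 => ->; rewrite ?eqxx; auto.
case=> ->; case: (H2_fundamental_unit g1 n4 N1) => ->.
- exact: liftable_t.
- suff -> : (w, - 'i%C) = - tP by apply: liftable_Nt.
  by apply: P_ext => //=; rewrite eNw.
- apply: liftable_mul1 liftable_t2; apply: P_ext.
    by rewrite -[LHS]/(w * (w * w)) -expr2 -exprS.
  by rewrite -[LHS]/(-1 * ('i%C * 'i%C)) -expr2 sqr_i mulN1r opprK.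
- apply: liftable_mul1 liftable_Nt; apply: P_ext.
    by rewrite -[LHS]/(w ^+ 2 * (- w)) eNw -exprSr.
  by rewrite -[LHS]/('i%C * (- 'i%C)) mulrN -expr2 sqr_i opprK.
- apply: liftable_mul1 liftable_t; apply: P_ext.
    by rewrite -[LHS]/(w ^+ 2 * w) -exprSr.
  by rewrite -[LHS]/(- 'i%C * 'i%C) mulNr -expr2 sqr_i opprK.
suff -> : (w ^+ 2, -1) = tP ^+ 2 by apply: liftable_t2.
by apply: P_ext => //; rewrite -[RHS]/('i%C * 'i%C) -expr2 sqr_i.
Qed.

Lemma liftable_large p : P_cross_ratio p -> 1 < sqnorm p.2 -> liftable pi p.
Proof.
move=> Cp gt1; have -> : p = 1 - (1 - p) by rewrite opprB addrC subrK.
apply/liftable_1B/liftable_unit; first exact: P_cross_ratio_1B.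
by case: Cp => _ _ _ _ [g1 g2]; apply: H2_fundamental_large.
Qed.

Lemma P_elt_neq0 (p : P) : pf_elt p -> p != 0 -> [/\ p.1 != 0, p.2 != 0 & gen_subgroup (@H2_gens R) p.2].
Proof.
move=> Pp np; have [n1 n2] := prod_neq0 Pp np; split=> //.
by case: Pp => _ [e|//] _; rewrite e eqxx in n2.
Qed.

(** Inversion turns norm below 1 into norm above 1, and then [1 - p] has norm 1; both operations
    preserve liftability. *)
Lemma proj_fund (p : P) : pf_elt p -> pf_elt (1 - p) -> liftable pi p.
Proof.
move=> Pp P1p; have [->|np] := eqVneq p 0.
  exists 0; last exact: rmorph0.
  by split; rewrite ?subr0; [apply: pf_elt0 | apply: pf_elt1].
have [e|n1p] := eqVneq (1 - p) 0.
  move/eqP: e; rewrite subr_eq0 => /eqP<-; exists 1; last exact: rmorph1.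
  by split; rewrite ?subrr; [apply: pf_elt1 | apply: pf_elt0].
have [a1 a2 a3] := P_elt_neq0 Pp np; have [b1 b2 b3] := P_elt_neq0 P1p n1p.
have Cp : P_cross_ratio p.
  by split=> //; [move: b1 | move: b2]; rewrite /= subr_eq0 eq_sym.
case: (ltrgtP 1 (sqnorm p.2)) => [gt1|lt1|/esym e1].
- exact: liftable_large.
- have [q [Cq pq Nq]] := P_cross_ratio_V Cp.
  apply: liftable_mul1 pq _; apply: liftable_large => //.
  rewrite Nq invf_gt1 // lt0r; apply/andP; split; last by rewrite addr_ge0 ?sqr_ge0.
  have := sqnormM p.2 p.2^-1; rewrite divff // sqnorm1.
  by apply: contra_eq_neq => ->; rewrite mul0r oner_neq0.
exact: liftable_unit.
Qed.

Lemma proj_mul (x y z : Q) : fundamental x -> fundamental y -> fundamental z ->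
  x != 0 -> x != 1 -> y != 0 -> y != 1 -> pi (x * z) = pi y -> x * z = y.
Proof.
move=> Fx Fy Fz nx0 nx1 ny0 ny1 zx.
case: (fundamentalE Fx) nx0 nx1 => [->|->|[e Le xE] _ _]; rewrite ?eqxx //.
case: (fundamentalE Fy) ny0 ny1 => [->|->|[e' Le' yE] _ _]; rewrite ?eqxx //.
case: (fundamentalE Fz) => [z0|z1|[e3 Le3 z3]].
- move: zx; rewrite z0 mulr0 rmorph0 yE => /esym/eqP.
  by rewrite (negPf (pi_emono_neq0 _ _ _ _)).
- by move: zx; rewrite z1 !mulr1 => /(fundamental_uniq Fx Fy).
rewrite xE yE z3 -emonoD; last exact: tQ_units.
congr emono; apply: fundamental_mul => //.
apply: (emono_tP_inj (R := R) cardF hw); rewrite -!snd_emono // emonoD; last exact: tQ_units.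
by have := zx; rewrite xE yE z3.
Qed.

Lemma proj_sub (x y : Q) : fundamental x -> fundamental y ->
  pf_elt (pi (x - y)) -> pf_elt (x - y).
Proof.
move=> Fx Fy; have [Qx Q1x] := Fx; have [Qy Q1y] := Fy.
have [->|nx0] := eqVneq x 0; first by rewrite sub0r => _; apply: pf_eltN.
have [->|nx1] := eqVneq x 1; first by [].
have [->|ny0] := eqVneq y 0; first by rewrite subr0.
have [->|ny1] := eqVneq y 1; first by rewrite -opprB => _; apply: pf_eltN.
apply: liftable_sub => //.
- exact: proj_elt.
- exact: proj_eq0.
- by move=> p [Pp P1p]; apply: proj_fund.
by move=> z Fz; apply: proj_mul.
Qed.

Theorem lift_proj_lift_map : lift_map pi.
Proof.
split.
- exact: proj_elt.
- exact: proj_eq0.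
- exact: proj_onto.
- by move=> p Pp P1p; have [x [Qx Q1x] xp] := proj_fund Pp P1p; exists x.
- by move=> x x' Qx Q1x Qx' Q1x'; apply: fundamental_uniq.
- by move=> x y *; apply: proj_sub.
(* In the product, 2 is zero in GF(4) but not in the complex numbers, so it is not an element. *)
case=> _ _; change ((2 : F) != 0 = ((2 : R[i]) != 0) -> False).
by rewrite (GF4_two cardF) eqxx pnatr_eq0.
Qed.

End LiftMap.

(** * Representability *)

Section Transfer.
Variables (P1 P2 : partialField) (E : finType) (M : matroid E).
Variables (m : nat) (A1 : 'M[P1]_(m, #|E|)) (A2 : 'M[P2]_(m, #|E|)).
Hypothesis A2_pmatrix : is_pmatrix A2.
Hypothesis A12 : forall g : 'I_m -> 'I_#|E|,
  (\det (colsub g A1) != 0) = (\det (colsub g A2) != 0).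

Lemma representable_transfer : full_row_rank A1 ->
  (forall B : {set E}, B \in bases M <-> col_basis A1 B) -> representable P2 M.
Proof.
move=> [g injg nzg] MA1; exists m, A2; split=> //; first by exists g; rewrite // -A12.
move=> B; rewrite MA1; split=> -[h [injh BE nzh]]; exists h; split=> //.
  by rewrite -A12.
by rewrite A12.
Qed.

End Transfer.

Section Main.
Variables (R : realType) (F : finFieldType) (w : F).
Hypotheses (cardF : #|F| = 4) (hw : w ^+ 2 + w + 1 = 0).

Local Notation P := (pf_prod (pf_of_field F) (H2 R)).
Local Notation Q := (liftPF R cardF hw).
Local Notation pi := (lift_proj R cardF hw).
Local Notation t := (tQ R w).
Local Notation K := {fraction {poly rat}}.

Lemma K2_elt (x : K2) : pf_elt x <-> x = 0 \/ exists s a b c, x = mono alpha s a b c.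
Proof. exact: (mono_PRS alpha_units). Qed.

Definition Qfst : {rmorphism Q -> K} := @fst K P.

Lemma fst_elt (q : Q) : pf_elt q -> @pf_elt K2 (Qfst q).
Proof.
move=> /liftPF_elt[->|[[[[s a] b] c] ->]]; apply/K2_elt; first by left; rewrite rmorph0.
by right; exists s, a, b, c; rewrite [LHS]fst_emono.
Qed.

Lemma fst_neq0 (q : Q) : pf_elt q -> (Qfst q != 0) = (q != 0).
Proof.
move=> /liftPF_elt[->|[e ->]]; first by rewrite rmorph0 !eqxx.
have u := emono_unit R cardF hw e.
have nz (U : comUnitRingType) (z : U) : z \is a GRing.unit -> z != 0.
  by apply: contraTneq => ->; rewrite unitr0.
by rewrite (nz _ _ u) nz //; apply: (rmorph_unit Qfst).
Qed.

(** Multiplying by a power of [t (t - 1) (t + 1)] turns the membership at [alpha] into an identity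
    of integer polynomials, by [ev_alpha_inj]; such an identity can be evaluated at any [t]. *)
Lemma ev_elt (p : {poly int}) : @pf_elt K2 (ev alpha p) -> @pf_elt Q (ev t p).
Proof.
move=> /K2_elt[e0|[s [a [b [c pE]]]]].
  by rewrite (ev_alpha_inj (etrans e0 (esym (rmorph0 _)))) rmorph0; apply: pf_elt0.
pose N := (`|a|%N + `|b|%N + `|c|%N)%N.
have [a' aE] : exists a' : nat, a + N%:Z = a'%:Z by exists (absz (a + N%:Z)); lia.
have [b' bE] : exists b' : nat, b + N%:Z = b'%:Z by exists (absz (b + N%:Z)); lia.
have [c' cE] : exists c' : nat, c + N%:Z = c'%:Z by exists (absz (c + N%:Z)); lia.
have evN (U : comUnitRingType) (u : U) : ev u (pmono N N N) = mono u false N N N.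
  by rewrite -(ev_pmono u false) expr0 mul1r.
have pN : p * pmono N N N = (-1) ^+ s * pmono a' b' c'.
  apply: ev_alpha_inj; rewrite rmorphM [LHS]/= evN ev_pmono pE monoM ?addbF ?aE ?bE ?cE //.
  exact: alpha_units.
have ut := tQ_units R cardF hw.
apply/liftPF_elt; right; exists (s, a, b, c).
apply: (mulIr (mono_unit ut false N N N)); rewrite /= monoM // addbF aE bE cE.
by rewrite -evN -[RHS]ev_pmono -pN [RHS]rmorphM.
Qed.

Lemma representable_K2 (E : finType) (M : matroid E) : representable P M -> representable K2 M.
Proof.
move=> [m [A [pA rkA MA]]].
have pTA : pmat_on setT A by move=> k f g injf injg _ _; apply: pA.
have [B [pB BA]] := has_lift_on (lift_proj_lift_map R cardF hw) pTA.
have mB k (f : 'I_k -> 'I_m) g : pf_elt (\det (mxsub f g B)).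
  by apply: (pmat_on_minor pB) => i; rewrite inE.
have detP k (f : 'I_k -> 'I_m) g : \det (mxsub f g A) = pi (\det (mxsub f g B)).
  rewrite -det_map_mx; congr (\det _).
  by apply/matrixP=> x y; rewrite !mxE BA ?inE.
have detK k (f : 'I_k -> 'I_m) g :
    \det (mxsub f g (map_mx Qfst B)) = Qfst (\det (mxsub f g B)).
  by rewrite -map_mxsub det_map_mx.
apply: (@representable_transfer P K2 _ _ _ A (map_mx Qfst B)) => //.
  by move=> k f g injf injg; rewrite [X in pf_elt X]detK; apply: fst_elt.
move=> g; rewrite detP (pi_neq0 (lift_proj_lift_map R cardF hw)) //.
by rewrite detK fst_neq0.
Qed.

(** One monomial [d N] clears the denominators of all entries. This multiplies a minor of size [k]
    by the unit [d N ^+ k], so the minors of the integer polynomial matrix stay in [K2] and vanish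
    exactly when those of [A] do. *)
Lemma representable_P (E : finType) (M : matroid E) : representable K2 M -> representable P M.
Proof.
move=> [m [A [pA rkA MA]]].
have uK := alpha_units; pose d N : K := mono alpha false N N N.
have entry (xy : 'I_m * 'I_#|E|) : exists n : nat, forall N, (n <= N)%N ->
    exists p : {poly int}, ev alpha p = d N * A xy.1 xy.2.
  case: xy => x y; have /K2_elt : @pf_elt K2 (A x y).
    by rewrite -(det_minor1 A x y); apply: pA => i j; rewrite !ord1.
  case=> [->|[s [a [b [c ->]]]]]; first by exists 0%N => N _; exists 0; rewrite rmorph0 mulr0.
  exists (`|a|%N + `|b|%N + `|c|%N)%N => N leN.
  have [a' aE] : exists a' : nat, N%:Z + a = a'%:Z by exists (absz (N%:Z + a)); lia.
  have [b' bE] : exists b' : nat, N%:Z + b = b'%:Z by exists (absz (N%:Z + b)); lia.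
  have [c' cE] : exists c' : nat, N%:Z + c = c'%:Z by exists (absz (N%:Z + c)); lia.
  by exists ((-1) ^+ s * pmono a' b' c'); rewrite ev_pmono monoM // aE bE cE.
have [n nP] := fin_all_exists entry.
pose N := \max_xy n xy.
have /fin_all_exists[p pE] : forall xy, exists p : {poly int}, ev alpha p = d N * A xy.1 xy.2.
  by move=> xy; apply: nP; apply: leq_bigmax.
pose Z : 'M[{poly int}]_(m, #|E|) := \matrix_(x, y) p (x, y).
have det_ev k (f : 'I_k -> 'I_m) g : ev alpha (\det (mxsub f g Z)) = d N ^+ k * \det (mxsub f g A).
  rewrite -det_map_mx -detZ; congr (\det _).
  by apply/matrixP=> x y; rewrite !mxE /= pE.
have dK : @pf_elt K2 (d N) by apply/K2_elt; right; exists false, N%:Z, N%:Z, N%:Z.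
have dn0 : d N != 0 by rewrite -unitfE; apply: mono_unit.
have dX k : @pf_elt K2 (d N ^+ k).
  by elim: k => [|k IHk]; [apply: pf_elt1 | rewrite exprS; apply: pf_eltM].
have eltA k (f : 'I_k -> 'I_m) g : @pf_elt K2 (\det (mxsub f g A)).
  have pTA : pmat_on setT A by move=> k' f' g' injf injg _ _; apply: pA.
  by apply: (pmat_on_minor pTA) => i; rewrite inE.
pose B : 'M[Q]_(m, #|E|) := map_mx (ev t) Z.
have detB k (f : 'I_k -> 'I_m) g : \det (mxsub f g B) = ev t (\det (mxsub f g Z)).
  by rewrite -map_mxsub det_map_mx.
have fstB k (f : 'I_k -> 'I_m) g :
    Qfst (\det (mxsub f g B)) = d N ^+ k * \det (mxsub f g A).
  by rewrite detB -det_ev; apply: (rmorph_ev Qfst t).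
have mB k (f : 'I_k -> 'I_m) g : @pf_elt Q (\det (mxsub f g B)).
  by rewrite detB; apply: ev_elt; rewrite det_ev; apply: pf_eltM.
have detP k (f : 'I_k -> 'I_m) g : \det (mxsub f g (map_mx pi B)) = pi (\det (mxsub f g B)).
  by rewrite -map_mxsub det_map_mx.
apply: (@representable_transfer K2 P _ _ _ A (map_mx pi B)) => //.
  by move=> k f g injf injg; rewrite detP; apply: proj_elt.
move=> g; rewrite detP (pi_neq0 (lift_proj_lift_map R cardF hw)) //.
have E1 := mB _ id g.
rewrite -(fst_neq0 E1).
rewrite fstB.
by rewrite mulf_eq0 expf_eq0 (negPf dn0) andbF.
Qed.

End Main.

Local Close Scope ring_scope.

Theorem theorem4p17 (R : realType) (GF4 : finFieldType) (hGF4 : #|GF4| = 4)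
    (E : finType) (M : matroid E) :
  representable (pf_prod (pf_of_field GF4) (H2 R)) M <-> representable K2 M.
Proof.
have [w hw] := GF4_omega hGF4; split; first exact: (representable_K2 hGF4 hw).
exact: (representable_P R hGF4 hw).
Qed.
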